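(* Let $Q$ be a quiver, $s\ge 2$, and let $\beta_1,\dots,\beta_s\in\mathbb{N}^{Q_0}$ be non-zero dimension-vectors with sum $\alpha=\beta_1+\cdots+\beta_s$ such that $\langle\beta_i,\beta_j\rangle=0$ for all $i<j$. Let $\eta=\eta_{\beta_1\tilde{+}\cdots\tilde{+}\beta_s}$ be the map associated to this (ordered) decomposition of $\alpha$. Then $\delta(\eta)=0$ and $$\begin{aligned}d(\eta)&=\big(\beta_1\circ(\alpha-\beta_1)\big)\cdot\big(\beta_2\circ(\alpha-\beta_1-\beta_2)\big)\cdots\big(\beta_{s-1}\circ\beta_s\big)\\&=\big((\alpha-\beta_s)\circ\beta_s\big)\cdot\big((\alpha-\beta_s-\beta_{s-1})\circ\beta_{s-1}\big)\cdots\big(\beta_1\circ\beta_2\big).\end{aligned}$$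
   Context: The base field $\mathbb{K}$ is algebraically closed of characteristic zero. A quiver $Q$ is a finite oriented graph with vertex set $Q_0$ and arrow set $Q_1$; an arrow $a$ has initial vertex $ia$ and terminal vertex $ta$. For $\alpha\in\mathbb{N}^{Q_0}$ fix vector spaces $V(s)$ with $\dim V(s)=\alpha(s)$, $s\in Q_0$, and set ${\rm Rep}(Q,\alpha)=\bigoplus_{a\in Q_1}{\rm Hom}(V(ia),V(ta))$, acted on by ${\rm GL}(\alpha)=\prod_{s\in Q_0}{\rm GL}(V(s))$. The Ringel form is $\langle\alpha,\beta\rangle=\sum_{s\in Q_0}\alpha(s)\beta(s)-\sum_{a\in Q_1}\alpha(ia)\beta(ta)$. For $\alpha,\beta\in\mathbb{N}^{Q_0}$, $\alpha\circ\beta$ is the number of $\alpha$-dimensional subrepresentations of a general representation of dimension $\alpha+\beta$ if it is finite, and $0$ otherwise. Map associated to a decomposition: given $\alpha=\beta_1+\cdots+\beta_s$ with non-zero $\beta_i\in\mathbb{N}^{Q_0}$ (ordered; written $\alpha=\beta_1\tilde{+}\cdots\tilde{+}\beta_s$), choose for each vertex $p$ a decomposition $V(p)=V_1(p)\oplus\cdots\oplus V_s(p)$ with $\dim V_i(p)=\beta_i(p)$. Let $P\subset G={\rm GL}(\alpha)$ be the parabolic subgroup of all $g$ with $g(p)(V_i(p))\subset\bigoplus_{j\le i}V_j(p)$ for all $i,p$, and let $C^+\subset{\rm Rep}(Q,\alpha)$ be the set of all $u$ with $u(a)(V_i(ia))\subset\bigoplus_{j\le i}V_j(ta)$ for all $i$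 and $a$. Let $G\times_PC^+$ be the quotient of $G\times C^+$ by the $P$-action $p\cdot(g,y)=(gp^{-1},py)$, and write $[g:y]$ for the class of $(g,y)$. Then $\eta_{\beta_1\tilde{+}\cdots\tilde{+}\beta_s}:G\times_PC^+\to{\rm Rep}(Q,\alpha)$ is the map $[g:y]\mapsto gy$ (well defined up to conjugacy). Set $\delta(\eta)=\dim{\rm Rep}(Q,\alpha)-\dim(G/P)-\dim C^+$. If $\delta(\eta)=0$ and $\eta$ is dominant, $d(\eta)$ is the degree of the finite field extension $\mathbb{K}({\rm Rep}(Q,\alpha))\subset\mathbb{K}(G\times_PC^+)$ induced by $\eta$; otherwise $d(\eta)=0$. *)

(* Defs.v *)
From HB Require Import structures.
From mathcomp Require Import all_boot all_order all_algebra.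
(* The notations of mpoly clash with those of MathComp-Analysis. *)
From mathcomp Require Import -(notations) mpoly.
From mathcomp Require Import generic_quotient.
From mathcomp Require Import boolp classical_sets functions cardinality topology.

Set Implicit Arguments.
Unset Strict Implicit.
Unset Printing Implicit Defensive.

Import GRing.Theory.
Local Open Scope classical_set_scope.
Local Open Scope card_scope.
Local Open Scope ring_scope.
Local Open Scope quotient_scope.

(* A quasi-affine variety is presented by its set of points and by coordinate
   functions that generate its polynomial functions; [K^o] is the field seen as
   a vector space, so that the coordinates of a vector space are its linear
   forms. *)
Record coordSpace (K : fieldType) := CoordSpace {
  point_of :> Type;
  coordfun : set (point_of -> K) }.

Definition vect_space (K : fieldType) (I : Type) (E : I -> vectType K) :
    coordSpace K :=
  @CoordSpace K (forall i, E i)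
    [set f | exists i (l : 'Hom(E i, K^o)), f = fun x => l (x i)].

(* Meant for locally closed subsets [S]. *)
Definition sub_space (K : fieldType) (X : coordSpace K) (S : set X) :
    coordSpace K :=
  @CoordSpace K {x : X | S x} [set f | exists2 c, coordfun c & f = c \o sval].

Definition prod_space (K : fieldType) (X Y : coordSpace K) : coordSpace K :=
  @CoordSpace K (X * Y)%type
    ([set f | exists2 c, coordfun c & f = c \o fst] `|`
     [set f | exists2 c, coordfun c & f = c \o snd]).

Inductive polyfun (K : fieldType) (X : coordSpace K) : (X -> K) -> Prop :=
| polyfun_cst (c : K) : polyfun (fun=> c)
| polyfun_coord f : coordfun f -> polyfun f
| polyfunD f g : polyfun f -> polyfun g -> polyfun (fun x => f x + g x)
| polyfunM f g : polyfun f -> polyfun g -> polyfun (fun x => f x * g x).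

Definition zariski (K : fieldType) (X : coordSpace K) : Type := X.

Section ZariskiTopology.
Variables (K : fieldType) (X : coordSpace K).

Definition zariski_open (U : set (zariski X)) : Prop :=
  forall x, U x ->
    exists f, [/\ polyfun f, f x != 0 & forall y, f y != 0 -> U y].

Let zariski_openT : zariski_open setT.
Proof. by move=> x _; exists (fun=> 1); split; [exact: polyfun_cst|exact: oner_neq0|]. Qed.

Let zariski_openI : setI_closed zariski_open.
Proof.
move=> A B oA oB x [Ax Bx].
have [f [pf fx fA]] := oA _ Ax; have [g [pg gx gB]] := oB _ Bx.
exists (fun y => f y * g y); split; first exact: polyfunM.
  by rewrite mulf_neq0.
by move=> y; rewrite mulf_eq0 negb_or => /andP[/fA ? /gB ?]; split.
Qed.

Let zariski_open_bigU (I : Type) (F : I -> set (zariski X)) :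
  (forall i, zariski_open (F i)) -> zariski_open (\bigcup_i F i).
Proof.
move=> oF x [i _ Fx]; have [f [pf fx fF]] := oF i _ Fx.
by exists f; split=> // y /fF Fy; exists i.
Qed.

HB.instance Definition _ := gen_eqMixin (zariski X).
HB.instance Definition _ := gen_choiceMixin (zariski X).
HB.instance Definition _ := isOpenTopological.Build (zariski X)
  zariski_openT zariski_openI zariski_open_bigU.

End ZariskiTopology.

(* [regular U] is the set of regular functions on the open set [U]; the values
   outside [U] are irrelevant. *)
Record funSpace (K : fieldType) := FunSpace {
  carrier :> topologicalType;
  regular : set carrier -> set (carrier -> K) }.

Definition affine_regular (K : fieldType) (X : coordSpace K)
    (U : set (zariski X)) (f : zariski X -> K) : Prop :=
  forall x, U x -> exists p q : X -> K,
    [/\ polyfun p, polyfun q, q x != 0 &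
        forall y, U y -> q y != 0 -> f y = p y / q y].

Definition affine (K : fieldType) (X : coordSpace K) : funSpace K :=
  @FunSpace K (zariski X) (@affine_regular K X).

(* The geometric quotient, in the sense of spaces with functions: the final topology, and
   the functions that are regular after composition with the projection. *)
Definition quot_space (K : fieldType) (X : funSpace K) (e : equiv_rel X) :
    funSpace K :=
  @FunSpace K (quotient_topology {eq_quot e})
    (fun U f => regular (\pi_{eq_quot e} @^-1` U) (f \o \pi_{eq_quot e})).

Definition generically (T : topologicalType) (P : set T) : Prop :=
  exists U : set T, [/\ open U, U !=set0 & U `<=` P].

Record ratfun (K : fieldType) (X : funSpace K) := Ratfun {
  ratval :> X -> K;
  ratdom : set X;
  ratdom_open : open ratdom;
  ratdom_neq0 : ratdom !=set0;
  ratval_regular : regular ratdom ratval }.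

(* All the spaces considered below are irreducible, so that two rational
   functions are equal as elements of the function field if and only if they
   agree on some non-empty open set. *)

Definition alg_indep (K : fieldType) (X : funSpace K) (n : nat)
    (f : 'I_n -> ratfun X) : Prop :=
  forall q : mpoly n K,
    generically [set x | meval (fun i => f i x) q = 0] -> q = 0.

(* The transcendence degree of the function field over [K]. *)
Definition vdim (K : fieldType) (X : funSpace K) : nat :=
  xget 0%N [set n | (exists f : 'I_n -> ratfun X, alg_indep f) /\
                    ~ (exists f : 'I_n.+1 -> ratfun X, alg_indep f)].

Definition dominant (K : fieldType) (X Y : funSpace K) (phi : X -> Y) : Prop :=
  dense (range phi).

(* For a dominant morphism [phi], the function field of [X] has a basis with
   [d] elements over the image of the function field of [Y] under composition
   with [phi]. *)
Definition has_degree (K : fieldType) (X Y : funSpace K) (phi : X -> Y)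
    (d : nat) : Prop :=
  exists b : 'I_d -> ratfun X,
    (forall f : ratfun X, exists c : 'I_d -> ratfun Y,
       generically [set x | f x = \sum_i c i (phi x) * b i x]) /\
    (forall c : 'I_d -> ratfun Y,
       generically [set x | \sum_i c i (phi x) * b i x = 0] ->
       forall i, generically [set y | c i y = 0]).

Record quiver := Quiver {
  vertex : finType;
  arrow : finType;
  ia : arrow -> vertex;
  ta : arrow -> vertex }.

Definition ringel (Q : quiver) (a b : vertex Q -> nat) : int :=
  \sum_(p : vertex Q) (a p * b p)%N%:Z -
  \sum_(e : arrow Q) (a (ia e) * b (ta e))%N%:Z.

Section Representations.
Variables (K : fieldType) (Q : quiver) (V : vertex Q -> vectType K).

Definition Rep : coordSpace K :=
  vect_space (fun e : arrow Q => 'Hom(V (ia e), V (ta e)) : vectType K).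

Definition Endo : coordSpace K :=
  vect_space (fun p : vertex Q => 'End(V p) : vectType K).

Definition GL : coordSpace K :=
  sub_space [set g : Endo | forall p, lker (g p) == 0%VS].

Definition gmul (g h : Endo) : Endo := fun p => (g p \o h p)%VF.
Definition ginv (g : Endo) : Endo := fun p => (g p)^-1%VF.
Definition gact (g : Endo) (u : Rep) : Rep :=
  fun e => (g (ta e) \o u e \o (g (ia e))^-1)%VF.

Definition subreps (u : Rep) (gamma : vertex Q -> nat) :
    set (forall p, {vspace V p}) :=
  [set W | (forall p, \dim (W p) = gamma p) /\
           (forall e, (u e @: W (ia e) <= W (ta e))%VS)].

End Representations.

(* The value is 0 when a general representation has infinitely many such
   subrepresentations, since then no [n] satisfies the predicate. *)
Definition circ (K : fieldType) (Q : quiver) (a b : vertex Q -> nat) : nat :=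
  xget 0%N [set n |
    generically [set u : zariski (Rep (fun p => 'cV[K]_(a p + b p) : vectType K)) |
                 subreps u a #= `I_n]].

Section Decomposition.
Variables (K : fieldType) (Q : quiver) (V : vertex Q -> vectType K) (s : nat).
Variable W : forall p, 'I_s -> {vspace V p}.

Definition flag p (i : 'I_s) : {vspace V p} := (\sum_(j < s | (j <= i)%N) W p j)%VS.

Definition parabolic : set (GL V) :=
  [set g | forall p i, (sval g p @: W p i <= flag p i)%VS].

Definition Cplus : coordSpace K :=
  sub_space [set u : Rep V | forall e i, (u e @: W (ia e) i <= flag (ta e) i)%VS].

(* The orbits of [h . g = g h^-1], [h] in the parabolic subgroup. *)
Definition GP_rel (g g' : affine (GL V)) : bool :=
  `[< exists2 h, parabolic h & sval g' = gmul (sval g) (ginv (sval h)) >].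

(* The orbits of [h . (g, y) = (g h^-1, h y)]. *)
Definition GPC_rel (x x' : affine (prod_space (GL V) Cplus)) : bool :=
  `[< exists2 h, parabolic h &
        sval x'.1 = gmul (sval x.1) (ginv (sval h)) /\
        sval x'.2 = gact (sval h) (sval x.2) >].

Lemma GL1 : [set g : Endo V | forall p, lker (g p) == 0%VS] (fun p => \1%VF).
Proof. by move=> p; apply/lker0P => u v; rewrite !id_lfunE. Qed.

Lemma GLM (g h : GL V) :
  [set g : Endo V | forall p, lker (g p) == 0%VS] (gmul (sval g) (sval h)).
Proof.
move=> p; apply/lker0P => u v; rewrite !comp_lfunE.
have /lker0P gI := svalP g p; have /lker0P hI := svalP h p.
by move/gI/hI.
Qed.

Lemma GLV (g : GL V) :
  [set g : Endo V | forall p, lker (g p) == 0%VS] (ginv (sval g)).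
Proof.
by move=> p; apply/lker0P; exact: can_inj (lker0_lfunVK (svalP g p)).
Qed.

Lemma sub_flag p i : (W p i <= flag p i)%VS.
Proof. by rewrite /flag (bigD1 i) //= addvSl. Qed.

Lemma flag_mono p (i j : 'I_s) : (i <= j)%N -> (flag p i <= flag p j)%VS.
Proof.
move=> ij; apply/subv_sumP => k ki.
by rewrite /flag (bigD1 k) /= ?addvSl // (leq_trans ki).
Qed.

Lemma parabolic_flag (g : GL V) p i :
  parabolic g -> (sval g p @: flag p i <= flag p i)%VS.
Proof.
move=> Pg; rewrite /flag limg_sum; apply/subv_sumP => j ji.
apply: (subv_trans (Pg p j)); exact: flag_mono.
Qed.

Lemma parabolic1 : parabolic (exist _ _ GL1).
Proof. by move=> p i /=; rewrite lim1g; exact: sub_flag. Qed.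

Lemma parabolicM (g h : GL V) :
  parabolic g -> parabolic h -> parabolic (exist _ _ (GLM g h)).
Proof.
move=> Pg Ph p i /=; rewrite limg_comp.
apply: (subv_trans (limgS _ (Ph p i))); exact: parabolic_flag.
Qed.

Lemma parabolicV (g : GL V) : parabolic g -> parabolic (exist _ _ (GLV g)).
Proof.
move=> Pg p i /=.
have /eqP gF : (sval g p @: flag p i == flag p i)%VS.
  by rewrite eqEdim parabolic_flag //= limg_dim_eq // (eqP (svalP g p)) capv0.
apply: (subv_trans (limgS _ (sub_flag p i))).
by rewrite -{1}gF -limg_comp lker0_compVf ?(svalP g p) // lim1g.
Qed.

Lemma lfun_invM p (g h : 'End(V p)) : lker g == 0%VS -> lker h == 0%VS ->
  ((g \o h)^-1 = h^-1 \o g^-1)%VF.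
Proof.
move=> g0 h0.
have gh0 : lker (g \o h)%VF == 0%VS.
  apply/lker0P => u v; rewrite !comp_lfunE.
  by move: g0 h0 => /lker0P gI /lker0P hI /gI/hI.
apply/lfunP => v; have /lker0P ghI := gh0; apply: ghI; rewrite lker0_lfunVK //.
by rewrite !comp_lfunE !lker0_lfunVK.
Qed.

Lemma gactM (g h : GL V) (u : Rep V) :
  gact (gmul (sval g) (sval h)) u = gact (sval g) (gact (sval h) u).
Proof.
apply: functional_extensionality_dep => e; rewrite /gact /gmul lfun_invM ?(svalP g) ?(svalP h) //.
by rewrite !comp_lfunA.
Qed.

Lemma ginvM (g h : GL V) :
  ginv (gmul (sval g) (sval h)) = gmul (ginv (sval h)) (ginv (sval g)).
Proof. by apply: functional_extensionality_dep => p; exact: lfun_invM (svalP g p) (svalP h p). Qed.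

Lemma lfun_inv1 p : (\1^-1 = \1 :> 'End(V p))%VF.
Proof.
have i1 : lker (\1%VF : 'End(V p)) == 0%VS := GL1 p.
by rewrite -[LHS]comp_lfun1l lker0_compfV.
Qed.

Lemma lfun_invK p (g : 'End(V p)) : lker g == 0%VS -> (g^-1^-1 = g)%VF.
Proof.
move=> g0; have gV0 : lker g^-1%VF == 0%VS.
  by apply/lker0P; exact: can_inj (lker0_lfunVK g0).
apply/lfunP => v; have /lker0P gI := gV0; apply: gI; rewrite lker0_lfunVK //.
by rewrite lker0_lfunK.
Qed.

Lemma ginvK (g : GL V) : ginv (ginv (sval g)) = sval g.
Proof. by apply: functional_extensionality_dep => p; exact: lfun_invK (svalP g p). Qed.

Lemma gmul1 (g : Endo V) : gmul g (ginv (fun p => \1%VF)) = g.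
Proof. by apply: functional_extensionality_dep => p; rewrite /gmul /ginv lfun_inv1 comp_lfun1r. Qed.

Lemma gact1 (u : Rep V) : gact (fun p => \1%VF) u = u.
Proof. by apply: functional_extensionality_dep => e; rewrite /gact lfun_inv1 comp_lfun1r comp_lfun1l. Qed.

Lemma gmulA (g h k : Endo V) : gmul g (gmul h k) = gmul (gmul g h) k.
Proof. by apply: functional_extensionality_dep => p; rewrite /gmul comp_lfunA. Qed.

Lemma gmulKV (g : Endo V) (h : GL V) : gmul (gmul g (ginv (sval h))) (sval h) = g.
Proof. by apply: functional_extensionality_dep => p; rewrite /gmul lker0_compfVK // (svalP h). Qed.

Lemma gactK (h : GL V) (u : Rep V) :
  gact (ginv (sval h)) (gact (sval h) u) = u.
Proof.
rewrite -(gactM (exist _ _ (GLV h)) h) /= -[RHS]gact1; congr gact.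
by apply: functional_extensionality_dep => p; rewrite /gmul lker0_compVf // (svalP h).
Qed.

Lemma GP_rel_sym g g' : GP_rel g g' -> GP_rel g' g.
Proof.
move=> /asboolP[h Ph E]; apply/asboolP; exists (exist _ _ (GLV h)).
  exact: parabolicV.
by rewrite /= ginvK E gmulKV.
Qed.

Lemma GP_equiv : equiv_class_of GP_rel.
Proof.
split=> [g|g g'|g' g g''].
- by apply/asboolP; exists (exist _ _ GL1); [exact: parabolic1|rewrite /= gmul1].
- by apply/idP/idP; exact: GP_rel_sym.
move=> /asboolP[h Ph E] /asboolP[k Pk E']; apply/asboolP.
exists (exist _ _ (GLM k h)); first exact: parabolicM.
by rewrite /= ginvM gmulA -E.
Qed.

Lemma GPC_rel_sym x x' : GPC_rel x x' -> GPC_rel x' x.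
Proof.
move=> /asboolP[h Ph [E F]]; apply/asboolP; exists (exist _ _ (GLV h)).
  exact: parabolicV.
by split; rewrite /= ?ginvK ?E ?gmulKV // F gactK.
Qed.

Lemma GPC_equiv : equiv_class_of GPC_rel.
Proof.
split=> [x|x x'|x' x x''].
- apply/asboolP; exists (exist _ _ GL1); first exact: parabolic1.
  by rewrite /= gmul1 gact1.
- by apply/idP/idP; exact: GPC_rel_sym.
move=> /asboolP[h Ph [E F]] /asboolP[k Pk [E' F']]; apply/asboolP.
exists (exist _ _ (GLM k h)); first exact: parabolicM.
by rewrite /= ginvM gmulA -E gactM -F.
Qed.

Definition GP : funSpace K :=
  quot_space (EquivRelPack GP_equiv).

Definition GPC : funSpace K :=
  quot_space (EquivRelPack GPC_equiv).

Definition eta (q : GPC) : affine (Rep V) :=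
  let x := repr q in gact (sval x.1) (sval x.2).

Lemma eta_pi (g : GL V) (y : Cplus) :
  eta (\pi_({eq_quot EquivRelPack GPC_equiv}) (g, y)) =
  gact (sval g) (sval y).
Proof.
rewrite /eta; have : GPC_rel (g, y) (repr (\pi_({eq_quot EquivRelPack GPC_equiv}) (g, y) : GPC)).
  by rewrite -[GPC_rel _ _]/(EquivRelPack GPC_equiv _ _) -eqmodE reprK.
case/asboolP => h Ph [-> ->].
by rewrite (gactM g (exist _ _ (GLV h))) /= gactK.
Qed.

Definition delta_eta : int :=
  (vdim (affine (Rep V)))%:Z - (vdim GP)%:Z - (vdim (affine Cplus))%:Z.

Definition d_eta : nat :=
  if `[< delta_eta = 0 /\ dominant eta >] then xget 0%N (has_degree eta) else 0%N.

End Decomposition.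

(* Main.v *)
(* On the big cell U^- x C^+ of G x_P C^+ the map eta is (m, y) |-> (1 + m) y (1 + m)^-1, a
   polynomial map between affine spaces whose dimensions agree because <beta_i, beta_j> = 0
   for i < j.  In characteristic zero the degree of the function field extension of such a
   map is the number of points of its generic fibre (primitive element theorem and
   specialization of the minimal polynomial), and the map is not dominant exactly when the
   generic fibre is empty.  Moving a general representation by a general element of G shows
   that all its flags lie in the big cell; for s = 2 the generic number of points is
   therefore beta_1 o beta_2.  Finally 1 + m factors along a splitting of the levels into
   two blocks, and the points of the two-step fibre over a general representation have
   general diagonal blocks, because the image of a proper closed subset is not dense.  Hence
   the generic numbers multiply; splitting off the first, or the last, level repeatedly
   gives the two products. *)

Require Import Defs.
From HB Require Import structures.
From mathcomp Require Import all_boot all_order all_algebra.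
From mathcomp Require Import fraction separable.
From mathcomp Require Import -(notations) mpoly.
From mathcomp Require Import generic_quotient.
From mathcomp Require Import boolp classical_sets functions cardinality topology.

Set Implicit Arguments.
Unset Strict Implicit.
Unset Printing Implicit Defensive.

Import GRing.Theory.

Local Open Scope classical_set_scope.
Local Open Scope ring_scope.

(** * Polynomials over an algebraically closed field *)

(** The development works with polynomial and regular functions only, so each geometric fact has an
    algebraic substitute. A polynomial map between affine spaces of equal dimension falls under one
    dichotomy: either its coordinates are algebraically dependent, and a non-zero polynomial
    vanishes on the image, or they are independent, and a transcendence degree count makes the
    function field extension finite. The quotients [GP] and [GPC] enter through a section of the
    projection over the big cell, a saturated open set; this turns dimension and degree into
    invariants of the map in coordinates. The obstacle is a flag outside the big cell, which the
    polynomial map does not see. Finiteness deals with it: one group element carries the [n] flags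
    in the cell and the extra one into the cell at once, over a representation that is still general
    and therefore has only [n]. The two products agree because the degree belongs to [W] alone: it
    can be computed with any basis index types having the right number of elements in each level,
    and these can be nested to the right or to the left. *)

Lemma muni_eq0 (K : idomainType) n (q : mpoly n.+1 K) : (muni q == 0) = (q == 0).
Proof.
apply/eqP/eqP => [u0|->]; last by rewrite muni0.
apply/eqP; apply/negPn/negP => qn0.
have := qn0; rewrite -mleadc_eq0; set m := mlead q; move/eqP; apply.
pose red (m : multinom n.+1) := Multinom (mktuple (fun i => m (widen_ord (leqnSn n) i))).
(* [red m] and [m ord_max] together determine [m], so the leading coefficient of [q] occurs
   unchanged among the coefficients of [muni q]. *)
have := congr1 (fun p : {poly mpoly n K} => mcoeff (red m) p`_(m ord_max)) u0.
rewrite /= coef0 mcoeff0 muniE.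
rewrite coef_sum raddf_sum /= (bigD1_seq m) ?msupp_uniq ?mlead_supp //=.
rewrite coefZ coefXn eqxx mulr1 mcoeffZ mcoeffX eqxx mulr1 big1 ?addr0 //.
move=> m' mm'; rewrite coefZ coefXn; case: eqP => [e|]; last by rewrite mulr0 mcoeff0.
rewrite mulr1 mcoeffZ mcoeffX; case: eqP => [e'|]; last by rewrite mulr0.
case/eqP: mm'; apply/mnmP => i; case: (unliftP ord_max i) => [j ->|-> //].
have -> : lift ord_max j = widen_ord (leqnSn n) j.
  by apply: val_inj; rewrite /= /bump leqNgt ltn_ord.
by move/mnmP/(_ j): e'; rewrite !mnmE.
Qed.

Lemma mmap_muni (K S : comNzRingType) (f : {rmorphism K -> S}) n (h : 'I_n.+1 -> S)
    (q : mpoly n.+1 K) :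
  mmap f h q =
  (map_poly (mmap f (fun i => h (widen_ord (leqnSn n) i))) (muni q)).[h ord_max].
Proof.
rewrite muniE raddf_sum horner_sum; apply: eq_bigr => m _ /=.
rewrite map_polyZ map_polyXn !hornerE [X in _ = X * _]mmapZ mmapX /mmap1.
rewrite big_ord_recr /= mulrA.
by congr (_ * _ * _); apply: eq_bigr => i _; rewrite mnmE.
Qed.

(** Induction on the number of variables: the leading coefficient in the last variable is non-zero
    at some [v], and the resulting non-zero polynomial in one variable has a non-root because the
    field is algebraically closed, hence infinite. *)
Lemma mpoly_eval_neq0 (K : closedFieldType) n (q : mpoly n K) :
  q != 0 -> exists v, meval v q != 0.
Proof.
elim: n => [|n IH] in q *.
  move=> q0; exists (fun=> 0); apply: contraNneq q0 => q0.
  apply/eqP/mpolyP => m; rewrite mcoeff0.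
  have qC : q = mpolyC 0 (mcoeff mnm0 q).
    apply/mpolyP => m'; have -> : m' = mnm0 by apply/mnmP; case.
    by rewrite mcoeffC eqxx mulr1.
  have -> : m = mnm0 by apply/mnmP; case.
  by move: q0; rewrite [in X in X -> _]qC mevalC.
rewrite -muni_eq0 -lead_coef_eq0 => /IH [v vn0].
have /closed_nonrootP[t tn0] : map_poly (meval v) (muni q) != 0.
  by apply: contraNneq vn0 => e; rewrite -coef_map e coef0.
exists (fun i => if unlift ord_max i is Some j then v j else t).
rewrite /meval mmap_muni unlift_none; move: tn0; rewrite rootE.
congr (_.[_] != 0); apply: eq_map_poly => p; apply: meval_eq => i.
have -> : widen_ord (leqnSn n) i = lift ord_max i.
  by apply: val_inj; rewrite /= /bump leqNgt ltn_ord.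
by rewrite liftK.
Qed.

Lemma msizeM_leS (K : idomainType) n (p q : mpoly n K) d e :
  (mmeasure mdeg p <= d.+1 -> mmeasure mdeg q <= e.+1 ->
   mmeasure mdeg (p * q)%R <= (d + e).+1)%N.
Proof.
have [->|p0] := eqVneq p 0; first by rewrite mul0r mmeasure0.
have [->|q0] := eqVneq q 0; first by rewrite mulr0 mmeasure0.
rewrite msizeM // => hp hq; apply: leq_trans (_ : (d.+1 + e.+1).-1 <= _)%N.
  by rewrite -!subn1 leq_sub2r // leq_add.
by rewrite addSn addnS.
Qed.

Lemma msize_prod_leS (K : idomainType) n I (r : seq I) (F : I -> mpoly n K) (d : I -> nat) :
  (forall i, mmeasure mdeg (F i) <= (d i).+1)%N ->
  (mmeasure mdeg (\prod_(i <- r) F i)%R <= (\sum_(i <- r) d i).+1)%N.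
Proof.
move=> h; elim: r => [|i r IH]; first by rewrite !big_nil msize1.
by rewrite !big_cons; apply: msizeM_leS.
Qed.

Lemma msize_exp_leS (K : idomainType) n (p : mpoly n K) d k :
  (mmeasure mdeg p <= d.+1 -> mmeasure mdeg (p ^+ k)%R <= (k * d).+1)%N.
Proof.
move=> h; elim: k => [|k IH]; first by rewrite expr0 msize1.
by rewrite exprS mulSn; apply: msizeM_leS.
Qed.

Lemma mulmx_kernel (K : fieldType) m n (A : 'M[K]_(m, n)) :
  (n < m)%N -> exists2 v : 'rV_m, v != 0 & v *m A = 0.
Proof.
move=> nm; have : kermx A != 0.
  rewrite kermx_eq0 /row_free; apply: contraL nm => /eqP <-.
  by rewrite -leqNgt rank_leq_col.
by case/rowV0Pn => v /sub_kermxP ? ?; exists v.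
Qed.

(* Siegel's pigeonhole: there are [k ^ N.+1] monomials with exponents below [k]
   in the [F i] and [D], and they live in a space of dimension [O (k ^ N)]. *)
Lemma mpoly_alg_dep (K : fieldType) N (F : 'I_N.+1 -> mpoly N K) (D : mpoly N K) :
  exists k (c : {ffun 'I_N.+1 -> 'I_k} -> K),
    (exists a, c a != 0) /\
    \sum_a c a *: \prod_i (F i ^+ a i * D ^+ (k - a i)) = 0.
Proof.
pose B := (mmeasure mdeg D + \sum_i mmeasure mdeg (F i))%N.
have FB i : (mmeasure mdeg (F i) <= B.+1)%N.
  by rewrite leqW // /B (bigD1 i) //= addnCA leq_addr.
have DB : (mmeasure mdeg D <= B.+1)%N by rewrite leqW // leq_addr.
(* Each [term a] has degree at most [(N+1) k B < S], so it lies in the span of [S^N = k^N C^N]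
   monomials. Taking [k = C^N + 1] makes the number [k^(N+1)] of terms larger than that. *)
pose C := (N.+1 * B).+1; pose k := (C ^ N).+1; pose S := (k * C)%N.
pose term (a : {ffun 'I_N.+1 -> 'I_k}) := \prod_i (F i ^+ a i * D ^+ (k - a i)).
have termS a : (mmeasure mdeg (term a) <= S)%N.
  apply: leq_trans (_ : (\sum_(i < N.+1) k * B).+1 <= _)%N.
    apply: msize_prod_leS => i.
    apply: leq_trans (msizeM_leS (msize_exp_leS _ (FB i)) (msize_exp_leS _ DB)) _.
    by rewrite -mulnDl subnKC // ltnW.
  by rewrite sum_nat_const card_ord /S /C mulnS mulnCA addSn ltnS leq_addl.
pose mon (j : {ffun 'I_N -> 'I_S}) := Multinom (mktuple (fun i => j i : nat)).
pose A := \matrix_(i < #|{ffun 'I_N.+1 -> 'I_k}|, j < #|{ffun 'I_N -> 'I_S}|)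
  mcoeff (mon (enum_val j)) (term (enum_val i)).
have [|v v0 vA] := @mulmx_kernel _ _ _ A.
  rewrite !card_ffun !card_ord /S expnMn expnS.
  by rewrite mulnC ltn_pmul2r ?expn_gt0.
exists k, (fun a => v ord0 (enum_rank a)); split.
  have /rV0Pn[j vj] := v0; exists (enum_val j); by rewrite enum_valK.
apply/mpolyP => m; rewrite mcoeff0 raddf_sum /=.
have [/forallP mS|] := boolP [forall i, (m i < S)%N]; last first.
  rewrite negb_forall => /existsP[i mi]; apply: big1 => a _.
  rewrite mcoeffZ memN_msupp_eq0 ?mulr0 //; apply: msize_mdeg_ge.
  apply: leq_trans (termS a) _; rewrite -leqNgt in mi; apply: leq_trans mi _.
  by rewrite mdegE (bigD1 i) //= leq_addr.
pose j := [ffun i => Ordinal (mS i)].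
have mj : mon j = m by apply/mnmP => i; rewrite mnmE ffunE.
move/matrixP/(_ ord0 (enum_rank j)): vA; rewrite !mxE => e; rewrite -[RHS]e.
rewrite (reindex enum_rank) /=; last by apply: onW_bij; exact: enum_rank_bij.
by apply: eq_bigr => a _; rewrite mcoeffZ !mxE !enum_rankK mj.
Qed.

(** * Fractions and their specialization *)

Local Notation "x %:F" := (@FracField.tofrac _ x).

Lemma frac_repr (R : idomainType) (f : {fraction R}) :
  f = (\n_(repr f))%:F / (\d_(repr f))%:F.
Proof.
apply: (canRL (mulfK _)); first by rewrite tofrac_eq0 denom_ratioP.
rewrite -{1}[f]reprK; move: (repr f) => x; have d0 := denom_ratioP x.
unlock FracField.tofrac; rewrite -[LHS]FracField.pi_mul.
apply/eqmodP; rewrite /= FracField.equivfE /FracField.mulf.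
by rewrite !numden_Ratio ?mulr1 ?oner_neq0 // mulrC.
Qed.

Lemma fracP (R : idomainType) (f : {fraction R}) :
  exists a b, b != 0 /\ f = a%:F / b%:F.
Proof.
exists (\n_(repr f)), (\d_(repr f)); split; [exact: denom_ratioP|exact: frac_repr].
Qed.

Section FracLift.
Variables (R : idomainType) (F : fieldType) (h : {rmorphism R -> F}).
Hypothesis h_inj : injective h.

Let h_neq0 b : b != 0 -> h b != 0.
Proof. by move=> b0; rewrite -(rmorph0 h) (inj_eq h_inj). Qed.

(* The hypothesis is an argument so that the canonical structures can use it. *)
Definition frac_lift (_ : injective h) (f : {fraction R}) : F :=
  h \n_(repr f) / h \d_(repr f).

Lemma frac_liftE a b : b != 0 -> frac_lift h_inj (a%:F / b%:F) = h a / h b.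
Proof.
move=> b0; set f := _ / _; rewrite /frac_lift.
have d0 := denom_ratioP (repr f); have fE := frac_repr f.
apply/eqP; rewrite eqr_div ?h_neq0 // -!rmorphM; apply/eqP; congr (h _).
apply/eqP; rewrite -tofrac_eq !rmorphM /=.
by rewrite -eqr_div ?tofrac_eq0 // -fE.
Qed.

Fact frac_lift_is_zmod_morphism : zmod_morphism (frac_lift h_inj).
Proof.
move=> f g; have [a [b [b0 ->]]] := fracP f; have [c [d [d0 ->]]] := fracP g.
rewrite -mulNr -rmorphN addf_div ?tofrac_eq0 // -!rmorphM -rmorphD.
rewrite !frac_liftE ?mulf_neq0 // -mulNr addf_div ?h_neq0 //.
by rewrite rmorphD !rmorphM rmorphN.
Qed.

Fact frac_lift_is_monoid_morphism : monoid_morphism (frac_lift h_inj).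
Proof.
split=> [|f g].
  have := @frac_liftE 1 1 (oner_neq0 _); rewrite !rmorph1 divr1 => ->.
  by rewrite divr1.
have [a [b [b0 ->]]] := fracP f; have [c [d [d0 ->]]] := fracP g.
rewrite mulf_div -!rmorphM !frac_liftE ?mulf_neq0 // mulf_div.
by rewrite !rmorphM.
Qed.

HB.instance Definition _ := GRing.isZmodMorphism.Build {fraction R} F
  (frac_lift h_inj) frac_lift_is_zmod_morphism.
HB.instance Definition _ := GRing.isMonoidMorphism.Build {fraction R} F
  (frac_lift h_inj) frac_lift_is_monoid_morphism.

Lemma frac_lift_tofrac a : frac_lift h_inj a%:F = h a.
Proof. by rewrite -[a%:F]divr1 -(rmorph1 (@FracField.tofrac R)) frac_liftE ?oner_neq0 // rmorph1 divr1. Qed.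

End FracLift.

Section Specialization.
Variables (K : fieldType) (n : nat) (y : 'I_n -> K).
Local Notation L := {fraction mpoly n K}.

(* The residue map of the local ring at [y], as a relation. *)
Definition specializes (f : L) (c : K) : Prop :=
  exists a b, [/\ meval y b != 0, f * b%:F = a%:F & c * meval y b = meval y a].

Lemma specializes_uniq f c c' : specializes f c -> specializes f c' -> c = c'.
Proof.
move=> [a [b [b0 fb cb]]] [a' [b' [b'0 fb' cb']]].
apply: (mulIf (mulf_neq0 b0 b'0)); rewrite mulrA cb mulrCA cb' -!mevalM.
congr (meval y _); apply/eqP; rewrite -tofrac_eq !rmorphM /= -fb -fb'.
by rewrite mulrCA mulrA.
Qed.

Lemma specializes_poly a : specializes a%:F (meval y a).
Proof. by exists a, 1; rewrite !rmorph1 oner_neq0 !mulr1. Qed.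

Lemma specializesD f g c d :
  specializes f c -> specializes g d -> specializes (f + g) (c + d).
Proof.
move=> [a [b [b0 fb cb]]] [a' [b' [b'0 gb db]]].
exists (a * b' + a' * b), (b * b'); split; first by rewrite mevalM mulf_neq0.
  by rewrite rmorphD !rmorphM /= mulrDl mulrA fb mulrCA gb [b%:F * _]mulrC.
by rewrite mevalD !mevalM mulrDl mulrA cb mulrCA db [meval y b * _]mulrC.
Qed.

Lemma specializesM f g c d :
  specializes f c -> specializes g d -> specializes (f * g) (c * d).
Proof.
move=> [a [b [b0 fb cb]]] [a' [b' [b'0 gb db]]].
exists (a * a'), (b * b'); split; first by rewrite mevalM mulf_neq0.
  by rewrite !rmorphM /= mulrACA fb gb.
by rewrite !mevalM mulrACA cb db.
Qed.

Lemma specializes0 : specializes 0 0.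
Proof. by have := specializes_poly 0; rewrite !rmorph0. Qed.

Lemma specializes1 : specializes 1 1.
Proof. by have := specializes_poly 1; rewrite !rmorph1. Qed.

Lemma specializesN f c : specializes f c -> specializes (- f) (- c).
Proof.
move=> h; rewrite -mulN1r -[- c]mulN1r; apply: specializesM => //.
by have := specializes_poly (- 1); rewrite !rmorphN !rmorph1.
Qed.

Lemma specializes_sum I (r : seq I) (f : I -> L) c :
  (forall i, specializes (f i) (c i)) ->
  specializes (\sum_(i <- r) f i) (\sum_(i <- r) c i).
Proof.
move=> h; elim: r => [|i r IH]; first by rewrite !big_nil; exact: specializes0.
by rewrite !big_cons; apply: specializesD.
Qed.

Lemma specializesX f c k : specializes f c -> specializes (f ^+ k) (c ^+ k).
Proof.
move=> h; elim: k => [|k IH]; first by rewrite !expr0; exact: specializes1.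
by rewrite !exprS; apply: specializesM.
Qed.

Definition specializes_upoly (P : {poly L}) (p : {poly K}) : Prop :=
  forall k, specializes P`_k p`_k.

Lemma specializes_upoly_uniq P p q :
  specializes_upoly P p -> specializes_upoly P q -> p = q.
Proof. by move=> hp hq; apply/polyP => k; exact: specializes_uniq (hp k) (hq k). Qed.

Lemma specializes_upolyD P Q p q : specializes_upoly P p -> specializes_upoly Q q ->
  specializes_upoly (P + Q) (p + q).
Proof. by move=> hp hq k; rewrite !coefD; apply: specializesD. Qed.

Lemma specializes_upolyN P p : specializes_upoly P p -> specializes_upoly (- P) (- p).
Proof. by move=> hp k; rewrite !coefN; apply: specializesN. Qed.

Lemma specializes_upolyM P Q p q : specializes_upoly P p -> specializes_upoly Q q ->
  specializes_upoly (P * Q) (p * q).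
Proof.
by move=> hp hq k; rewrite !coefM; apply: specializes_sum => i; apply: specializesM.
Qed.

Lemma specializes_upolyC f c : specializes f c -> specializes_upoly f%:P c%:P.
Proof. by move=> h k; rewrite !coefC; case: eqP => // _; exact: specializes0. Qed.

Lemma specializes_upolyX P p k :
  specializes_upoly P p -> specializes_upoly (P ^+ k) (p ^+ k).
Proof.
move=> h; elim: k => [|k IH].
  by rewrite !expr0; apply: specializes_upolyC; exact: specializes1.
by rewrite !exprS; apply: specializes_upolyM.
Qed.

Lemma specializes_upoly_deriv P p :
  specializes_upoly P p -> specializes_upoly (deriv P) (deriv p).
Proof.
move=> h k; rewrite !coef_deriv; have := h k.+1; move: (P`_k.+1) (p`_k.+1) => f c fc.
elim: k.+1 => [|m IH]; first exact: specializes0.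
by rewrite !mulrS; apply: specializesD.
Qed.

Lemma specializes_mmap m (h : 'I_m -> {poly L}) h' (q : mpoly m K) :
  (forall i, specializes_upoly (h i) (h' i)) ->
  specializes_upoly (mmap (polyC \o (@FracField.tofrac _ \o @mpolyC n K)) h q) (mmap polyC h' q).
Proof.
move=> hh; rewrite /mmap; elim: (msupp q) => [|a r IH].
  by rewrite !big_nil => k; rewrite !coef0; exact: specializes0.
rewrite !big_cons; apply: specializes_upolyD => //; apply: specializes_upolyM.
  apply: specializes_upolyC; rewrite /= -{2}(mevalC y (mcoeff a q)).
  exact: specializes_poly.
rewrite /mmap1; elim: (index_enum _) => [|i s IHs].
  by rewrite !big_nil; apply: specializes_upolyC; exact: specializes1.
by rewrite !big_cons; apply: specializes_upolyM => //; apply: specializes_upolyX.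
Qed.

Lemma specializes_horner P p f c :
  specializes_upoly P p -> specializes f c -> specializes P.[f] p.[c].
Proof.
move=> h hf; pose s := maxn (size P) (size p).
rewrite (@horner_coef_wide _ s) ?leq_maxl // (@horner_coef_wide _ s p) ?leq_maxr //.
by apply: specializes_sum => i; apply: specializesM => //; exact: specializesX.
Qed.

End Specialization.

Section GenericSpecialization.
Variables (K : fieldType) (n : nat).
Local Notation L := {fraction mpoly n K}.

Lemma specializes_generic (f : L) : exists2 g : mpoly n K, g != 0 &
  forall y, meval y g != 0 -> exists c, specializes y f c.
Proof.
have [a [b [b0 ->]]] := fracP f; exists b => // y yb.
exists (meval y a / meval y b), a, b; split=> //; last by rewrite divfK.
by rewrite divfK // tofrac_eq0.
Qed.

Lemma specializes_upoly_generic (P : {poly L}) : exists2 g : mpoly n K, g != 0 &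
  forall y, meval y g != 0 -> exists p, specializes_upoly y P p.
Proof.
have /choice[g hg] : forall k : nat, exists g : mpoly n K, g != 0 /\
    forall y, meval y g != 0 -> exists c, specializes y P`_k c.
  by move=> k; have [g g0 hg] := specializes_generic P`_k; exists g.
exists (\prod_(k < size P) g k); first by apply/prodf_neq0 => k _; case: (hg k).
move=> y; rewrite rmorph_prod => /prodf_neq0 yg.
have /choice[c hc] : forall k : 'I_(size P), exists c, specializes y P`_k c.
  by move=> k; apply: (hg k).2; apply: yg.
exists (\poly_(k < size P) if insub k is Some i then c i else 0) => k.
rewrite coef_poly; case: ltnP => kP; last first.
  by rewrite nth_default //; exact: specializes0.
by rewrite insubT; exact: hc (Sub k kP).
Qed.

End GenericSpecialization.

(** Over a common denominator the fractions are [F i / D]. The powers of [D] in [mpoly_alg_dep]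
    homogenize its relation, so dividing by [D ^ ((N+1) k)] leaves a polynomial relation among the
    fractions; it is non-zero because distinct exponents give distinct monomials. *)
Lemma frac_alg_dep (K : fieldType) N (f : 'I_N.+1 -> {fraction mpoly N K}) :
  exists2 q : mpoly N.+1 K, q != 0 &
    mmap (@FracField.tofrac _ \o @mpolyC N K) f q = 0.
Proof.
have /choice[a /choice[b ab]] : forall i, exists a b, b != 0 /\ f i = a%:F / b%:F.
  by move=> i; exact: fracP.
pose D := \prod_i b i; have D0 : D != 0 by apply/prodf_neq0 => i _; case: (ab i).
pose F i := a i * \prod_(j | j != i) b j.
have FE i : (F i)%:F = f i * D%:F.
  rewrite (ab i).2 /D (bigD1 i) //= !rmorphM /= mulrA divfK //.
  by rewrite tofrac_eq0 (ab i).1.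
have [k [c [[a0 ca0] cE]]] := mpoly_alg_dep F D.
pose mon (j : {ffun 'I_N.+1 -> 'I_k}) := Multinom (mktuple (fun i => j i : nat)).
have mon_inj : injective mon.
  move=> j j' /mnmP e; apply/ffunP => i; apply: val_inj => /=.
  by have := e i; rewrite !mnmE.
exists (\sum_j c j *: mpolyX K (mon j)).
  apply: contraNneq ca0 => /(congr1 (mcoeff (mon a0))).
  rewrite mcoeff0 raddf_sum /= (bigD1 a0) //= mcoeffZ mcoeffX eqxx mulr1.
  rewrite big1 ?addr0 => [->//|j ja]; rewrite mcoeffZ mcoeffX.
  by rewrite (inj_eq mon_inj) (negPf ja) mulr0.
have DF : D%:F ^+ (N.+1 * k) != 0 :> {fraction mpoly N K} by rewrite expf_neq0 // tofrac_eq0.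
apply: (mulIf DF); rewrite mul0r -[RHS](rmorph0 (@FracField.tofrac _)) -cE !raddf_sum mulr_suml.
apply: eq_bigr => j _; rewrite [X in X * _]mmapZ mmapX /mmap1 /= -mul_mpolyC rmorphM /= -mulrA.
congr (_ * _); rewrite mulnC exprM.
have -> : D%:F ^+ k ^+ N.+1 = \prod_(i < N.+1) (D%:F ^+ k : {fraction mpoly N K}).
  by rewrite prodr_const card_ord.
rewrite [RHS]rmorph_prod -big_split /=.
apply: eq_bigr => i _; rewrite mnmE rmorphM !rmorphXn /= FE exprMn -mulrA -exprD.
by rewrite subnKC // ltnW.
Qed.

(** * The function field of a generically finite polynomial map *)

Section MapHorner.
Variables (F L : fieldType) (iota : {rmorphism F -> L}).

Lemma map_hornerM (P Q : {poly F}) z :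
  (map_poly iota (P * Q)).[z] = (map_poly iota P).[z] * (map_poly iota Q).[z].
Proof. by rewrite rmorphM hornerM. Qed.

Lemma map_hornerD (P Q : {poly F}) z :
  (map_poly iota (P + Q)).[z] = (map_poly iota P).[z] + (map_poly iota Q).[z].
Proof. by rewrite rmorphD hornerD. Qed.

Lemma map_hornerB (P Q : {poly F}) z :
  (map_poly iota (P - Q)).[z] = (map_poly iota P).[z] - (map_poly iota Q).[z].
Proof. by rewrite rmorphB hornerD hornerN. Qed.

Lemma map_hornerC c z : (map_poly iota c%:P).[z] = iota c.
Proof. by rewrite map_polyC hornerC. Qed.

Lemma map_hornerX z : (map_poly iota 'X).[z] = z.
Proof. by rewrite map_polyX hornerX. Qed.

End MapHorner.

Section MinimalPolynomial.
Variables (F L : fieldType) (iota : {rmorphism F -> L}) (z : L).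
Hypothesis char0 : [pchar F] =i pred0.
Local Notation "P ^iota" := (map_poly iota P) (at level 2, format "P ^iota").

Variable m : {poly F}.
Hypothesis m_monic : m \is monic.
Hypothesis mz : m^iota.[z] = 0.
Hypothesis m_dvd : forall P : {poly F}, P^iota.[z] = 0 -> m %| P.

(** The gcd of [P] and [m] divides [P], so it does not vanish at [z]; its cofactor in [m] does,
    hence is divisible by [m], and the gcd is a constant. *)
Lemma minimal_coprime (P : {poly F}) : P^iota.[z] != 0 -> coprimep P m.
Proof.
move=> Pz; pose g := gcdp P m.
have m0 := monic_neq0 m_monic.
have g0 : g != 0 by rewrite gcdp_eq0 negb_and m0 orbT.
have [h mE] : exists h, m = h * g by apply/dvdpP; exact: dvdp_gcdr.
have gz : g^iota.[z] != 0.
  have [k PE] : exists k, P = k * g by apply/dvdpP; exact: dvdp_gcdl.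
  by apply: contraNneq Pz => e; rewrite PE rmorphM hornerM e mulr0.
have : m %| h.
  apply: m_dvd; move/eqP: mz; rewrite {1}mE rmorphM hornerM mulf_eq0 (negPf gz) orbF.
  by move/eqP.
have h0 : h != 0 by apply: contraNneq m0 => e; rewrite mE e mul0r.
move/(dvdp_leq h0); rewrite {1}mE size_mul // -ltnS => hh.
rewrite coprimep_def -/g eqn_leq size_poly_gt0 g0 andbT.
by move: hh; rewrite -size_poly_gt0 in h0; rewrite prednK ?addn_gt0 ?h0 // -addn1 leq_add2l.
Qed.

Lemma minimal_size_gt1 : (1 < size m)%N.
Proof.
rewrite ltnNge; apply/negP => /size1_polyC mE.
have := mz; rewrite mE map_polyC hornerC => /eqP; rewrite fmorph_eq0 => m0.
by have := monic_neq0 m_monic; rewrite mE polyC_eq0 m0.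
Qed.

(** In characteristic zero the derivative is non-zero of smaller degree, so [m] does not divide it
    and it does not vanish at [z]. *)
Lemma minimal_separable : coprimep m^`() m.
Proof.
apply: minimal_coprime; apply/eqP => /m_dvd; apply/negP.
have m1 := minimal_size_gt1.
have d0 : m^`() != 0.
  have [k sm] : exists k, size m = k.+2 by case: (size m) m1 => [|[|k]] // _; exists k.
  apply/eqP => /(congr1 (fun p : {poly F} => p`_k)).
  rewrite coef0 coef_deriv.
  have -> : m`_k.+1 = 1 by rewrite -(monicP m_monic) lead_coefE sm.
  by move/eqP => e; have /pcharf0P/(_ k.+1) := char0; rewrite e.
by apply: contraTN (lt_size_deriv (monic_neq0 m_monic)) => /(dvdp_leq d0); rewrite ltnNge => ->.
Qed.

Lemma minimal_inverse (P : {poly F}) : P^iota.[z] != 0 ->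
  exists Q : {poly F}, Q^iota.[z] = (P^iota.[z])^-1.
Proof.
move=> Pz; have /Bezout_eq1_coprimepP[[u v] /= e] := minimal_coprime Pz.
exists u; apply: (mulIf Pz); rewrite mulVf //.
have := congr1 (fun p => p^iota.[z]) e.
by rewrite /= rmorphD !rmorphM rmorph1 hornerD !hornerM mz mulr0 addr0 hornerC.
Qed.

End MinimalPolynomial.

Lemma minimal_poly_exists (F L : fieldType) (iota : {rmorphism F -> L}) (z : L) (p : {poly F}) :
  p != 0 -> root (map_poly iota p) z ->
  exists m : {poly F}, [/\ m \is monic, (map_poly iota m).[z] = 0 &
    forall P : {poly F}, (map_poly iota P).[z] = 0 -> m %| P].
Proof.
move=> p0 pz.
have ex : exists k, `[< exists2 q : {poly F}, q != 0 & root (map_poly iota q) z /\ size q = k >].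
  by exists (size p); apply/asboolP; exists p.
case: (ex_minnP ex) => k /asboolP[q q0 [qz sq]] kmin.
have lq : lead_coef q != 0 by rewrite lead_coef_eq0.
exists ((lead_coef q)^-1 *: q); split.
- by rewrite monicE lead_coefZ mulVf.
- by rewrite map_polyZ hornerZ (eqP qz) mulr0.
move=> P Pz; rewrite dvdpZl ?invr_eq0 //; apply/negPn/negP => qP.
have : (k <= size (P %% q)%R)%N.
  apply: kmin; apply/asboolP; exists (P %% q); first exact: qP.
  split=> //; move: Pz; rewrite {1}(divp_eq P q) rmorphD rmorphM hornerD hornerM.
  by rewrite (eqP qz) mulr0 add0r => e; apply/eqP.
by rewrite -sq leqNgt ltn_modp q0.
Qed.

Section FunctionField.
Variables (K : closedFieldType) (n : nat) (phi : n.-tuple (mpoly n K)).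
Hypothesis char0 : [pchar K] =i pred0.
Hypothesis phi_indep : forall q : mpoly n K, comp_mpoly phi q = 0 -> q = 0.
Local Notation R := (mpoly n K).
Local Notation L := {fraction mpoly n K}.

Let h := (@FracField.tofrac R \o comp_mpoly phi).

Let h_inj : injective h.
Proof.
move=> p q /eqP; rewrite tofrac_eq -subr_eq0 -rmorphB => /eqP /phi_indep /eqP.
by rewrite subr_eq0 => /eqP.
Qed.

(** The function fields of the source and of the target are both written [L], and [fpull] is
    composition with [phi]. A polynomial over the subfield generated by [phi] is therefore given as
    [map_poly fpull P]. *)
Definition fpull : L -> L := frac_lift h_inj.
HB.instance Definition _ := GRing.RMorphism.on fpull.

Local Notation "P ^iota" := (map_poly fpull P) (at level 2, format "P ^iota").

Lemma fpullE p : fpull p%:F = (comp_mpoly phi p)%:F.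
Proof. exact: frac_lift_tofrac. Qed.

Lemma pchar_frac : [pchar L] =i pred0.
Proof.
move=> p; rewrite !inE; apply/negP => /andP[p_pr].
have -> : p%:R = (p%:R : R)%:F :> L by rewrite rmorph_nat.
rewrite tofrac_eq0 -(rmorph_nat (@mpolyC n K)) /= mpolyC_eq0 => p0.
by have := char0 p; rewrite !inE p_pr p0.
Qed.

(** The coordinates of [phi] together with [f] are [n + 1] fractions in [n] variables, hence
    dependent. Read in the last variable, the relation has coefficients that are polynomials in
    [phi], and it is non-zero since [muni] is injective. *)
Lemma fpull_algebraic (f : L) : exists2 P : {poly L}, P != 0 & root P^iota f.
Proof.
pose g (i : 'I_n.+1) : L :=
  if unlift ord_max i is Some j then (tnth phi j)%:F else f.
have [q q0 qE] := frac_alg_dep g.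
exists (map_poly (@FracField.tofrac _) (muni q)).
  by rewrite map_poly_eq0_id0 ?lead_coef_eq0 ?muni_eq0 // tofrac_eq0 lead_coef_eq0 muni_eq0.
rewrite rootE -map_poly_comp; apply/eqP; rewrite -[RHS]qE mmap_muni.
rewrite /g unlift_none; congr (_.[_]); apply: eq_map_poly => p /=.
rewrite fpullE comp_mpolyE rmorph_sum /mmap; apply: eq_bigr => m _ /=.
rewrite -mul_mpolyC rmorphM rmorph_prod; congr (_ * _).
apply: eq_bigr => i _; rewrite rmorphXn; congr (_ ^+ _) => /=.
have -> : widen_ord (leqnSn n) i = lift ord_max i.
  by apply: val_inj; rewrite /= /bump leqNgt ltn_ord.
by rewrite liftK.
Qed.

(** The variables are adjoined one at a time by the primitive element theorem. In characteristic
    zero the new generator is an integral multiple of the variable minus the old generator, hence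
    again a polynomial and not merely a fraction: it has a value at every point. *)
Lemma primitive_poly : exists z : R, forall i : 'I_n,
  exists q : {poly L}, q^iota.[z%:F] = (mpolyX K (mnm1 i))%:F.
Proof.
suff hk : forall k, exists z : R, forall i : 'I_n, (i < k)%N ->
    exists q : {poly L}, q^iota.[z%:F] = (mpolyX K (mnm1 i))%:F.
  by have [z hz] := hk n; exists z => i; apply: hz.
elim=> [|k [z hz]]; first by exists 0.
have [kn|nk] := ltnP k n; last first.
  by exists z => i _; apply: hz; apply: leq_trans nk.
have [p p0 pz] := fpull_algebraic z%:F.
have [q q0 qx] := fpull_algebraic (mpolyX K (mnm1 (Ordinal kn)))%:F.
have [m [[r rz] [t tz]]] := pchar0_PET p0 pz q0 qx pchar_frac.
rewrite -raddfMn -raddfB /= in rz tz.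
exists (mpolyX K (mnm1 (Ordinal kn)) *+ m - z) => i; rewrite ltnS leq_eqVlt => /orP[/eqP ik|/hz [w wz]]; last first.
  by exists (w \Po r); rewrite map_comp_poly horner_comp [X in _.[X]]rz.
by exists t; rewrite [LHS]tz; congr (mpolyX _ (mnm1 _))%:F; apply: val_inj.
Qed.
Lemma fpull_specializes y v f c : (forall j, meval v (tnth phi j) = y j) ->
  specializes y f c -> specializes v (fpull f) c.
Proof.
move=> vy [a [b [b0 fb cb]]].
have E p : meval v (comp_mpoly phi p) = meval y p.
  by rewrite comp_mpoly_meval; apply: meval_eq.
exists (comp_mpoly phi a), (comp_mpoly phi b); rewrite !E; split=> //.
by rewrite -!fpullE -rmorphM fb.
Qed.

Lemma comp_poly_mmap (q : 'I_n -> {poly L}) (z : R) (p : R) :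
  (forall i, (q i)^iota.[z%:F] = (mpolyX K (mnm1 i))%:F) ->
  (mmap (polyC \o (@FracField.tofrac _ \o @mpolyC n K)) q p)^iota.[z%:F] = p%:F.
Proof.
move=> qz; rewrite [in RHS](mpolyE p) /mmap !rmorph_sum horner_sum.
apply: eq_bigr => m _ /=; rewrite rmorphM hornerM /= map_polyC hornerC -mul_mpolyC rmorphM.
rewrite /= fpullE comp_mpolyC; congr (_ * _); rewrite mpolyXE_id /mmap1 !rmorph_prod horner_prod.
by apply: eq_bigr => i _; rewrite !rmorphXn horner_exp /= qz.
Qed.

Variable z : R.
Variable q : 'I_n -> {poly L}.
Hypothesis qz : forall i, (q i)^iota.[z%:F] = (mpolyX K (mnm1 i))%:F.
Variable m : {poly L}.
Hypothesis m_monic : m \is monic.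
Hypothesis mz : m^iota.[z%:F] = 0.
Hypothesis m_dvd : forall P : {poly L}, P^iota.[z%:F] = 0 -> m %| P.

Lemma primitive_generates (f : L) : exists P : {poly L}, P^iota.[z%:F] = f.
Proof.
have [a [b [b0 ->]]] := fracP f.
have bz := comp_poly_mmap b qz; have bF : b%:F != 0 :> L by rewrite tofrac_eq0.
rewrite -bz in bF; have [Q Qz] := minimal_inverse m_monic mz m_dvd bF.
exists (mmap (polyC \o (@FracField.tofrac _ \o @mpolyC n K)) q a * Q).
have Qz' := etrans Qz (congr1 GRing.inv bz).
exact: (etrans (map_hornerM _ _ _ _) (congr2 *%R (comp_poly_mmap a qz) Qz')).
Qed.

Let d := (size m).-1.
Let sm : size m = d.+1.
Proof. by rewrite prednK // size_poly_gt0 monic_neq0. Qed.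

Lemma power_basis_span (f : L) : exists c : 'I_d -> L, f = \sum_i fpull (c i) * z%:F ^+ i.
Proof.
have [P <-] := primitive_generates f.
exists (fun i => (P %% m)`_i).
rewrite [in LHS](divp_eq P m) map_hornerD map_hornerM mz mulr0 add0r.
have sP : (size (P %% m)^iota <= d)%N.
  by rewrite size_map_poly -ltnS -sm ltn_modp monic_neq0.
by rewrite (horner_coef_wide _ sP); apply: eq_bigr => i _; rewrite coef_map.
Qed.

Lemma power_basis_free (c : 'I_d -> L) :
  \sum_i fpull (c i) * z%:F ^+ i = 0 -> forall i, c i = 0.
Proof.
move=> c0; pose P := \poly_(k < d) if insub k is Some i then c i else 0.
have Pc (i : 'I_d) : P`_i = c i by rewrite coef_poly ltn_ord valK.
have sP : (size P <= d)%N by exact: size_poly.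
suff P0 : P = 0 by move=> i; rewrite -Pc P0 coef0.
apply/eqP/negPn/negP => P0; have : m %| P.
  apply: m_dvd; rewrite (@horner_coef_wide _ d) ?size_map_poly // -[RHS]c0.
  by apply: eq_bigr => i _; rewrite coef_map Pc.
by move/(dvdp_leq P0); rewrite sm leqNgt ltnS sP.
Qed.

(* Over a general [y] the coordinates of a point are [q i] evaluated at a root of the
   minimal polynomial [m] of [z], all specialized at [y]. *)
Lemma generic_fibre_roots : exists2 g : R, g != 0 & forall y, meval y g != 0 ->
  exists x : 'I_d -> 'I_n -> K, injective x /\
    forall v, (forall j, meval v (tnth phi j) = y j) <-> exists i, v = x i.
Proof.
pose sub p := mmap (polyC \o (@FracField.tofrac _ \o @mpolyC n K)) q p.
have subz p : (sub p)^iota.[z%:F] = p%:F by exact: comp_poly_mmap.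
(* At [z] the polynomial [sub (tnth phi j)] has the value [tnth phi j], which is also the image of
   the [j]-th variable under [fpull]; hence the divisibility by [m]. Specialized at [y], these
   identities put the point defined by each root of the specialized [m] in the fibre. *)
have /choice[w wE] : forall j, exists w, sub (tnth phi j) - ((mpolyX K (mnm1 j))%:F)%:P = w * m.
  move=> j; apply/dvdpP; apply: m_dvd.
  rewrite map_hornerB subz map_hornerC /= fpullE comp_mpolyXU.
  by rewrite -tnth_nth subrr.
(* Specialized at [y], this recovers a root from the point it defines, which makes the points
   distinct. *)
have [wz wzE] : exists w, sub z - 'X = w * m.
  by apply/dvdpP; apply: m_dvd; rewrite map_hornerB subz map_hornerX subrr.
have /Bezout_eq1_coprimepP[[u1 u2] /= uE] := minimal_separable pchar_frac m_monic mz m_dvd.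
have [g g0 gs] : exists2 g : R, g != 0 & forall y, meval y g != 0 ->
    forall P, P \in [:: m, wz, u1, u2 & codom q ++ codom w] -> exists p, specializes_upoly y P p.
  elim: [:: m, wz, u1, u2 & _] => [|P s [g g0 gs]]; first by exists 1; [exact: oner_neq0|].
  have [g' g'0 gP] := specializes_upoly_generic P.
  exists (g' * g); first by rewrite mulf_neq0.
  move=> y; rewrite mevalM mulf_eq0 negb_or => /andP[yP ys] P'; rewrite inE => /orP[/eqP->|].
    exact: gP.
  exact: gs.
exists g => // y /gs {gs}gs.
have [|my myE] := gs m; first by rewrite !inE eqxx.
have [|wy wyE] := gs wz; first by rewrite !inE eqxx !orbT.
have [|a1 a1E] := gs u1; first by rewrite !inE eqxx !orbT.
have [|a2 a2E] := gs u2; first by rewrite !inE eqxx !orbT.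
have /choice[qy qyE] : forall i, exists p, specializes_upoly y (q i) p.
  by move=> i; apply: gs; rewrite !inE mem_cat codom_f !orbT.
have /choice[wyj wyjE] : forall i, exists p, specializes_upoly y (w i) p.
  by move=> i; apply: gs; rewrite !inE mem_cat codom_f !orbT.
have myd : my`_d = 1.
  apply: specializes_uniq (myE d) _.
  have -> : m`_d = 1 by rewrite -(monicP m_monic) lead_coefE.
  exact: specializes1.
have smy : size my = d.+1.
  apply/eqP; rewrite eqn_leq; apply/andP; split.
    apply/leq_sizeP => k dk; apply: specializes_uniq (myE k) _.
    by rewrite nth_default ?sm //; exact: specializes0.
  by rewrite ltnNge; apply/negP => /leq_sizeP/(_ d (leqnn _))/eqP; rewrite myd oner_eq0.
(* The Bezout relation between [m] and its derivative survives specialization, so [my] has [d]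
   distinct roots. *)
have my_sep : separable_poly my.
  rewrite unlock coprimep_sym; apply/Bezout_eq1_coprimepP; exists (a1, a2) => /=.
  apply: (@specializes_upoly_uniq _ _ y 1); last exact: specializes_upolyC (specializes1 y).
  rewrite -uE; apply: specializes_upolyD; apply: specializes_upolyM => //.
  exact: specializes_upoly_deriv.
have my_monic : my \is monic by rewrite monicE lead_coefE smy myd.
have [r rE] := closed_field_poly_normal my; rewrite (monicP my_monic) scale1r in rE.
have sr : size r = d by apply: succn_inj; rewrite -smy rE size_prod_XsubC.
have ur : uniq r by move: my_sep; rewrite rE separable_prod_XsubC.
have rootr t : root my t = (t \in r) by rewrite rE root_prod_XsubC.
pose subv t := fun i => (qy i).[t].
have subE p t : (mmap polyC qy p).[t] = meval (subv t) p.
  rewrite /meval /mmap horner_sum; apply: eq_bigr => a _; rewrite hornerM hornerC.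
  by congr (_ * _); rewrite horner_prod; apply: eq_bigr => i _; rewrite horner_exp.
have subphi t j : root my t -> meval (subv t) (tnth phi j) = y j.
  move=> /eqP tr; have e : mmap polyC qy (tnth phi j) - (y j)%:P = wyj j * my.
    apply: (@specializes_upoly_uniq _ _ y (w j * m)); last exact: specializes_upolyM.
    rewrite -wE; apply: specializes_upolyD; first exact: specializes_mmap.
    apply/specializes_upolyN/specializes_upolyC; rewrite -(mevalXU y j).
    exact: specializes_poly.
  have := congr1 (fun p => p.[t]) e; rewrite /= hornerM tr mulr0 !hornerE subE.
  by move/eqP; rewrite subr_eq0 => /eqP.
have subzt t : root my t -> meval (subv t) z = t.
  move=> /eqP tr; have e : mmap polyC qy z - 'X = wy * my.
    apply: (@specializes_upoly_uniq _ _ y (wz * m)); last exact: specializes_upolyM.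
    rewrite -wzE; apply: specializes_upolyD; first exact: specializes_mmap.
    apply: specializes_upolyN => k; rewrite !coefX; case: eqP => _.
      exact: specializes1.
    exact: specializes0.
  have := congr1 (fun p => p.[t]) e; rewrite /= hornerM tr mulr0 !hornerE subE.
  by move/eqP; rewrite subr_eq0 => /eqP.
have rr (i : 'I_d) : root my r`_i by rewrite rootr mem_nth // sr.
exists (fun i => subv r`_i); split.
  move=> i j e; have : r`_i = r`_j by rewrite -(subzt _ (rr i)) -(subzt _ (rr j)) e.
  by move/eqP; rewrite nth_uniq ?sr // => /eqP/val_inj.
move=> v; split=> [vy|[i ->] j]; last exact: subphi.
(* Conversely, at a point [v] of the fibre the relation [m(z) = 0] specializes to the vanishing of
   [my] at the value of [z], and the specialized [q i] takes at this value the [i]-th coordinate of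
   [v]. *)
have spz : specializes v z%:F (meval v z) by exact: specializes_poly.
have spiota P p : specializes_upoly y P p -> specializes v P^iota.[z%:F] p.[meval v z].
  move=> h1; apply: specializes_horner => // k; rewrite coef_map.
  exact: fpull_specializes vy (h1 k).
have tr : root my (meval v z).
  apply/eqP; have h1 := spiota _ _ myE; rewrite mz in h1.
  exact: specializes_uniq h1 (specializes0 v).
have := tr; rewrite rootr => /(nthP 0) [k kd kE]; rewrite sr in kd.
exists (Ordinal kd); rewrite /= kE; apply/funext => i; rewrite /subv -(mevalXU v i).
have h1 := spiota _ _ (qyE i); rewrite qz in h1.
exact: specializes_uniq (specializes_poly v _) h1.
Qed.

(* [1 / f] is a polynomial in [z], hence has a value at all points over a general [y]. *)
Lemma generic_fibre_neq0 (f : R) : f != 0 -> exists2 g : R, g != 0 &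
  forall y v, meval y g != 0 -> (forall j, meval v (tnth phi j) = y j) -> meval v f != 0.
Proof.
move=> f0; have [P PE] := primitive_generates (f%:F)^-1.
have [g g0 gP] := specializes_upoly_generic P.
exists g => // y v /gP[p pE] vy; apply/eqP => fv.
have h1 : specializes v (f%:F)^-1 p.[meval v z].
  rewrite -PE; apply: specializes_horner; last exact: specializes_poly.
  by move=> k; rewrite coef_map; exact: fpull_specializes (pE k).
have h2 := specializesM (specializes_poly v f) h1.
rewrite fv mul0r mulfV ?tofrac_eq0 // in h2.
by have := specializes_uniq h2 (specializes1 v) => /eqP; rewrite eq_sym oner_eq0.
Qed.

End FunctionField.

(** A single [d], the degree of the minimal polynomial of a primitive element, is both the size of a
    basis and the number of points of a general fibre. *)
Lemma function_field_degree (K : closedFieldType) (char0 : [pchar K] =i pred0) n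
    (phi : n.-tuple (mpoly n K))
    (phi_indep : forall q : mpoly n K, comp_mpoly phi q = 0 -> q = 0) :
  exists d (b : 'I_d -> {fraction mpoly n K}),
  [/\ forall f, exists c, f = \sum_i fpull phi_indep (c i) * b i,
      forall c, \sum_i fpull phi_indep (c i) * b i = 0 -> forall i, c i = 0,
      exists2 g : mpoly n K, g != 0 & forall y, meval y g != 0 ->
        exists x : 'I_d -> 'I_n -> K, injective x /\
        forall v, (forall j, meval v (tnth phi j) = y j) <-> exists i, v = x i &
      forall f : mpoly n K, f != 0 -> exists2 g : mpoly n K, g != 0 &
        forall y v, meval y g != 0 -> (forall j, meval v (tnth phi j) = y j) ->
        meval v f != 0].
Proof.
have [z /choice[q qz]] := primitive_poly char0 phi_indep.
have [p p0 pz] := fpull_algebraic phi_indep z%:F.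
have [m [m_monic mz m_dvd]] := minimal_poly_exists p0 pz.
exists (size m).-1, (fun i => z%:F ^+ i); split.
- exact: power_basis_span qz _ m_monic mz m_dvd.
- exact: power_basis_free m_monic m_dvd.
- exact: (generic_fibre_roots char0 qz m_monic mz m_dvd).
- exact: (generic_fibre_neq0 qz m_monic mz m_dvd).
Qed.

(** * Birational charts *)

(** Writing each family in terms of the other gives matrices [mB] and [mA] over [F], and freeness of
    [b] forces [mB *m mA = 1]; an identity of size [d] factors through size [d'] only if
    [d <= d']. *)
Lemma basis_size (F L : fieldType) (iota : {rmorphism F -> L}) d d'
    (b : 'I_d -> L) (b' : 'I_d' -> L) :
  (forall c : 'I_d -> F, \sum_i iota (c i) * b i = 0 -> forall i, c i = 0) ->
  (forall f, exists c : 'I_d' -> F, f = \sum_i iota (c i) * b' i) ->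
  (forall f, exists c : 'I_d -> F, f = \sum_i iota (c i) * b i) ->
  (d <= d')%N.
Proof.
move=> free span' span.
have /choice[B BE] : forall i, exists c : 'I_d' -> F, b i = \sum_j iota (c j) * b' j.
  by move=> i.
have /choice[A AE] : forall j, exists c : 'I_d -> F, b' j = \sum_k iota (c k) * b k.
  by move=> j.
pose mB := \matrix_(i, j) B i j; pose mA := \matrix_(j, k) A j k.
apply: (@mulmx1_min _ _ _ mB mA); apply/matrixP => i k; rewrite mxE [RHS]mxE.
apply/eqP; rewrite -subr_eq0; apply/eqP.
apply: (free (fun k => \sum_j mB i j * mA j k - (i == k)%:R)).
under eq_bigr => l _ do rewrite rmorphB rmorph_nat mulrBl.
have -> : forall G : 'I_d -> L, \sum_l (G l - (i == l)%:R * b l) = \sum_l G l - b i.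
  move=> G; rewrite sumrB; congr (_ - _); rewrite (bigD1 i) //= eqxx mul1r big1 ?addr0 // => l.
  by rewrite eq_sym => /negPf ->; rewrite mul0r.
rewrite [in X in _ - X]BE; under [X in _ - X]eq_bigr => j _ do rewrite AE mulr_sumr.
rewrite exchange_big -sumrB big1 // => l _; rewrite rmorph_sum mulr_suml -sumrB big1 // => j _.
by rewrite !mxE rmorphM mulrA subrr.
Qed.

Section Charts.
Variable K : closedFieldType.

Section Represents.
Variables (X : Type) (N : nat) (kappa : ('I_N -> K) -> X).

(** Only agreement on a non-empty open set is asked for; by [representsB] and [represents_zero] this
    already determines [f]. *)
Definition represents (f : {fraction mpoly N K}) (r : X -> K) : Prop :=
  exists2 g : mpoly N K, g != 0 &
    forall v, meval v g != 0 -> specializes v f (r (kappa v)).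

Lemma representsD f g r s : represents f r -> represents g s ->
  represents (f + g) (fun x => r x + s x).
Proof.
move=> [p p0 pr] [q q0 qs]; exists (p * q); first by rewrite mulf_neq0.
move=> v; rewrite mevalM mulf_eq0 negb_or => /andP[pv qv].
by apply: specializesD; [exact: pr|exact: qs].
Qed.

Lemma representsM f g r s : represents f r -> represents g s ->
  represents (f * g) (fun x => r x * s x).
Proof.
move=> [p p0 pr] [q q0 qs]; exists (p * q); first by rewrite mulf_neq0.
move=> v; rewrite mevalM mulf_eq0 negb_or => /andP[pv qv].
by apply: specializesM; [exact: pr|exact: qs].
Qed.

Lemma representsB f g r s : represents f r -> represents g s ->
  represents (f - g) (fun x => r x - s x).
Proof.
move=> [p p0 pr] [q q0 qs]; exists (p * q); first by rewrite mulf_neq0.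
move=> v; rewrite mevalM mulf_eq0 negb_or => /andP[pv qv].
by apply: specializesD; [exact: pr|apply: specializesN; exact: qs].
Qed.

Lemma represents_cst c : represents (mpolyC N c)%:F (fun=> c).
Proof.
exists 1; first exact: oner_neq0.
by move=> v _; rewrite -{2}(mevalC v c); exact: specializes_poly.
Qed.

Lemma represents0 : represents 0 (fun=> 0).
Proof. by have := represents_cst 0; rewrite !rmorph0. Qed.

Lemma represents1 : represents 1 (fun=> 1).
Proof. by have := represents_cst 1; rewrite !rmorph1. Qed.

Lemma represents_sum I (s : seq I) f r : (forall i, represents (f i) (r i)) ->
  represents (\sum_(i <- s) f i) (fun x => \sum_(i <- s) r i x).
Proof.
move=> h; elim: s => [|i s IH].
  by rewrite big_nil (funext (fun x => big_nil _ _ _ _)); exact: represents0.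
by rewrite big_cons (funext (fun x => big_cons _ _ _ _ _ _)); apply: representsD.
Qed.

Lemma representsX f r k : represents f r -> represents (f ^+ k) (fun x => r x ^+ k).
Proof.
move=> h; elim: k => [|k IH].
  by rewrite expr0 (funext (fun x => expr0 _)); exact: represents1.
by rewrite exprS (funext (fun x => exprS _ _)); apply: representsM.
Qed.

Lemma represents_mmap m (f : 'I_m -> {fraction mpoly N K}) r (q : mpoly m K) :
  (forall i, represents (f i) (r i)) ->
  represents (mmap (@FracField.tofrac _ \o @mpolyC N K) f q)
    (fun x => meval (fun i => r i x) q).
Proof.
move=> h; rewrite /meval /mmap; apply: represents_sum => a.
apply: representsM; first exact: represents_cst.
rewrite /mmap1; elim: (index_enum _) => [|i s IH].
  by rewrite big_nil (funext (fun x => big_nil _ _ _ _)); exact: represents1.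
rewrite big_cons (funext (fun x => big_cons _ _ _ _ _ _)).
by apply: representsM => //; exact: representsX.
Qed.

Lemma represents_zero f r : represents f r ->
  (exists2 g : mpoly N K, g != 0 & forall v, meval v g != 0 -> r (kappa v) = 0) -> f = 0.
Proof.
move=> [p p0 pr] [q q0 q_eq0]; apply/eqP/negPn/negP => f0.
have [a [b [b0 fE]]] := fracP f.
have a0 : a != 0 by apply: contraNneq f0 => a0; rewrite fE a0 rmorph0 mul0r.
have [v] : exists v, meval v (a * b * p * q) != 0.
  by apply: mpoly_eval_neq0; rewrite !mulf_neq0.
rewrite !mevalM !mulf_eq0 !negb_or => /andP[/andP[/andP[av bv] pv] qv].
have h1 := pr v pv; rewrite (q_eq0 _ qv) in h1.
have h2 : specializes v f (meval v a / meval v b).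
  exists a, b; split=> //; last by apply: divfK.
  by rewrite fE; apply: divfK; rewrite tofrac_eq0.
have /eqP := specializes_uniq h1 h2; rewrite eq_sym mulf_eq0 invr_eq0.
by rewrite (negPf av) (negPf bv).
Qed.

End Represents.

(* A birational parametrization of [X] by the affine [N]-space. *)
Record is_chart (X : funSpace K) N (kappa : ('I_N -> K) -> X) : Prop := IsChart {
  chart_open : forall O : set X, open O -> O !=set0 ->
    exists2 f : mpoly N K, f != 0 & forall v, meval v f != 0 -> O (kappa v);
  chart_frac : forall r : ratfun X, exists f, represents kappa f r;
  chart_ratfun : forall f, exists r : ratfun X, represents kappa f r;
  chart_cover : forall g : mpoly N K, g != 0 ->
    exists O : set X, [/\ open O, O !=set0 &
      forall x, O x -> exists2 v, meval v g != 0 & kappa v = x] }.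

Section ChartFacts.
Variables (X : funSpace K) (N : nat) (kappa : ('I_N -> K) -> X).
Hypothesis kC : is_chart kappa.

Lemma chart_generically (P : set X) :
  generically P <-> exists2 g : mpoly N K, g != 0 & forall v, meval v g != 0 -> P (kappa v).
Proof.
split=> [[O [oO O0 OP]]|[g g0 gP]].
  by have [f f0 fO] := chart_open kC oO O0; exists f => // v /fO/OP.
have [O [oO O0 OP]] := chart_cover kC g0; exists O; split=> // x /OP[v gv <-].
exact: gP.
Qed.

Lemma chart_rat_eq0 (r : X -> K) f : represents kappa f r ->
  generically [set x | r x = 0] <-> f = 0.
Proof.
move=> fr; split=> [/chart_generically|f0]; first exact: represents_zero.
apply/chart_generically; have [g g0 gr] := fr; exists g => // v gv /=.
by have := gr v gv; rewrite f0 => /specializes_uniq; apply; exact: specializes0.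
Qed.

Lemma alg_indepS m (f : 'I_m -> ratfun X) k (km : (k <= m)%N) :
  alg_indep f -> alg_indep (f \o widen_ord km).
Proof.
move=> fI q [O [oO O0 Oq]].
pose t := [tuple mpolyX K (mnm1 (widen_ord km i)) | i < k].
have tE v : meval v (comp_mpoly t q) = meval (v \o widen_ord km) q.
  by rewrite comp_mpoly_meval; apply: meval_eq => i; rewrite tnth_mktuple mevalXU.
apply/eqP/negPn/negP => /mpoly_eval_neq0[v qv].
have /eqP : comp_mpoly t q = 0 by apply: fI; exists O; split=> // x /Oq /=; rewrite tE.
apply/negP; apply: contraNneq qv => t0.
pose w (i : 'I_m) := if insub (i : nat) is Some j then v j else 0 : K.
have := tE w; rewrite t0 meval0 => /esym/eqP; congr (_ == 0); apply: meval_eq => i.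
by rewrite /w /= valK.
Qed.

(** The coordinates of the chart are [N] independent rational functions and any [N + 1] are
    dependent. Since subfamilies of independent families are independent, no other number passes the
    test in [vdim]. *)
Lemma chart_vdim : vdim X = N.
Proof.
have indep : exists f : 'I_N -> ratfun X, alg_indep f.
  have /choice[f fE] : forall i, exists r : ratfun X,
      represents kappa (mpolyX K (mnm1 i))%:F r by move=> i; exact: chart_ratfun kC _.
  exists f => q qf; apply/eqP; rewrite -tofrac_eq0; apply/eqP.
  have := (chart_rat_eq0 (represents_mmap q fE)).1 qf.
  rewrite [in q%:F](mpolyE q) /mmap rmorph_sum => h; rewrite -[RHS]h.
  apply: eq_bigr => m _ /=; rewrite -mul_mpolyC rmorphM mpolyXE_id rmorph_prod.
  by congr (_ * _); apply: eq_bigr => i _; rewrite rmorphXn.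
have dep : ~ exists f : 'I_N.+1 -> ratfun X, alg_indep f.
  case=> f fI; have /choice[F FE] : forall i, exists F, represents kappa F (f i).
    by move=> i; exact: chart_frac kC _.
  have [q q0 qF] := frac_alg_dep F.
  move/eqP: q0; apply; apply: fI.
  by apply/(chart_rat_eq0 (represents_mmap q FE)); exact: qF.
rewrite /vdim; case: xgetP => [n ->{n} [n_indep n_dep]|/(_ N)[]//].
set n := xget _ _ in n_indep n_dep *; case: (ltngtP n N) => // nN.
  by case: n_dep; have [f fI] := indep; exists (f \o widen_ord nN); exact: alg_indepS.
by case: dep; have [f fI] := n_indep; exists (f \o widen_ord nN); exact: alg_indepS.
Qed.

End ChartFacts.

(** * Degree of a map read in charts *)

Section ChartDegree.
Hypothesis char0 : [pchar K] =i pred0.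
Variables (X Y : funSpace K) (N : nat) (kappa : ('I_N -> K) -> X) (kappa' : ('I_N -> K) -> Y).
Hypotheses (kX : is_chart kappa) (kY : is_chart kappa').
Variables (eta : X -> Y) (phi : N.-tuple (mpoly N K)).
Hypothesis eta_phi : forall v, eta (kappa v) = kappa' (fun i => meval v (tnth phi i)).
Hypothesis phi_indep : forall q : mpoly N K, comp_mpoly phi q = 0 -> q = 0.

Lemma represents_fpull c r : represents kappa' c r ->
  represents kappa (fpull phi_indep c) (r \o eta).
Proof.
move=> [g g0 gr]; exists (comp_mpoly phi g).
  by apply: contraNneq g0 => /phi_indep ->.
move=> v; rewrite comp_mpoly_meval => /gr; rewrite /= eta_phi.
by apply: fpull_specializes.
Qed.

Variables (d : nat) (b : 'I_d -> {fraction mpoly N K}).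
Hypothesis b_span : forall f, exists c, f = \sum_i fpull phi_indep (c i) * b i.
Hypothesis b_free : forall c, \sum_i fpull phi_indep (c i) * b i = 0 -> forall i, c i = 0.

Lemma chart_has_degree : has_degree eta d.
Proof.
have /choice[r rE] : forall i, exists r : ratfun X, represents kappa (b i) r.
  by move=> i; exact: chart_ratfun kX _.
exists r; split=> [f|c].
  have [F FE] := chart_frac kX f; have [C CE] := b_span F.
  have /choice[c cE] : forall i, exists c : ratfun Y, represents kappa' (C i) c.
    by move=> i; exact: chart_ratfun kY _.
  exists c; have : represents kappa (F - \sum_i fpull phi_indep (C i) * b i)
      (fun x => f x - \sum_i c i (eta x) * r i x).
    apply: representsB => //.
    by apply: represents_sum => i; apply: representsM => //; exact: represents_fpull.
  rewrite -CE subrr => R; have := (chart_rat_eq0 kX R).2 erefl.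
  by congr generically; apply/seteqP; split=> x /=; [move/eqP; rewrite subr_eq0 => /eqP|move=> ->; rewrite subrr].
move=> h i.
have /choice[C CE] : forall i, exists C, represents kappa' C (c i).
  by move=> j; exact: chart_frac kY _.
apply/(chart_rat_eq0 kY (CE i)); move: i; apply: b_free.
have R : represents kappa (\sum_i fpull phi_indep (C i) * b i)
    (fun x => \sum_i c i (eta x) * r i x).
  by apply: represents_sum => i; apply: representsM => //; exact: represents_fpull.
exact/(chart_rat_eq0 kX R).
Qed.

(** [d_eta] selects some [d] with [has_degree]; its value is known only once all bases are shown to
    have the same size. *)
Lemma chart_has_degree_uniq d' : has_degree eta d' -> d' = d.
Proof.
move=> [r [r_span r_free]].
have /choice[b' b'E] : forall i, exists F, represents kappa F (r i).
  by move=> i; exact: chart_frac kX _.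
have b'_free (C : 'I_d' -> _) : \sum_i fpull phi_indep (C i) * b' i = 0 -> forall i, C i = 0.
  move=> C0; have /choice[c cE] : forall i, exists c : ratfun Y, represents kappa' (C i) c.
    by move=> i; exact: chart_ratfun kY _.
  move=> i; apply/(chart_rat_eq0 kY (cE i)); move: i; apply: r_free.
  have R : represents kappa (\sum_i fpull phi_indep (C i) * b' i)
      (fun x => \sum_i c i (eta x) * r i x).
    by apply: represents_sum => i; apply: representsM => //; exact: represents_fpull.
  exact/(chart_rat_eq0 kX R).
have b'_span F : exists C, F = \sum_i fpull phi_indep (C i) * b' i.
  have [f fE] := chart_ratfun kX F; have [c cE] := r_span f.
  have /choice[C CE] : forall i, exists C, represents kappa' C (c i).
    by move=> j; exact: chart_frac kY _.
  exists C; apply/eqP; rewrite -subr_eq0; apply/eqP.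
  have R : represents kappa (F - \sum_i fpull phi_indep (C i) * b' i)
      (fun x => f x - \sum_i c i (eta x) * r i x).
    apply: representsB => //.
    by apply: represents_sum => i; apply: representsM => //; exact: represents_fpull.
  apply: (chart_rat_eq0 kX R).1; move: cE; congr generically.
  by apply/seteqP; split=> x /=; [move=> ->; rewrite subrr|move/eqP; rewrite subr_eq0 => /eqP].
apply/eqP; rewrite eqn_leq; apply/andP; split.
  exact: (basis_size b'_free b_span b'_span).
exact: (basis_size b_free b'_span b_span).
Qed.

End ChartDegree.
End Charts.

(** * Polynomial and regular functions *)

Section PolynomialFunctions.
Variables (K : fieldType) (X : coordSpace K).

Lemma polyfun_sum I (r : seq I) (P : pred I) (F : I -> X -> K) :
  (forall i, polyfun (F i)) -> polyfun (fun x => \sum_(i <- r | P i) F i x).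
Proof.
move=> h; elim: r => [|i r IH].
  by rewrite (funext (fun x => big_nil _ _ _ _)); exact: polyfun_cst.
rewrite (funext (fun x => big_cons _ _ _ _ _ _)); case: (P i) => //.
exact: polyfunD.
Qed.

Lemma polyfun_prod I (r : seq I) (P : pred I) (F : I -> X -> K) :
  (forall i, polyfun (F i)) -> polyfun (fun x => \prod_(i <- r | P i) F i x).
Proof.
move=> h; elim: r => [|i r IH].
  by rewrite (funext (fun x => big_nil _ _ _ _)); exact: polyfun_cst.
rewrite (funext (fun x => big_cons _ _ _ _ _ _)); case: (P i) => //.
exact: polyfunM.
Qed.

Lemma polyfunX (f : X -> K) k : polyfun f -> polyfun (fun x => f x ^+ k).
Proof.
move=> h; elim: k => [|k IH].
  by rewrite (funext (fun x => expr0 _)); exact: polyfun_cst.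
by rewrite (funext (fun x => exprS _ _)); apply: polyfunM.
Qed.

Lemma polyfunN (f : X -> K) : polyfun f -> polyfun (fun x => - f x).
Proof.
move=> h; rewrite (_ : (fun x => - f x) = fun x => -1 * f x).
  by apply: polyfunM => //; exact: polyfun_cst.
by apply/funext => x; rewrite mulN1r.
Qed.

Lemma polyfunB (f g : X -> K) : polyfun f -> polyfun g -> polyfun (fun x => f x - g x).
Proof. by move=> hf hg; apply: polyfunD => //; exact: polyfunN. Qed.

Lemma polyfun_det n (A : X -> 'M[K]_n) :
  (forall i j, polyfun (fun x => A x i j)) -> polyfun (fun x => \det (A x)).
Proof.
move=> h; apply: polyfun_sum => s; apply: polyfunM; first exact: polyfun_cst.
by apply: polyfun_prod => i.
Qed.

Lemma polyfun_adj n (A : X -> 'M[K]_n) i j :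
  (forall i j, polyfun (fun x => A x i j)) -> polyfun (fun x => \adj (A x) i j).
Proof.
move=> h; under eq_fun do rewrite mxE.
apply: polyfunM; first exact: polyfun_cst; apply: polyfun_det => k l.
by under eq_fun do rewrite !mxE.
Qed.

Lemma polyfun_meval n (h : 'I_n -> X -> K) (q : mpoly n K) :
  (forall i, polyfun (h i)) -> polyfun (fun x => meval (fun i => h i x) q).
Proof.
move=> hh; apply: polyfun_sum => m; apply: polyfunM; first exact: polyfun_cst.
by apply: polyfun_prod => i; apply: polyfunX.
Qed.

End PolynomialFunctions.

Lemma polyfun_comp (K : fieldType) (X Y : coordSpace K) (phi : X -> Y) (f : Y -> K) :
  (forall c, coordfun c -> polyfun (c \o phi)) -> polyfun f -> polyfun (f \o phi).
Proof.
move=> h; elim=> [c|g gc|g1 g2 _ h1 _ h2|g1 g2 _ h1 _ h2].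
- exact: polyfun_cst.
- exact: h.
- exact: polyfunD.
- exact: polyfunM.
Qed.

(** The coordinates are indexed by an arbitrary finite type because they will be matrix entries;
    [polyfun_mpoly] numbers them when multivariate polynomials are wanted. *)
Definition aff (K : fieldType) (J : finType) : coordSpace K :=
  @CoordSpace K (J -> K) [set f | exists j, f = fun v => v j].

Lemma polyfun_aff (K : fieldType) (J : finType) j : polyfun (X := aff K J) (fun v => v j).
Proof. by apply: polyfun_coord; exists j. Qed.

Lemma polyfun_mpoly (K : fieldType) (J : finType) N (e : J -> 'I_N) (f : aff K J -> K) :
  polyfun f -> exists q : mpoly N K, forall v, f (fun j => v (e j)) = meval v q.
Proof.
elim=> [c|g [j ->]|g h _ [p pE] _ [q qE]|g h _ [p pE] _ [q qE]].
- by exists (mpolyC N c) => v; rewrite mevalC.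
- by exists (mpolyX K (mnm1 (e j))) => v; rewrite mevalXU.
- by exists (p + q) => v; rewrite mevalD pE qE.
- by exists (p * q) => v; rewrite mevalM pE qE.
Qed.

(** Affine space is irreducible: polynomials form a domain, and over this field a non-zero
    polynomial is a non-zero function. *)
Lemma polyfun_neq0M (K : closedFieldType) (J : finType) (f g : aff K J -> K) :
  polyfun f -> polyfun g -> (exists v, f v != 0) -> (exists v, g v != 0) ->
  exists v, f v != 0 /\ g v != 0.
Proof.
move=> pf pg [v fv] [w gw].
have [p pE] := polyfun_mpoly (@enum_rank J) pf; have [q qE] := polyfun_mpoly (@enum_rank J) pg.
have KE (u : J -> K) : (fun j => (u \o enum_val) (enum_rank j)) = u.
  by apply/funext => j /=; rewrite enum_rankK.
have p0 : p != 0.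
  by apply: contraNneq fv => p0; rewrite -(KE v) pE p0 meval0.
have q0 : q != 0.
  by apply: contraNneq gw => q0; rewrite -(KE w) qE q0 meval0.
have [u] := mpoly_eval_neq0 (mulf_neq0 p0 q0); rewrite mevalM mulf_eq0 negb_or.
by move=> /andP[pu qu]; exists (fun j => u (enum_rank j)); rewrite pE qE.
Qed.

Lemma zariski_openE (K : fieldType) (S : coordSpace K) (U : set (zariski S)) :
  open U = zariski_open U.
Proof. by []. Qed.

Section RegularFunctions.
Variables (K : fieldType) (S : coordSpace K) (U : set (zariski S)).

Lemma regular_polyfun f : polyfun f -> affine_regular U f.
Proof.
move=> pf x Ux; exists f, (fun=> 1); split=> //; [exact: polyfun_cst|exact: oner_neq0|].
by move=> y _ _; rewrite divr1.
Qed.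

Lemma eq_regular f g : (forall x, U x -> f x = g x) -> affine_regular U f -> affine_regular U g.
Proof.
move=> fg hf x Ux; have [p [q [pp pq qx h]]] := hf x Ux.
by exists p, q; split=> // y Uy qy; rewrite -fg // h.
Qed.

Lemma regularD f g : affine_regular U f -> affine_regular U g ->
  affine_regular U (fun x => f x + g x).
Proof.
move=> hf hg x Ux; have [p [q [pp pq qx hf']]] := hf x Ux.
have [p' [q' [pp' pq' qx' hg']]] := hg x Ux.
exists (fun y => p y * q' y + p' y * q y), (fun y => q y * q' y); split.
- by apply: polyfunD; apply: polyfunM.
- exact: polyfunM.
- by rewrite mulf_neq0.
move=> y Uy; rewrite mulf_eq0 negb_or => /andP[qy q'y].
by rewrite hf' // hg' // addf_div.
Qed.

Lemma regularM f g : affine_regular U f -> affine_regular U g ->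
  affine_regular U (fun x => f x * g x).
Proof.
move=> hf hg x Ux; have [p [q [pp pq qx hf']]] := hf x Ux.
have [p' [q' [pp' pq' qx' hg']]] := hg x Ux.
exists (fun y => p y * p' y), (fun y => q y * q' y); split.
- exact: polyfunM.
- exact: polyfunM.
- by rewrite mulf_neq0.
move=> y Uy; rewrite mulf_eq0 negb_or => /andP[qy q'y].
by rewrite hf' // hg' // mulf_div.
Qed.

Lemma regularV f : (forall x, U x -> f x != 0) -> affine_regular U f ->
  affine_regular U (fun x => (f x)^-1).
Proof.
move=> f0 hf x Ux; have [p [q [pp pq qx hf']]] := hf x Ux.
have px : p x != 0 by apply: contraNneq (f0 x Ux) => px; rewrite hf' // px mul0r.
exists (fun y => q y * q y), (fun y => p y * q y); split.
- exact: polyfunM.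
- exact: polyfunM.
- by rewrite mulf_neq0.
move=> y Uy; rewrite mulf_eq0 negb_or => /andP[py qy].
by rewrite hf' // invf_div -mulf_div divff // mulr1.
Qed.

Lemma regular_sum I (r : seq I) (P : pred I) (F : I -> S -> K) :
  (forall i, affine_regular U (F i)) -> affine_regular U (fun x => \sum_(i <- r | P i) F i x).
Proof.
move=> h; elim: r => [|i r IH].
  by rewrite (funext (fun x => big_nil _ _ _ _)); apply: regular_polyfun; exact: polyfun_cst.
rewrite (funext (fun x => big_cons _ _ _ _ _ _)); case: (P i) => //.
exact: regularD.
Qed.

Lemma regular_comp (Y : coordSpace K) (phi : S -> Y) (f : Y -> K) :
  (forall c, coordfun c -> affine_regular U (c \o phi)) -> polyfun f ->
  affine_regular U (f \o phi).
Proof.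
move=> h; elim=> [c|g gc|g1 g2 _ h1 _ h2|g1 g2 _ h1 _ h2].
- by apply: regular_polyfun; exact: polyfun_cst.
- exact: h.
- exact: regularD.
- exact: regularM.
Qed.

Lemma regular_neq0_open f : open U -> affine_regular U f -> open (U `&` [set x | f x != 0]).
Proof.
rewrite !zariski_openE => oU hf x [Ux fx]; have [p [q [pp pq qx h]]] := hf x Ux.
have [u [pu ux uU]] := oU x Ux.
have px : p x != 0 by apply: contraNneq fx => px; rewrite h // px mul0r.
exists (fun y => u y * (p y * q y)); split.
- by do 2! apply: polyfunM => //.
- by rewrite !mulf_neq0.
move=> y; rewrite !mulf_eq0 !negb_or => /andP[uy /andP[py qy]]; split; first exact: uU.
by rewrite /= h ?mulf_neq0 ?invr_eq0 //; exact: uU.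
Qed.

End RegularFunctions.

Lemma regularS (K : fieldType) (S : coordSpace K) (U V : set (zariski S)) f :
  U `<=` V -> affine_regular V f -> affine_regular U f.
Proof.
move=> UV hf x /UV Vx; have [p [q [pp pq qx h]]] := hf x Vx.
by exists p, q; split=> // y /UV Vy; apply: h.
Qed.

Definition irreducible_space (K : fieldType) (S : coordSpace K) : Prop :=
  forall f g : S -> K, polyfun f -> polyfun g -> (exists x, f x != 0) ->
  (exists x, g x != 0) -> exists x, f x != 0 /\ g x != 0.

Lemma irreducible_openI (K : fieldType) (S : coordSpace K) (U V : set (zariski S)) :
  irreducible_space S -> open U -> open V -> U !=set0 -> V !=set0 -> (U `&` V) !=set0.
Proof.
rewrite !zariski_openE => S_irr oU oV [x Ux] [y Vy].
have [f [pf fx fU]] := oU x Ux; have [g [pg gy gV]] := oV y Vy.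
have [z [fz gz]] := S_irr f g pf pg (ex_intro _ x fx) (ex_intro _ y gy).
by exists z; split; [exact: fU|exact: gV].
Qed.

(** * Charts obtained from a section of a quotient map *)

Section ChartFromSection.
Variables (K : closedFieldType) (S : coordSpace K) (X : funSpace K) (proj : zariski S -> X).
Hypothesis proj_open : forall O : set X, open O <-> open (proj @^-1` O).
Hypothesis proj_regular : forall (O : set X) f,
  regular O f <-> affine_regular (proj @^-1` O) (f \o proj).
Hypothesis proj_surj : forall x, exists s, proj s = x.
Hypothesis S_irr : irreducible_space S.
Variables (J : finType) (sigma : (J -> K) -> S) (D : set (zariski S)) (rho : S -> J -> K).
Hypothesis sigma_poly : forall c, coordfun c -> polyfun (X := aff K J) (c \o sigma).
Hypothesis D_open : open D.
Hypothesis rho_regular : forall j, affine_regular D (fun x => rho x j).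
Hypothesis D_sigma : forall v, D (sigma v).
Hypothesis sigmaK : forall v, rho (sigma v) = v.
Hypothesis rhoK : forall x, D x -> proj (sigma (rho x)) = proj x.
Hypothesis rho_inv : forall x x', D x -> proj x = proj x' -> D x' /\ rho x = rho x'.
Variables (N : nat) (e : J -> 'I_N) (e' : 'I_N -> J).
Hypotheses (eK : cancel e e') (eK' : cancel e' e).

Let kappa (v : 'I_N -> K) : X := proj (sigma (fun j => v (e j))).

Let eKf (w : J -> K) : (fun j => (w \o e') (e j)) = w.
Proof. by apply/funext => j /=; rewrite eK. Qed.

Let meet_D (O : set X) : open O -> O !=set0 -> exists v, O (proj (sigma v)).
Proof.
move=> /proj_open oO [x Ox]; have [s sx] := proj_surj x.
have [|t [Dt Ot]] := irreducible_openI S_irr D_open oO (ex_intro _ _ (D_sigma (fun=> 0))).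
  by exists s; rewrite /preimage /= sx.
by exists (rho t); rewrite rhoK.
Qed.

Let sigma_mpoly f : polyfun f ->
  exists q : mpoly N K, forall v, f (sigma (fun j => v (e j))) = meval v q.
Proof.
by move=> /(polyfun_comp sigma_poly)/(polyfun_mpoly e).
Qed.

Let mpoly_neq0 f (q : mpoly N K) : (forall v, f (sigma (fun j => v (e j))) = meval v q) ->
  (exists v, f (sigma v) != 0) -> q != 0.
Proof.
by move=> fq [v]; rewrite -(eKf v) fq; apply: contraNneq => ->; rewrite meval0.
Qed.

Let openP (O : set X) : open O -> O !=set0 ->
  exists2 f : mpoly N K, f != 0 & forall v, meval v f != 0 -> O (kappa v).
Proof.
move=> oO O0; have [v Ov] := meet_D oO O0; have := oO; rewrite proj_open zariski_openE => poO.
have [f [pf fv fO]] := poO _ Ov; have [q qE] := sigma_mpoly pf.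
exists q; first by apply: mpoly_neq0 qE _; exists v.
by move=> w; rewrite -qE => /fO.
Qed.

Let fracE (r : ratfun X) : exists f, represents kappa f r.
Proof.
have oO := ratdom_open r; have [v Ov] := meet_D oO (ratdom_neq0 r).
have /proj_regular rr := @ratval_regular _ _ r.
have [p [q [pp pq qv pqE]]] := rr _ Ov.
have [g g0 gO] := openP oO (ratdom_neq0 r).
have [P PE] := sigma_mpoly pp; have [Q QE] := sigma_mpoly pq.
have Q0 : Q != 0 by apply: mpoly_neq0 QE _; exists v.
exists (P%:F / Q%:F), (Q * g); first by rewrite mulf_neq0.
move=> w; rewrite mevalM mulf_eq0 negb_or => /andP[Qw gw].
exists P, Q; split=> //; first by apply: divfK; rewrite tofrac_eq0.
have := pqE (sigma (fun j => w (e j))); rewrite QE PE => /(_ (gO _ gw) Qw) /= ->.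
by rewrite divfK.
Qed.

(** An arbitrary choice of representatives, without any regularity. Functions of [rho] nevertheless
    descend to regular functions, because by [rho_inv] the set [D] is saturated and [rho] is
    constant on the fibres in [D]. *)
Let sec := projT1 (choice proj_surj).
Let secK x : proj (sec x) = x.
Proof. exact: projT2 (choice proj_surj) x. Qed.

Let ev (p : mpoly N K) (s : S) := meval (fun i => rho s (e' i)) p.

Let ev_regular p : affine_regular D (ev p).
Proof.
apply: (@regular_comp _ _ _ (aff K J) rho (fun w => meval (fun i => w (e' i)) p)).
  by move=> c [j ->]; exact: rho_regular.
by apply: polyfun_meval => i; exact: polyfun_aff.
Qed.

Let dom (g : mpoly N K) : set X := [set x | D (sec x) /\ ev g (sec x) != 0].

Let dom_pre g : proj @^-1` (dom g) = D `&` [set s | ev g s != 0].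
Proof.
apply/seteqP; split=> s [Ds gs]; have E := secK (proj s).
  by have [? rE] := rho_inv Ds E; split=> //; move: gs; rewrite /= /ev rE.
by have [? rE] := rho_inv Ds (esym E); split=> //; move: gs; rewrite /= /ev rE.
Qed.

Let dom_open g : open (dom g).
Proof.
by apply/proj_open; rewrite dom_pre; apply: regular_neq0_open => //; exact: ev_regular.
Qed.

Let kappa_dom g v : meval v g != 0 -> dom g (kappa v).
Proof.
move=> gv; suff : (proj @^-1` (dom g)) (sigma (fun j => v (e j))) by [].
rewrite dom_pre; split; first exact: D_sigma.
by rewrite /= /ev sigmaK (_ : (fun i => _) = v) //; apply/funext => i; rewrite eK'.
Qed.

Let dom_neq0 g : g != 0 -> dom g !=set0.
Proof. by case/mpoly_eval_neq0 => v gv; exists (kappa v); exact: kappa_dom. Qed.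

Let rat (a b : mpoly N K) (x : X) : K := ev a (sec x) / ev b (sec x).

Let rat_proj a b s : D s -> rat a b (proj s) = ev a s / ev b s.
Proof.
by move=> Ds; have [_ rE] := rho_inv Ds (esym (secK (proj s))); rewrite /rat /ev -rE.
Qed.

Let rat_regular a b : regular (dom b) (rat a b).
Proof.
apply/proj_regular; rewrite dom_pre.
apply: (@eq_regular _ _ _ (fun s => ev a s * (ev b s)^-1)).
  by move=> s [Ds _]; rewrite /= rat_proj.
apply: regularM; first by apply: regularS (ev_regular a); exact: subIsetl.
by apply: regularV => [s []//|]; apply: regularS (ev_regular b); exact: subIsetl.
Qed.

(** [sigma] and [rho] identify affine space with the image of the saturated open set [D]. As [S] is
    irreducible, this image meets every non-empty open set, so rational functions can be read on
    it. *)
Lemma chart_from_section : is_chart kappa.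
Proof.
split; [exact: openP|exact: fracE| |].
  move=> f; have [a [b [b0 fE]]] := fracP f.
  exists (Ratfun (dom_open b) (dom_neq0 b0) (rat_regular a b)); exists b => // v bv.
  have vE : (fun i : 'I_N => v (e (e' i))) = v by apply/funext => i; rewrite eK'.
  exists a, b; split=> //; first by rewrite fE; apply: divfK; rewrite tofrac_eq0.
  by rewrite /= rat_proj; [rewrite /ev sigmaK vE divfK|exact: D_sigma].
move=> g g0; exists (dom g); split; [exact: dom_open|exact: dom_neq0|].
move=> x [Dx gx]; exists (fun i => rho (sec x) (e' i)) => //.
by rewrite /kappa (eKf (rho (sec x))) rhoK.
Qed.

End ChartFromSection.

(** * Matrices indexed by finite types *)

Section FunctionMatrices.
Variable K : fieldType.

(** Matrices are functions on finite types, so that a sum type of indices gives a block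
    decomposition without casts between ordinals. *)
Definition fmul (A B C : finType) (f : A -> B -> K) (g : B -> C -> K) : A -> C -> K :=
  fun a c => \sum_b f a b * g b c.

Definition fone (A : finType) : A -> A -> K := fun x y => (x == y)%:R.

Definition funi (A : finType) (m : A -> A -> K) : A -> A -> K :=
  fun x y => fone x y + m x y.

Local Notation "f ** g" := (fmul f g) (at level 40, left associativity).

Lemma fmatP (A B : Type) (f g : A -> B -> K) : (forall a b, f a b = g a b) -> f = g.
Proof. by move=> h; apply/funext => a; apply/funext => b. Qed.

Lemma fmulA (A B C D : finType) (f : A -> B -> K) (g : B -> C -> K) (h : C -> D -> K) :
  f ** (g ** h) = f ** g ** h.
Proof.
apply: fmatP => a d; rewrite /fmul.
under eq_bigr => b _ do rewrite mulr_sumr.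
rewrite exchange_big; apply: eq_bigr => c _; rewrite mulr_suml.
by apply: eq_bigr => b _; rewrite mulrA.
Qed.

Lemma fmul1 (A B : finType) (f : A -> B -> K) : @fone A ** f = f.
Proof.
apply: fmatP => a b; rewrite /fmul (bigD1 a) //= /fone eqxx mul1r big1 ?addr0 // => x.
by rewrite eq_sym => /negPf->; rewrite mul0r.
Qed.

Lemma fmulr1 (A B : finType) (f : A -> B -> K) : f ** @fone B = f.
Proof.
apply: fmatP => a b; rewrite /fmul (bigD1 b) //= /fone eqxx mulr1 big1 ?addr0 // => x.
by move=> /negPf->; rewrite mulr0.
Qed.

Lemma fmul_unil (A B : finType) (m : A -> A -> K) (f : A -> B -> K) a b :
  (funi m ** f) a b = f a b + (m ** f) a b.
Proof.
rewrite -{2}[f]fmul1 /fmul -big_split; apply: eq_bigr => c _; exact: mulrDl.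
Qed.

Lemma fmul_unir (A B : finType) (m : B -> B -> K) (f : A -> B -> K) a b :
  (f ** funi m) a b = f a b + (f ** m) a b.
Proof.
rewrite -{2}[f]fmulr1 /fmul -big_split; apply: eq_bigr => c _; exact: mulrDr.
Qed.

Lemma fmulBr (A B C : finType) (f : A -> B -> K) (g h : B -> C -> K) :
  f ** (fun x y => g x y - h x y) = fun x y => (f ** g) x y - (f ** h) x y.
Proof.
by apply: fmatP => a c; rewrite /fmul -sumrB; apply: eq_bigr => b _; rewrite mulrBr.
Qed.

Lemma funi0 (A : finType) : funi (fun _ _ : A => 0) = @fone A.
Proof. by apply: fmatP => x y; rewrite /funi addr0. Qed.

Lemma funi_inj (A : finType) (m m' : A -> A -> K) : funi m = funi m' -> m = m'.
Proof.
move=> e; apply: fmatP => x y; have := congr1 (fun f => f x y) e.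
by move/addrI.
Qed.

Lemma fone_subK (A : finType) (f : A -> A -> K) : funi (fun x y => f x y - fone x y) = f.
Proof. by apply: fmatP => x y; rewrite /funi addrC subrK. Qed.

(** The entry at [a], [b] will be the coefficient of the basis vector [a] in the image of the basis
    vector [b]. Thus [upper] says that levels do not rise, which is the condition defining the
    parabolic subgroup and [Cplus]; [lowtri] gives the Lie algebra of the opposite unipotent
    group. *)
Definition upper (A B : Type) (la : A -> nat) (lb : B -> nat) (f : A -> B -> K) : Prop :=
  forall a b, (lb b < la a)%N -> f a b = 0.

Definition lowtri (A : Type) (l : A -> nat) (m : A -> A -> K) : Prop :=
  forall x y, (l x <= l y)%N -> m x y = 0.

Lemma upperM (A B C : finType) la lb lc (f : A -> B -> K) (g : B -> C -> K) :
  upper la lb f -> upper lb lc g -> upper la lc (f ** g).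
Proof.
move=> uf ug a c ca; apply: big1 => b _; case: (ltnP (lb b) (la a)) => ba.
  by rewrite uf // mul0r.
by rewrite ug ?mulr0 //; exact: leq_trans ba.
Qed.

Lemma upper1 (A : finType) (l : A -> nat) : upper l l (@fone A).
Proof. by move=> x y; rewrite /fone; case: eqP => // ->; rewrite ltnn. Qed.

Definition raises (A : Type) (l : A -> nat) k (f : A -> A -> K) : Prop :=
  forall x y, (l x < l y + k)%N -> f x y = 0.

Lemma raisesM (A : finType) (l : A -> nat) j k f g :
  raises l j f -> raises l k g -> raises l (j + k) (f ** g).
Proof.
move=> rf rg x y xy; apply: big1 => z _; case: (ltnP (l x) (l z + j)) => h.
  by rewrite rf // mul0r.
rewrite rg ?mulr0 // -(ltn_add2r j); apply: leq_ltn_trans h _.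
by rewrite -addnA [(k + j)%N]addnC.
Qed.

Lemma lowtri_raises (A : Type) (l : A -> nat) m : lowtri l m -> raises l 1 m.
Proof. by move=> h x y; rewrite addn1 => xy; apply: h. Qed.

Fixpoint geo (A : finType) (m : A -> A -> K) k : A -> A -> K :=
  if k is k'.+1 then fun x y => fone x y - (m ** geo m k') x y else @fone A.

(** This is [(1 + m)^-1 - 1] by the Neumann series: [geo m k] is the sum of [(- m)^i] for [i <= k],
    and for strictly lower [m] the powers beyond the highest level vanish. The inverse is therefore
    polynomial in the entries of [m]. *)
Definition linv (A : finType) (l : A -> nat) (m : A -> A -> K) : A -> A -> K :=
  fun x y => geo m (\max_x l x)%N x y - fone x y.

Lemma funi_linv (A : finType) (l : A -> nat) m : funi (linv l m) = geo m (\max_x l x)%N.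
Proof. exact: fone_subK. Qed.

Lemma geo_raises (A : finType) (l : A -> nat) m k : lowtri l m -> raises l 0 (geo m k).
Proof.
move=> /lowtri_raises ml; have r1 : raises l 0 (@fone A).
  by move=> x y; rewrite addn0 /fone; case: eqP => // ->; rewrite ltnn.
elim: k => //= k IH x y xy; rewrite r1 // sub0r (raisesM ml IH) ?oppr0 //.
by apply: leq_trans xy _; rewrite leq_add2l.
Qed.

Lemma linv_lowtri (A : finType) (l : A -> nat) m : lowtri l m -> lowtri l (linv l m).
Proof.
move=> ml x y xy; rewrite /linv; case: (\max_x l x)%N => [|k] /=; first by rewrite subrr.
rewrite addrAC subrr sub0r; apply/eqP; rewrite oppr_eq0; apply/eqP.
by apply: (raisesM (lowtri_raises ml) (geo_raises k ml)); rewrite addn1.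
Qed.

(** Up to sign the error is [m^(k+1)]: it is [m] for [k = 0] and is multiplied by [- m] at each
    step. *)
Lemma geo_errorE (A : finType) (l : A -> nat) m k : lowtri l m ->
  raises l k.+1 (fun x y => (funi m ** geo m k) x y - fone x y).
Proof.
move=> ml; elim: k => [|k IH] x y xy.
  by rewrite fmulr1 /funi addrAC subrr add0r (lowtri_raises ml).
have -> : (funi m ** geo m k.+1) x y - fone x y =
    - (m ** (fun x y => (funi m ** geo m k) x y - fone x y)) x y.
  have mC : m ** funi m = funi m ** m.
    by apply: fmatP => a b; rewrite fmul_unil fmul_unir.
  rewrite fmulBr fmulr1 fmulA mC -fmulA /= fmulBr fmulr1 opprB.
  by rewrite addrAC /funi [fone x y + _]addrC addrK.
apply/eqP; rewrite oppr_eq0; apply/eqP.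
by apply: (raisesM (lowtri_raises ml) IH); rewrite add1n.
Qed.

Lemma funi_linvr (A : finType) (l : A -> nat) m :
  lowtri l m -> funi m ** funi (linv l m) = @fone A.
Proof.
move=> ml; rewrite funi_linv; apply: fmatP => x y; apply/eqP; rewrite -subr_eq0; apply/eqP.
have h := geo_errorE (k := (\max_x l x)%N) ml; apply: (h x y); rewrite addnS ltnS.
by apply: leq_trans (leq_addl _ _); exact: (leq_bigmax x).
Qed.

Lemma funi_linvl (A : finType) (l : A -> nat) m :
  lowtri l m -> funi (linv l m) ** funi m = @fone A.
Proof.
move=> ml; have h := funi_linvr ml; have h' := funi_linvr (linv_lowtri ml).
suff E : funi m = funi (linv l (linv l m)) by rewrite E.
by rewrite -[LHS]fmulr1 -h' fmulA h fmul1.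
Qed.

Lemma lowtri_mulM (A : finType) (l : A -> nat) m n : lowtri l m -> lowtri l n ->
  exists2 k, lowtri l k & funi m ** funi n = funi k.
Proof.
move=> ml nl; exists (fun x y => m x y + n x y + (m ** n) x y).
  move=> x y xy; rewrite ml // nl // add0r add0r.
  apply: (raisesM (lowtri_raises ml) (lowtri_raises nl)).
  by apply: leq_ltn_trans xy _; rewrite -{1}[l y]addn0 ltn_add2l.
apply: fmatP => x y; rewrite fmul_unil /funi.
have -> : (m ** (fun x y => fone x y + n x y)) x y = m x y + (m ** n) x y.
  exact: fmul_unir.
by rewrite -!addrA; congr (_ + _); rewrite addrCA.
Qed.

Lemma upper_lowtri_eq0 (A : finType) (l : A -> nat) m :
  upper l l (funi m) -> lowtri l m -> m = fun _ _ => 0.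
Proof.
move=> um ml; apply: fmatP => x y; case: (leqP (l x) (l y)) => xy; first exact: ml.
have := um _ _ xy; rewrite /funi /fone; case: eqP xy => [->|_ _]; first by rewrite ltnn.
by rewrite add0r.
Qed.

(** The opposite unipotent group meets the parabolic group only in 1, since an upper [1 + k] with
    [k] strictly lower has [k = 0]. A flag of the big cell thus comes from only one [m]. *)
Lemma upper_quot_eq (A : finType) (l : A -> nat) m n : lowtri l m -> lowtri l n ->
  upper l l (funi (linv l m) ** funi n) -> n = m.
Proof.
move=> ml nl un; have [k kl kE] := lowtri_mulM (linv_lowtri ml) nl.
have k0 : k = fun _ _ => 0 by apply: upper_lowtri_eq0 kl; rewrite -kE.
by apply: funi_inj; rewrite -[LHS]fmul1 -(funi_linvr ml) -fmulA kE k0 funi0 fmulr1.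
Qed.

(** * Cramer's rule for systems indexed by a finite type *)

Section Cramer.
Variables (S : finType) (A : S -> S -> K).

Definition smat : 'M[K]_#|S| := \matrix_(i, j) A (enum_val i) (enum_val j).
Definition sdet : K := \det smat.
Definition sadj : S -> S -> K := fun s t => \adj smat (enum_rank s) (enum_rank t).

Lemma sum_enum_rank (M : nmodType) (F : S -> M) : \sum_s F s = \sum_(i < #|S|) F (enum_val i).
Proof.
rewrite (reindex (fun i : 'I_#|S| => enum_val i)) //.
by exists enum_rank => i _; [exact: enum_valK|exact: enum_rankK].
Qed.

Lemma smat_adj : A ** sadj = fun s t => sdet * fone s t.
Proof.
apply: fmatP => s t; rewrite /fmul sum_enum_rank.
have := congr1 (fun M : 'M_#|S| => M (enum_rank s) (enum_rank t)) (mul_mx_adj smat).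
rewrite !mxE /sdet /fone (inj_eq enum_rank_inj) mulr_natr => <-.
by apply: eq_bigr => i _; rewrite mxE enum_rankK /sadj enum_valK.
Qed.

Lemma sadj_mat : sadj ** A = fun s t => sdet * fone s t.
Proof.
apply: fmatP => s t; rewrite /fmul sum_enum_rank.
have := congr1 (fun M : 'M_#|S| => M (enum_rank s) (enum_rank t)) (mul_adj_mx smat).
rewrite !mxE /sdet /fone (inj_eq enum_rank_inj) mulr_natr => <-.
by apply: eq_bigr => i _; rewrite [smat _ _]mxE enum_rankK /sadj enum_valK.
Qed.

Lemma sdet_neq0 : (forall v : S -> K, (forall s, \sum_t v t * A t s = 0) -> forall t, v t = 0) ->
  sdet != 0.
Proof.
move=> inj; apply/det0P => -[v v0 vA].
have /rV0Pn[j /eqP[]] := v0; rewrite -[j]enum_valK.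
apply: (inj (fun s => v 0 (enum_rank s))) => s.
have := congr1 (fun M : 'rV_#|S| => M 0 (enum_rank s)) vA; rewrite !mxE => h.
rewrite sum_enum_rank -[RHS]h; apply: eq_bigr => i _.
by rewrite !mxE enum_valK enum_rankK.
Qed.

Lemma sdet_solve (b : S -> K) : sdet != 0 ->
  forall s, \sum_t (\sum_r b r * sadj r t / sdet) * A t s = b s.
Proof.
move=> d0 s; under eq_bigr => t _ do rewrite mulr_suml.
rewrite exchange_big /=.
have E r : \sum_t b r * sadj r t / sdet * A t s = b r / sdet * (sadj ** A) r s.
  by rewrite /fmul mulr_sumr; apply: eq_bigr => t _; rewrite !mulrA; congr (_ * _); rewrite mulrAC.
under eq_bigr => r _ do rewrite E sadj_mat.
rewrite (bigD1 s) //= big1 => [|r rs]; last by rewrite /fone (negPf rs) !mulr0.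
by rewrite addr0 /fone eqxx mulr1 divfK.
Qed.

Lemma sdet_inj (v : S -> K) : sdet != 0 ->
  (forall s, \sum_t v t * A t s = 0) -> forall t, v t = 0.
Proof.
move=> d0 vA t; apply: (mulIf d0); rewrite mul0r.
have := congr1 (fun f => ((fun _ : unit => v) ** f) tt t) smat_adj.
rewrite /= fmulA {1}/fmul big1 => [|s _]; last by rewrite [X in X * _]vA mul0r.
rewrite /fmul (bigD1 t) //= big1 ?addr0 => [|s st]; last by rewrite /fone (negPf st) !mulr0.
by rewrite /fone eqxx mulr1.
Qed.

End Cramer.

Lemma fmul_right_inv (A : finType) (f g : A -> A -> K) : f ** g = @fone A -> g ** f = @fone A.
Proof.
move=> fg; have d0 : sdet f != 0.
  apply: sdet_neq0 => v vf t.
  have := congr1 (fun h => ((fun _ : unit => v) ** h) tt t) fg; rewrite /= fmulr1 fmulA => <-.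
  by apply: big1 => s _; rewrite [X in X * _]vf mul0r.
pose h : A -> A -> K := fun x t => \sum_r fone x r * sadj f r t / sdet f.
have hf : h ** f = @fone A by apply: fmatP => x s; exact: (sdet_solve (fone x) d0).
suff -> : g = h by [].
by rewrite -[g]fmul1 -hf -fmulA fg fmulr1.
Qed.

End FunctionMatrices.

(** * Generic fibres *)

Definition has_card (T : Type) (A : set T) n : Prop :=
  exists f : 'I_n -> T, injective f /\ forall t, A t <-> exists i, t = f i.

Lemma has_card_uniq T (A : set T) m n : has_card A m -> has_card A n -> m = n.
Proof.
suff le p q : has_card A p -> has_card A q -> (p <= q)%N.
  by move=> hm hn; apply/eqP; rewrite eqn_leq !le.
move=> [f [f_inj fA]] [g [g_inj gA]].
have /choice[h hE] : forall i, exists j, f i = g j by move=> i; apply/gA/fA; exists i.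
have h_inj : injective h by move=> i j e; apply: f_inj; rewrite !hE e.
by have := leq_card h h_inj; rewrite !card_ord.
Qed.

Lemma has_card_image T U (A : set T) (B : set U) n (f : T -> U) :
  (forall t t', A t -> A t' -> f t = f t' -> t = t') ->
  (forall u, B u <-> exists2 t, A t & f t = u) -> has_card A n -> has_card B n.
Proof.
move=> f_inj fB [g [g_inj gA]]; exists (f \o g); split.
  by move=> i j /= e; apply: g_inj; apply: f_inj => //; apply/gA; [exists i|exists j].
move=> u; rewrite fB; split=> [[t /gA[i ->] <-]|[i ->]]; first by exists i.
by exists (g i) => //; apply/gA; exists i.
Qed.

Lemma has_card_fin T (A : set T) (I : finType) (f : I -> T) :
  injective f -> (forall t, A t <-> exists i, t = f i) -> has_card A #|I|.
Proof.
move=> f_inj fA; exists (f \o enum_val); split; first exact: inj_comp f_inj enum_val_inj.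
move=> t; rewrite fA; split=> -[i ->]; last by exists (enum_val i).
by exists (enum_rank i); rewrite /= enum_rankK.
Qed.

Section GenericCount.
Variable K : closedFieldType.

Definition nonzero_poly (J : finType) (h : (J -> K) -> K) : Prop :=
  polyfun (X := aff K J) h /\ exists v, h v != 0.

Lemma nonzero_polyM (J : finType) (f g : (J -> K) -> K) :
  nonzero_poly f -> nonzero_poly g -> nonzero_poly (fun v => f v * g v).
Proof.
move=> [pf f0] [pg g0]; split; first exact: polyfunM.
have [v [fv gv]] := polyfun_neq0M pf pg f0 g0.
by exists v; rewrite mulf_neq0.
Qed.

Definition generic_card (J : finType) T (F : (J -> K) -> set T) n : Prop :=
  exists2 h, nonzero_poly h & forall u, h u != 0 -> has_card (F u) n.

Lemma generic_card_uniq (J : finType) T (F : (J -> K) -> set T) m n :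
  generic_card F m -> generic_card F n -> m = n.
Proof.
move=> [h h0 hF] [g g0 gF]; have [_ [u]] := nonzero_polyM h0 g0.
rewrite mulf_eq0 negb_or => /andP[hu gu].
exact: has_card_uniq (hF u hu) (gF u gu).
Qed.

(** Contrapositively, [phi] sends the proper closed set [f = 0] into a proper closed set [h = 0]. *)
Definition generic_fibre_avoids (J L : finType) (phi : (J -> K) -> L -> K) : Prop :=
  forall f, nonzero_poly f -> exists2 h, nonzero_poly h &
    forall v, h (phi v) != 0 -> f v != 0.

Definition is_fchart (X : funSpace K) (J : finType) (kappa : (J -> K) -> X) : Prop :=
  forall N (e : J -> 'I_N) e', cancel e e' -> cancel e' e ->
  is_chart (fun v => kappa (fun j => v (e j))).

(** Quantifying over all spaces with such charts makes the degree a property of [phi] alone, which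
    can be stated before the spaces are known. *)
Definition degree_on_charts (J L : finType) (phi : (J -> K) -> L -> K) n : Prop :=
  forall (X Y : funSpace K) (kappa : (J -> K) -> X) (kappa' : (L -> K) -> Y) (eta : X -> Y),
  is_fchart kappa -> is_fchart kappa' -> (forall v, eta (kappa v) = kappa' (phi v)) ->
  forall d, has_degree eta d <-> d = n.

Lemma fchart_vdim (X : funSpace K) (J : finType) (kappa : (J -> K) -> X) :
  is_fchart kappa -> vdim X = #|J|.
Proof. move=> k; exact: chart_vdim (k _ _ _ (@enum_rankK J) (@enum_valK J)). Qed.

Section Dichotomy.
Hypothesis char0 : [pchar K] =i pred0.
Variables (J L : finType) (phi : (J -> K) -> L -> K).
Hypothesis phi_poly : forall l, polyfun (X := aff K J) (fun v => phi v l).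
Hypothesis cardJL : #|J| = #|L|.

(** If the coordinates of [phi] are algebraically dependent, a non-zero [q] vanishes on the image
    and the fibres over [q != 0] are empty, so [n = 0] and avoidance is vacuous. Otherwise [n] is
    the degree of the function field extension. *)
Lemma fibre_dichotomy : exists n,
  [/\ generic_card (fun u => [set v | phi v = u]) n, generic_fibre_avoids phi &
      (0 < n)%N -> degree_on_charts phi n].
Proof.
pose N := #|L|; pose e j : 'I_N := cast_ord cardJL (enum_rank j).
pose e' (i : 'I_N) : J := enum_val (cast_ord (esym cardJL) i).
have eK : cancel e e' by move=> j; rewrite /e /e' cast_ordK enum_rankK.
have eK' : cancel e' e by move=> i; rewrite /e /e' enum_valK cast_ordKV.
have eKf (v : J -> K) : (fun j => (v \o e') (e j)) = v by apply/funext => j /=; rewrite eK.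
have eKf' (v : 'I_N -> K) : (fun i => v (e (e' i))) = v by apply/funext => j /=; rewrite eK'.
pose f (l : L) : 'I_N := enum_rank l.
have fKf (u : L -> K) : (fun l => (u \o enum_val) (f l)) = u.
  by apply/funext => l /=; rewrite enum_rankK.
have fKf' (u : 'I_N -> K) : (fun i => u (f (enum_val i))) = u.
  by apply/funext => l /=; rewrite /f enum_valK.
have /choice[p pE] : forall l, exists q : mpoly N K,
    forall v, phi (fun j => v (e j)) l = meval v q.
  by move=> l; exact: polyfun_mpoly (phi_poly l).
pose ph := [tuple p (enum_val i) | i < N].
have phE v i : meval v (tnth ph i) = phi (fun j => v (e j)) (enum_val i).
  by rewrite tnth_mktuple -pE.
have liftL (q : mpoly N K) : q != 0 -> nonzero_poly (fun u : L -> K => meval (u \o enum_val) q).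
  move=> /mpoly_eval_neq0[v qv]; split.
    by apply: (@polyfun_meval _ (aff K L)) => i; exact: polyfun_aff.
  by exists (fun l => v (f l)); rewrite (_ : _ \o _ = v) //; exact: fKf'.
have liftLphi (q : mpoly N K) v : meval (phi (fun j => v (e j)) \o enum_val) q = meval v (comp_mpoly ph q).
  by rewrite comp_mpoly_meval; apply: meval_eq => i; rewrite phE.
have [ind|] := pselect (forall q : mpoly N K, comp_mpoly ph q = 0 -> q = 0); last first.
  move=> /existsNP[q] /not_implyP[q_dep /eqP q0].
  have qphi v : meval (phi v \o enum_val) q = 0.
    by rewrite -(eKf v) liftLphi q_dep meval0.
  exists 0%N; split=> //.
    exists (fun u : L -> K => meval (u \o enum_val) q); first exact: liftL.
    move=> u qu; exists (fun i : 'I_0 => fun _ => 0); split; first by case.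
    move=> v; split=> [/= phv|[[]//]]; by move: qu; rewrite -phv qphi eqxx.
  move=> g _; exists (fun u : L -> K => meval (u \o enum_val) q); first exact: liftL.
  by move=> v; rewrite qphi eqxx.
have [d [b [b_span b_free [g g0 gfib] avoid]]] := function_field_degree char0 ind.
exists d; split.
- exists (fun u : L -> K => meval (u \o enum_val) g); first exact: liftL.
  move=> u /gfib[x [x_inj xE]].
  exists (fun i => fun j => x i (e j)); split.
    move=> i i' h; apply: x_inj; rewrite -(eKf' (x i)) -(eKf' (x i')).
    by apply/funext => k; rewrite (congr1 (fun w => w (e' k)) h).
  move=> v; split=> /= [phv|[i ->]].
    have [|i vi] := (xE (v \o e')).1; last by exists i; rewrite -vi eKf.
    by move=> j; rewrite phE eKf phv.
  have h := (xE (x i)).2 (ex_intro _ i erefl); rewrite -[RHS]fKf; apply/funext => l.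
  by have := h (f l); rewrite phE /= /f enum_rankK => ->.
- move=> w [pw [v wv]]; have [q qE] := polyfun_mpoly e pw.
  have q0 : q != 0 by apply: contraNneq wv => q0; rewrite -(eKf v) qE q0 meval0.
  have [g' g'0 g'E] := avoid q q0.
  exists (fun u : L -> K => meval (u \o enum_val) g'); first exact: liftL.
  move=> v' h; rewrite -(eKf v') qE; apply: (g'E _ _ h) => j.
  by rewrite phE eKf.
- move=> d0 X Y kappa kappa' eta kX kY eta_phi d'.
  have cX := kX N e e' eK eK'.
  have cY := kY N f enum_val (@enum_rankK L) (@enum_valK L).
  have h v : eta (kappa (fun j => v (e j))) =
      kappa' (fun l => (fun i => meval v (tnth ph i)) (f l)).
    by rewrite eta_phi; congr kappa'; apply/funext => l; rewrite phE enum_rankK.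
  split=> [|->]; first exact: (chart_has_degree_uniq cX cY h b_span b_free).
  exact: (chart_has_degree cX cY h b_span b_free).
Qed.

End Dichotomy.
End GenericCount.

(** * The big cell of the space of flagged representations *)

Local Notation "f ** g" := (fmul f g) (at level 40, left associativity).

Section PolynomialMatrices.
Variables (K : fieldType) (S : coordSpace K).

Lemma polyfun_fmul (A B C : finType) (f : S -> A -> B -> K) (g : S -> B -> C -> K) a c :
  (forall a b, polyfun (fun s => f s a b)) -> (forall b c, polyfun (fun s => g s b c)) ->
  polyfun (fun s => (f s ** g s) a c).
Proof. by move=> hf hg; apply: polyfun_sum => b; apply: polyfunM. Qed.

Lemma polyfun_fone (A : finType) (a b : A) : polyfun (fun _ : S => fone K a b).
Proof. exact: polyfun_cst. Qed.

Lemma polyfun_funi (A : finType) (m : S -> A -> A -> K) a b :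
  (forall a b, polyfun (fun s => m s a b)) -> polyfun (fun s => funi (m s) a b).
Proof. by move=> h; apply: polyfunD => //; exact: polyfun_cst. Qed.

Lemma polyfun_geo (A : finType) (m : S -> A -> A -> K) k a b :
  (forall a b, polyfun (fun s => m s a b)) -> polyfun (fun s => geo (m s) k a b).
Proof.
move=> h; elim: k a b => [|k IH] a b; first exact: polyfun_fone.
by apply: polyfunB; [exact: polyfun_fone|exact: polyfun_fmul].
Qed.

Lemma polyfun_linv (A : finType) l (m : S -> A -> A -> K) a b :
  (forall a b, polyfun (fun s => m s a b)) -> polyfun (fun s => linv l (m s) a b).
Proof. by move=> h; apply: polyfunB; [exact: polyfun_geo|exact: polyfun_fone]. Qed.

Lemma regular_fmul (U : set (zariski S)) (A B C : finType)
    (f : S -> A -> B -> K) (g : S -> B -> C -> K) a c :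
  (forall a b, affine_regular U (fun s => f s a b)) ->
  (forall b c, affine_regular U (fun s => g s b c)) ->
  affine_regular U (fun s => (f s ** g s) a c).
Proof. by move=> hf hg; apply: regular_sum => b; apply: regularM. Qed.

End PolynomialMatrices.

Section QuiverFibres.
Variables (K : closedFieldType) (Q : quiver).

Definition rep_index (X : vertex Q -> finType) : finType :=
  {e : arrow Q & (X (ta e) * X (ia e))%type}.

Definition endo_index (X : vertex Q -> finType) : finType :=
  {p : vertex Q & (X p * X p)%type}.

Definition rmat (X : vertex Q -> finType) := forall e : arrow Q, X (ta e) -> X (ia e) -> K.
Definition emat (X : vertex Q -> finType) := forall p : vertex Q, X p -> X p -> K.

Definition rep_at (X : vertex Q -> finType) (u : rep_index X -> K) : rmat X :=
  fun e x y => u (Tagged (fun e => (X (ta e) * X (ia e))%type) (x, y)).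

Arguments rep_at {X} u e x y.

Definition flat (X : vertex Q -> finType) (w : rmat X) : rep_index X -> K :=
  fun r => w (tag r) (tagged r).1 (tagged r).2.

Lemma flatK (X : vertex Q -> finType) (u : rep_index X -> K) : flat (rep_at u) = u.
Proof. by apply/funext => -[e [x y]]. Qed.

Lemma rmatP (X : vertex Q -> finType) (w w' : rmat X) : (forall e, w e = w' e) -> w = w'.
Proof. by move=> h; apply: functional_extensionality_dep. Qed.

Lemma ematP (X : vertex Q -> finType) (w w' : emat X) : (forall e, w e = w' e) -> w = w'.
Proof. by move=> h; apply: functional_extensionality_dep. Qed.

Section Levels.
Variables (X : vertex Q -> finType) (lv : forall p, X p -> nat).

Definition low_pred (i : endo_index X) : bool := (lv (tagged i).2 < lv (tagged i).1)%N.
Definition up_pred (r : rep_index X) : bool := (lv (tagged r).1 <= lv (tagged r).2)%N.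

(** Coordinates on the opposite unipotent group; [up_index] gives those on [Cplus], and
    [chart_index] those on the big cell of [GPC]. *)
Definition low_index : finType := {i : endo_index X | low_pred i}.
Definition up_index : finType := {r : rep_index X | up_pred r}.
Definition chart_index : finType := (low_index + up_index)%type.

Definition low_mat (v : low_index -> K) : emat X := fun p x y =>
  if insub (Tagged (fun p => (X p * X p)%type) (x, y)) is Some i then v i else 0.

Definition up_mat (v : up_index -> K) : rmat X := fun e x y =>
  if insub (Tagged (fun e => (X (ta e) * X (ia e))%type) (x, y)) is Some r then v r else 0.

Arguments low_mat v p x y : clear implicits.
Arguments up_mat v e x y : clear implicits.

Definition low_vec (m : emat X) : low_index -> K :=
  fun i => m (tag (val i)) (tagged (val i)).1 (tagged (val i)).2.

Definition up_vec (w : rmat X) : up_index -> K :=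
  fun r => w (tag (val r)) (tagged (val r)).1 (tagged (val r)).2.

Definition lowtri_mat (m : emat X) := forall p, lowtri (@lv p) (m p).
Definition upper_mat (w : rmat X) := forall e, upper (@lv (ta e)) (@lv (ia e)) (w e).

Lemma low_mat_lowtri v : lowtri_mat (low_mat v).
Proof.
move=> p x y xy; rewrite /low_mat insubF //; apply/negbTE.
by rewrite /low_pred /= -leqNgt.
Qed.

Lemma up_mat_upper v : upper_mat (up_mat v).
Proof.
move=> e x y xy; rewrite /up_mat insubF //; apply/negbTE.
by rewrite /up_pred /= -ltnNge.
Qed.

Lemma low_matK v : low_vec (low_mat v) = v.
Proof.
apply/funext => i; rewrite /low_vec /low_mat.
suff -> : Tagged (fun p => (X p * X p)%type) ((tagged (val i)).1, (tagged (val i)).2) = val i.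
  by rewrite valK.
by case: i => -[p [x y]].
Qed.

Lemma up_matK v : up_vec (up_mat v) = v.
Proof.
apply/funext => r; rewrite /up_vec /up_mat.
suff -> : Tagged (fun e => (X (ta e) * X (ia e))%type)
    ((tagged (val r)).1, (tagged (val r)).2) = val r by rewrite valK.
by case: r => -[e [x y]].
Qed.

Lemma low_vecK m : lowtri_mat m -> low_mat (low_vec m) = m.
Proof.
move=> ml; apply: ematP => p; apply: fmatP => x y; rewrite /low_mat.
case: insubP => [i _ iE|]; first by rewrite /low_vec iE.
by rewrite /low_pred -leqNgt => /= xy; rewrite ml.
Qed.

Lemma up_vecK w : upper_mat w -> up_mat (up_vec w) = w.
Proof.
move=> wu; apply: rmatP => p; apply: fmatP => x y; rewrite /up_mat.
case: insubP => [i _ iE|]; first by rewrite /up_vec iE.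
by rewrite /up_pred -ltnNge => /= xy; rewrite wu.
Qed.

Definition chart_low (v : chart_index -> K) : emat X := low_mat (v \o inl).
Definition chart_up (v : chart_index -> K) : rmat X := up_mat (v \o inr).

Arguments chart_low v p x y : clear implicits.
Arguments chart_up v e x y : clear implicits.

Definition chart_vec (m : emat X) (w : rmat X) : chart_index -> K := fun j =>
  match j with inl i => low_vec m i | inr r => up_vec w r end.

Lemma chart_vecE v : chart_vec (chart_low v) (chart_up v) = v.
Proof.
apply/funext => -[i|r] /=; first by rewrite /chart_low low_matK.
by rewrite /chart_up up_matK.
Qed.

Lemma chart_lowK m w : lowtri_mat m -> chart_low (chart_vec m w) = m.
Proof. exact: low_vecK. Qed.

Lemma chart_upK m w : upper_mat w -> chart_up (chart_vec m w) = w.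
Proof. exact: up_vecK. Qed.

(* The map [(m, w) |-> (1 + m) w (1 + m)^-1] from the big cell of [G x_P C^+]. *)
Definition chart_map (v : chart_index -> K) : rep_index X -> K := flat (fun e =>
  funi (chart_low v (ta e)) ** chart_up v e ** funi (linv (@lv (ia e)) (chart_low v (ia e)))).

Lemma polyfun_low_mat p x y : polyfun (X := aff K low_index) (fun v => low_mat v p x y).
Proof. by rewrite /low_mat; case: insub => [i|]; [exact: polyfun_aff|exact: polyfun_cst]. Qed.

Lemma polyfun_up_mat e x y : polyfun (X := aff K up_index) (fun v => up_mat v e x y).
Proof. by rewrite /up_mat; case: insub => [i|]; [exact: polyfun_aff|exact: polyfun_cst]. Qed.

Lemma polyfun_chart_low p x y : polyfun (X := aff K chart_index) (fun v => chart_low v p x y).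
Proof.
apply: (@polyfun_comp _ (aff K chart_index) (aff K low_index) (fun v => v \o inl)
  (fun v => low_mat v p x y)); last exact: polyfun_low_mat.
by move=> c [j ->]; exact: (@polyfun_aff _ chart_index (inl j)).
Qed.

Lemma polyfun_chart_up p x y : polyfun (X := aff K chart_index) (fun v => chart_up v p x y).
Proof.
apply: (@polyfun_comp _ (aff K chart_index) (aff K up_index) (fun v => v \o inr)
  (fun v => up_mat v p x y)); last exact: polyfun_up_mat.
by move=> c [j ->]; exact: (@polyfun_aff _ chart_index (inr j)).
Qed.

Lemma chart_map_poly r : polyfun (X := aff K chart_index) (fun v => chart_map v r).
Proof.
apply: polyfun_fmul => [a b|b c].
  apply: polyfun_fmul => b' c; last exact: polyfun_chart_up.
  by apply: polyfun_funi => x y; exact: polyfun_chart_low.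
by apply: polyfun_funi => x y; apply: polyfun_linv => x' y'; exact: polyfun_chart_low.
Qed.

(** Multiplying by [1 + m] on the right removes the inverse and leaves an intertwining relation,
    which is easily compared block by block. *)
Lemma chart_mapP v u : chart_map v = u <-> forall e,
  funi (chart_low v (ta e)) ** chart_up v e = rep_at u e ** funi (chart_low v (ia e)).
Proof.
split=> [<- e|h].
  have -> : rep_at (chart_map v) e = funi (chart_low v (ta e)) ** chart_up v e **
      funi (linv (@lv (ia e)) (chart_low v (ia e))) by apply: fmatP.
  by rewrite -fmulA funi_linvl ?fmulr1 //; exact: low_mat_lowtri.
rewrite -[u]flatK /chart_map; congr flat; apply: rmatP => e.
by rewrite h -fmulA funi_linvr ?fmulr1 //; exact: low_mat_lowtri.
Qed.

(* The flags of [u] in the big cell: [m] stands for the image of the standard flag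
   under [1 + m]. *)
Definition flag_fibre (u : rmat X) : set (emat X) := [set m | lowtri_mat m /\
  exists2 w, upper_mat w & forall e, funi (m (ta e)) ** w e = u e ** funi (m (ia e))].

(** In a fibre [m] determines the representation, as [w = (1 + m)^-1 u (1 + m)]. *)
Lemma chart_map_inj v v' :
  chart_map v = chart_map v' -> chart_low v = chart_low v' -> v = v'.
Proof.
move=> /chart_mapP hv e; have /chart_mapP hv' := erefl (chart_map v').
have E : chart_up v = chart_up v'.
  apply: rmatP => a; have vl := low_mat_lowtri (v \o inl) (p := ta a).
  rewrite -[chart_up v a]fmul1 -[chart_up v' a]fmul1 -(funi_linvl vl) -!fmulA.
  by rewrite -/(chart_low v) hv e hv'.
by rewrite -[v]chart_vecE -[v']chart_vecE e E.
Qed.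

Lemma flag_fibre_card u n :
  has_card [set v | chart_map v = u] n -> has_card (flag_fibre (rep_at u)) n.
Proof.
apply: (has_card_image (f := chart_low)) => [v v' /= vu v'u|m].
  by apply: chart_map_inj; rewrite vu v'u.
split=> [[ml [w wu mw]]|[v /chart_mapP vu <-]].
  exists (chart_vec m w); last exact: chart_lowK.
  by apply/chart_mapP => e; rewrite chart_lowK // chart_upK.
split; first exact: low_mat_lowtri.
by exists (chart_up v) => //; exact: up_mat_upper.
Qed.

Definition flag_count n := generic_card (fun u => flag_fibre (rep_at u)) n.

Lemma flag_count_chart n :
  generic_card (fun u => [set v | chart_map v = u]) n -> flag_count n.
Proof. by move=> [h h0 hn]; exists h => // u /hn; exact: flag_fibre_card. Qed.

End Levels.
End QuiverFibres.

Arguments rep_at {K Q X} u e x y.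
Arguments low_mat {K Q X} lv v p x y.
Arguments up_mat {K Q X} lv v e x y.
Arguments chart_low {K Q X} lv v p x y.
Arguments chart_up {K Q X} lv v e x y.

(** * Multiplicativity *)

Section Blocks.
Variable K : fieldType.

Definition fadd (A B : Type) (f g : A -> B -> K) : A -> B -> K := fun a b => f a b + g a b.
Local Notation "f ++' g" := (fadd f g) (at level 50, left associativity).

Lemma fmulDl (A B C : finType) (f g : A -> B -> K) (h : B -> C -> K) :
  (f ++' g) ** h = f ** h ++' g ** h.
Proof.
by apply: fmatP => a c; rewrite /fadd /fmul -big_split; apply: eq_bigr => b _; exact: mulrDl.
Qed.

Lemma fadd0 (A B : Type) (f : A -> B -> K) : f ++' (fun _ _ => 0) = f.
Proof. by apply: fmatP => a b; rewrite /fadd addr0. Qed.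

Lemma fadd0l (A B : Type) (f : A -> B -> K) : (fun _ _ => 0) ++' f = f.
Proof. by apply: fmatP => a b; rewrite /fadd add0r. Qed.

Lemma faddI (A B : Type) (f g h : A -> B -> K) : f ++' g = f ++' h -> g = h.
Proof.
move=> e; apply: fmatP => a b; have := congr1 (fun w => w a b) e; exact: addrI.
Qed.

Lemma fmul0l (A B C : finType) (f : B -> C -> K) :
  (fun (_ : A) (_ : B) => 0) ** f = fun _ _ => 0.
Proof. by apply: fmatP => a c; apply: big1 => b _; rewrite mul0r. Qed.

Lemma fmul0r (A B C : finType) (f : A -> B -> K) :
  f ** (fun (_ : B) (_ : C) => 0) = fun _ _ => 0.
Proof. by apply: fmatP => a c; apply: big1 => b _; rewrite mulr0. Qed.

Definition blk (A B C D : Type) (f11 : A -> C -> K) (f12 : A -> D -> K)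
    (f21 : B -> C -> K) (f22 : B -> D -> K) : A + B -> C + D -> K := fun x y =>
  match x, y with
  | inl a, inl c => f11 a c | inl a, inr d => f12 a d
  | inr b, inl c => f21 b c | inr b, inr d => f22 b d end.

Definition b11 (A B C D : Type) (f : A + B -> C + D -> K) a c := f (inl a) (inl c).
Definition b12 (A B C D : Type) (f : A + B -> C + D -> K) a d := f (inl a) (inr d).
Definition b21 (A B C D : Type) (f : A + B -> C + D -> K) b c := f (inr b) (inl c).
Definition b22 (A B C D : Type) (f : A + B -> C + D -> K) b d := f (inr b) (inr d).

Lemma blkE (A B C D : Type) (f : A + B -> C + D -> K) :
  f = blk (b11 f) (b12 f) (b21 f) (b22 f).
Proof. by apply: fmatP => -[a|b] [c|d]. Qed.

Lemma blk_mul (A B C D E F : finType) (f11 : A -> C -> K) (f12 : A -> D -> K)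
    (f21 : B -> C -> K) (f22 : B -> D -> K) (g11 : C -> E -> K) (g12 : C -> F -> K)
    (g21 : D -> E -> K) (g22 : D -> F -> K) :
  blk f11 f12 f21 f22 ** blk g11 g12 g21 g22 =
  blk (f11 ** g11 ++' f12 ** g21) (f11 ** g12 ++' f12 ** g22)
      (f21 ** g11 ++' f22 ** g21) (f21 ** g12 ++' f22 ** g22).
Proof. by apply: fmatP => -[a|b] [c|d]; rewrite /fmul big_sumType. Qed.

Lemma blk_inj (A B C D : Type) (f11 g11 : A -> C -> K) (f12 g12 : A -> D -> K)
    (f21 g21 : B -> C -> K) (f22 g22 : B -> D -> K) :
  blk f11 f12 f21 f22 = blk g11 g12 g21 g22 ->
  [/\ f11 = g11, f12 = g12, f21 = g21 & f22 = g22].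
Proof.
move=> e; split; apply: fmatP => a c.
- exact: (congr1 (fun w => w (inl a) (inl c)) e).
- exact: (congr1 (fun w => w (inl a) (inr c)) e).
- exact: (congr1 (fun w => w (inr a) (inl c)) e).
- exact: (congr1 (fun w => w (inr a) (inr c)) e).
Qed.

Lemma funi_blk (A B : finType) (m11 : A -> A -> K) m21 (m22 : B -> B -> K) :
  funi (blk m11 (fun _ _ => 0) m21 m22) = blk (funi m11) (fun _ _ => 0) m21 (funi m22).
Proof. by apply: fmatP => -[a|b] [c|d] //; rewrite /funi /= add0r. Qed.

End Blocks.

Local Notation "f ++' g" := (fadd f g) (at level 50, left associativity).

Definition coarse_level (A B : Type) (x : A + B) : nat := if x is inl _ then 0%N else 1%N.

Section Multiplicativity.
Variables (K : closedFieldType) (Q : quiver) (A B : vertex Q -> finType).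
Let X p : finType := (A p + B p)%type.
Variables (lA : forall p, A p -> nat) (lB : forall p, B p -> nat) (lv : forall p, X p -> nat).

Arguments lA : clear implicits.
Arguments lB : clear implicits.
Arguments lv : clear implicits.

Definition coarse (p : vertex Q) : A p + B p -> nat := @coarse_level (A p) (B p).
Arguments coarse : clear implicits.

Hypothesis lvA : forall p q a a', (lv p (inl a) < lv q (inl a'))%N = (lA p a < lA q a')%N.
Hypothesis lvB : forall p q b b', (lv p (inr b) < lv q (inr b'))%N = (lB p b < lB q b')%N.
Hypothesis lvAB : forall p q a b, (lv p (inl a) < lv q (inr b))%N.

(** Conjugating [u] by [1 + c] yields the diagonal blocks [u11 + u12 c] and [u22 - c u12]. When the
    graph of [c] is a subrepresentation, these are the subrepresentation and the quotient by it. *)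
Definition sub_block (u : rmat K X) (c : forall p, B p -> A p -> K) : rmat K A :=
  fun e => b11 (u e) ++' b12 (u e) ** c (ia e).

Definition quot_block (u : rmat K X) (c : forall p, B p -> A p -> K) : rmat K B :=
  fun e b d => b22 (u e) b d - (c (ta e) ** b12 (u e)) b d.

(* [1 + glue c m n = [1 0; c 1] [1 + m 0; 0 1 + n]]. *)
Definition glue (c : forall p, B p -> A p -> K) (m : emat K A) (n : emat K B) : emat K X :=
  fun p => blk (m p) (fun _ _ => 0) (c p ** funi (m p)) (n p).

Definition low_block (m : emat K X) p : B p -> A p -> K := b21 (m p).

Arguments sub_block : clear implicits.
Arguments quot_block : clear implicits.
Arguments glue : clear implicits.
Arguments low_block : clear implicits.

Lemma glue_lowtri c m n : lowtri_mat lA m -> lowtri_mat lB n -> lowtri_mat lv (glue c m n).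
Proof.
move=> mA nB p [a|b] [a'|b'] //=; rewrite leqNgt ?lvA ?lvB -?leqNgt.
- exact: mA.
- by rewrite leqNgt lvAB.
- exact: nB.
Qed.

(** Solving the lower left block of [glue] for [c] gives [c = m21 (1 + m11)^-1]. *)
Lemma lowtri_glue m : lowtri_mat lv m -> exists c,
  m = glue c (fun p => b11 (m p)) (fun p => b22 (m p)) /\
  lowtri_mat lA (fun p => b11 (m p)) /\ lowtri_mat lB (fun p => b22 (m p)).
Proof.
move=> ml; have mA : lowtri_mat lA (fun p => b11 (m p)).
  by move=> p a a' h; apply: ml; rewrite leqNgt lvA -leqNgt.
exists (fun p => b21 (m p) ** funi (linv (lA p) (b11 (m p)))); split; last first.
  by split=> // p b b' h; apply: ml; rewrite leqNgt lvB -leqNgt.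
apply: ematP => p; rewrite [LHS]blkE /glue -fmulA funi_linvl // fmulr1; congr blk.
by apply: fmatP => a b; apply: ml; exact: ltnW.
Qed.

Lemma chart_low_coarse (v : chart_index coarse -> K) p : chart_low coarse v p =
  blk (fun _ _ => 0) (fun _ _ => 0) (low_block (chart_low coarse v) p) (fun _ _ => 0).
Proof.
rewrite [LHS]blkE; have ml := low_mat_lowtri (v \o inl) (p := p).
by congr blk; apply: fmatP => x y; apply: ml.
Qed.

Lemma coarse_chart (v : chart_index coarse -> K) u : chart_map v = u ->
  let c := low_block (chart_low coarse v) in let w := chart_up coarse v in
  [/\ forall e, b11 (w e) = sub_block (rep_at u) c e,
      forall e, b12 (w e) = b12 (rep_at u e),
      forall e, c (ta e) ** b11 (w e) = b21 (rep_at u e) ++' b22 (rep_at u e) ** c (ia e) &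
      forall e, b22 (w e) = quot_block (rep_at u) c e].
Proof.
move=> /chart_mapP vu c w.
have w21 e : b21 (w e) = fun _ _ => 0.
  by apply: fmatP => x y; apply: (up_mat_upper (v \o inr)).
have E e : [/\ b11 (w e) = sub_block (rep_at u) c e, b12 (w e) = b12 (rep_at u e),
    c (ta e) ** b11 (w e) = b21 (rep_at u e) ++' b22 (rep_at u e) ** c (ia e) &
    c (ta e) ** b12 (w e) ++' b22 (w e) = b22 (rep_at u e)].
  have := vu e; rewrite !chart_low_coarse !funi_blk !funi0 [chart_up _ _ _]blkE [rep_at u e]blkE !blk_mul.
  rewrite !fmul1 !fmulr1 !fmul0l !fmul0r !fadd0 !fadd0l w21 fadd0.
  by move=> /blk_inj.
split=> e; have [h1 h2 h3 h4] := E e => //.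
apply: fmatP => b d; rewrite /quot_block -h4 -h2 /fadd.
by rewrite addrAC subrr add0r.
Qed.

(** A flag of [u] passing through the graph of [c] amounts to a flag of this subrepresentation and a
    flag of the quotient. The first condition says that the graph of [c] is stable; it is the lower
    left block of the intertwining relation, once the upper left block is known and the invertible
    [1 + m] is cancelled. *)
Lemma glue_fibre (u : rmat K X) c m n :
  lowtri_mat lA m -> lowtri_mat lB n ->
  flag_fibre lv u (glue c m n) <->
  [/\ forall e, c (ta e) ** sub_block u c e = b21 (u e) ++' b22 (u e) ** c (ia e),
      flag_fibre lA (sub_block u c) m & flag_fibre lB (quot_block u c) n].
Proof.
move=> mA nB.
have subE e : sub_block u c e ** funi (m (ia e)) =
    b11 (u e) ** funi (m (ia e)) ++' b12 (u e) ** (c (ia e) ** funi (m (ia e))).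
  by rewrite fmulDl fmulA.
have quotE e y : quot_block u c e ** funi (n (ia e)) = y <->
    b22 (u e) ** funi (n (ia e)) = c (ta e) ** (b12 (u e) ** funi (n (ia e))) ++' y.
  have h : b22 (u e) = c (ta e) ** b12 (u e) ++' quot_block u c e.
    by apply: fmatP => b d; rewrite /fadd /quot_block addrC subrK.
  by rewrite h fmulDl -!fmulA; split=> [->//|]; exact: faddI.
have eqE (w : rmat K X) e : b21 (w e) = (fun _ _ => 0) ->
  funi (glue c m n (ta e)) ** w e = u e ** funi (glue c m n (ia e)) <->
  [/\ funi (m (ta e)) ** b11 (w e) = sub_block u c e ** funi (m (ia e)),
      funi (m (ta e)) ** b12 (w e) = b12 (u e) ** funi (n (ia e)),
      c (ta e) ** (funi (m (ta e)) ** b11 (w e)) =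
        (b21 (u e) ++' b22 (u e) ** c (ia e)) ** funi (m (ia e)) &
      c (ta e) ** (funi (m (ta e)) ** b12 (w e)) ++' funi (n (ta e)) ** b22 (w e) =
        b22 (u e) ** funi (n (ia e))].
  move=> w21; rewrite subE fmulDl -!fmulA /glue !funi_blk {1}[w e]blkE {1}[u e]blkE !blk_mul.
  rewrite w21 !fmul0r !fmul0l !fadd0 !fadd0l -!fmulA.
  by split=> [/blk_inj[-> -> -> ->]|[-> -> -> ->]].
split=> [[ml [w wu we]]|[ce [_ [x xu xe]] [_ [y yu ye]]]].
  have w21 e : b21 (w e) = fun _ _ => 0 by apply: fmatP => b a; apply: wu.
  have E e := (eqE w e (w21 e)).1 (we e).
  split.
  - move=> e; have [h1 _ h3 _] := E e; rewrite h1 in h3.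
    have mi := mA (ia e).
    rewrite -[LHS]fmulr1 -[RHS]fmulr1 -(funi_linvr mi) !fmulA; congr (_ ** _).
    by rewrite -h3 fmulA.
  - split=> //; exists (fun e => b11 (w e)) => [e a a' h|e]; last by have [] := E e.
    by apply: wu; rewrite lvA.
  - split=> //; exists (fun e => b22 (w e)) => [e b b' h|e].
      by apply: wu; rewrite lvB.
    by have [_ h2 _ h4] := E e; apply/esym/quotE; rewrite -h2 h4.
split; first exact: glue_lowtri.
(* The solution of the upper right block of the intertwining relation: this block can always be
   solved, so it imposes no condition on [u]. *)
pose z e := funi (linv (lA (ta e)) (m (ta e))) ** (b12 (u e) ** funi (n (ia e))).
exists (fun e => blk (x e) (z e) (fun _ _ => 0) (y e)).
  move=> e [a|b] [a'|b'] //=; rewrite ?lvA ?lvB; [exact: xu| |exact: yu].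
  by rewrite ltnNge ltnW.
move=> e; apply: (eqE (fun e => blk (x e) (z e) (fun _ _ => 0) (y e)) e _).2 => //.
have mt := mA (ta e).
have zE : funi (m (ta e)) ** z e = b12 (u e) ** funi (n (ia e)).
  by rewrite fmulA funi_linvr ?fmul1.
split; [exact: (xe e)|exact: zE| |].
  by rewrite -ce -fmulA; congr (_ ** _); exact: (xe e).
have E : b22 (u e) ** funi (n (ia e)) =
    c (ta e) ** (b12 (u e) ** funi (n (ia e))) ++' funi (n (ta e)) ** y e.
  by apply: (quotE e _).1; rewrite ye.
rewrite E; congr (_ ++' _); congr (_ ** _); exact: zE.
Qed.

Lemma coarse_chart_exists u (c : forall p, B p -> A p -> K) :
  (forall e, c (ta e) ** sub_block (rep_at u) c e =
     b21 (rep_at u e) ++' b22 (rep_at u e) ** c (ia e)) ->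
  exists2 v : chart_index coarse -> K, chart_map v = u & low_block (chart_low coarse v) = c.
Proof.
move=> ce; pose m : emat K X := fun p => blk (fun _ _ => 0) (fun _ _ => 0) (c p) (fun _ _ => 0).
have ml : lowtri_mat coarse m by move=> p [a|b] [a'|b'].
pose w : rmat K X := fun e => blk (sub_block (rep_at u) c e) (b12 (rep_at u e))
  (fun _ _ => 0) (quot_block (rep_at u) c e).
have wu : upper_mat coarse w by move=> e [a|b] [a'|b'].
exists (chart_vec (lv := coarse) m w); last by rewrite chart_lowK.
apply/chart_mapP => e; rewrite chart_lowK // chart_upK // /m /w !funi_blk !funi0.
rewrite [in RHS](blkE (rep_at u e)) !blk_mul !fmul1 !fmulr1 !fmul0l !fmul0r !fadd0 !fadd0l ce.
congr blk; apply: fmatP => b d; rewrite /fadd /quot_block.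
by rewrite addrC subrK.
Qed.

Lemma flag_count_mul n nA nB :
  generic_card (fun u => [set v : chart_index coarse -> K | chart_map v = u]) n ->
  generic_fibre_avoids (@chart_map K Q X coarse) ->
  flag_count K lA nA -> flag_count K lB nB -> flag_count K lv (n * (nA * nB)).
Proof.
move=> [h h0 hn] avoid [hA [pA [uA uA0]] hAn] [hB [pB [uB uB0]] hBn].
pose wA (v : chart_index coarse -> K) := flat (fun e => b11 (chart_up coarse v e)).
pose wB (v : chart_index coarse -> K) := flat (fun e => b22 (chart_up coarse v e)).
(* The product of [hA] and [hB] at the diagonal blocks is a polynomial function on the two-step
   chart, so [avoid] keeps it non-zero at every point over a general [u]. *)
have [h' h'0 h'n] : exists2 h', nonzero_poly h' & forall v : chart_index coarse -> K,
    h' (chart_map v) != 0 -> hA (wA v) * hB (wB v) != 0.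
  apply: avoid; split.
    apply: polyfunM.
      apply: (@polyfun_comp _ (aff K (chart_index coarse)) (aff K (rep_index A)) wA hA) => // _ [r ->].
      exact: polyfun_chart_up.
    apply: (@polyfun_comp _ (aff K (chart_index coarse)) (aff K (rep_index B)) wB hB) => // _ [r ->].
    exact: polyfun_chart_up.
  (* This function is non-zero at the block diagonal representation with blocks [uA] and [uB]. *)
  pose w : rmat K X := fun e => blk (rep_at uA e) (fun _ _ => 0) (fun _ _ => 0) (rep_at uB e).
  have wu : upper_mat coarse w by move=> e [a|b] [a'|b'].
  exists (chart_vec (lv := coarse) (fun p _ _ => 0) w).
  rewrite /wA /wB chart_upK // mulf_neq0 //.
    by rewrite (_ : flat _ = uA) // -[RHS]flatK.
  by rewrite (_ : flat _ = uB) // -[RHS]flatK.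
exists (fun u => h u * h' u); first exact: nonzero_polyM.
move=> u; rewrite mulf_eq0 negb_or => /andP[/hn [x [x_inj xE]] h'u].
pose c i := low_block (chart_low coarse (x i)).
have xu i : chart_map (x i) = u by apply/xE; exists i.
have cE i := coarse_chart (xu i).
have nz i : hA (wA (x i)) * hB (wB (x i)) != 0 by apply: h'n; rewrite xu.
have cardA i : has_card (flag_fibre lA (sub_block (rep_at u) (c i))) nA.
  have [/rmatP <- _ _ _] := cE i; apply: (hAn (wA (x i))).
  by apply: contraNneq (nz i) => ->; rewrite mul0r.
have cardB i : has_card (flag_fibre lB (quot_block (rep_at u) (c i))) nB.
  have [_ _ _ /rmatP <-] := cE i; apply: (hBn (wB (x i))).
  by apply: contraNneq (nz i) => ->; rewrite mulr0.
have /choice[f fE] := cardA; have /choice[g gE] := cardB.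
(* A flag is enumerated by its two-step flag, then by a flag of the subrepresentation and one of the
   quotient that this two-step flag defines. *)
pose G (t : 'I_n * ('I_nA * 'I_nB)) := glue (c t.1) (f t.1 t.2.1) (g t.1 t.2.2).
have fl i j : flag_fibre lA (sub_block (rep_at u) (c i)) (f i j).
  by apply/(fE i).2; exists j.
have gl i j : flag_fibre lB (quot_block (rep_at u) (c i)) (g i j).
  by apply/(gE i).2; exists j.
have -> : (n * (nA * nB))%N = #|{: 'I_n * ('I_nA * 'I_nB)}| by rewrite !card_prod !card_ord.
apply: (has_card_fin (f := G)).
  move=> [i [j k]] [i' [j' k']] /= e.
  have E p := blk_inj (congr1 (fun m : emat K X => m p) e).
  have ff : f i j = f i' j' by apply: ematP => p; have [] := E p.
  have gg : g i k = g i' k' by apply: ematP => p; have [] := E p.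
  have cc : c i = c i'.
    apply: functional_extensionality_dep => p; have [_ _ + _] := E p; rewrite /= -ff => ee.
    rewrite -[LHS]fmulr1 -[RHS]fmulr1 -(funi_linvr ((fl i j).1 p)) !fmulA.
    by congr (_ ** _); exact: ee.
  (* By the formulas of [coarse_chart], [u] and [c] determine the whole point of the two-step
     chart. *)
  have ii : i = i'.
    apply: x_inj; rewrite -[x i]chart_vecE -[x i']chart_vecE; congr chart_vec.
      by apply: ematP => p; rewrite !chart_low_coarse -/(c i) cc.
    have [/rmatP a1 a2 _ a4] := cE i; have [/rmatP b1 b2 _ b4] := cE i'.
    apply: rmatP => e'; have w21 (v : chart_index coarse -> K) : b21 (chart_up coarse v e') = fun _ _ => 0.
      by apply: fmatP => ? ?; apply: (up_mat_upper (v \o inr)).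
    rewrite [LHS]blkE [RHS]blkE; congr blk.
    - by rewrite (congr1 (fun w : rmat K A => w e') a1) (congr1 (fun w : rmat K A => w e') b1) -/(c i) cc.
    - by rewrite a2 b2.
    - by rewrite !w21.
    - by rewrite a4 b4 -/(c i) cc.
  move: ff gg; rewrite -ii => /(fE i).1 -> /(gE i).1 ->; by [].
move=> m; split=> [mF|[[i [j k]] ->]]; last first.
  by apply/glue_fibre; [exact: (fl i j).1|exact: (gl i k).1|split=> //; have [s1 _ s3 _] := cE i; move=> e; rewrite -s3 s1].
have [c0 [mE [mA mB]]] := lowtri_glue mF.1; rewrite mE in mF *.
have [cc FA FB] := (glue_fibre (rep_at u) c0 mA mB).1 mF.
have [v vu vc] := coarse_chart_exists cc.
have [i vi] := (xE v).1 vu.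
have ci : c i = c0 by rewrite /c -vi.
rewrite -ci in FA FB *; have [j ->] := ((fE i).2 _).1 FA; have [k ->] := ((gE i).2 _).1 FB.
by exists (i, (j, k)).
Qed.

End Multiplicativity.

(** * The big cell of the group *)

Section MaskedSystem.
Variables (K : fieldType) (A : finType) (L : A -> A -> bool) (q : A -> A -> K).

Definition masked (n : A -> A -> K) : Prop := forall x y, ~~ L x y -> n x y = 0.

(* The equations [(n ** q) x z = b x z], for [L x z], in the unknowns [n x y],
   for [L x y], padded to a square system over all pairs. *)
Definition mask_sys (t s : A * A) : K :=
  if L s.1 s.2 then (if L t.1 t.2 && (t.1 == s.1) then q t.2 s.2 else 0) else (t == s)%:R.

Lemma mask_sysE (n : A -> A -> K) s : masked n ->
  \sum_t n t.1 t.2 * mask_sys t s = if L s.1 s.2 then (n ** q) s.1 s.2 else 0.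
Proof.
case: s => x z nm; rewrite /mask_sys /=; case: ifP => Ls; last first.
  rewrite (bigD1 (x, z)) //= eqxx mulr1 big1 ?addr0 => [|t /negPf ->]; last by rewrite mulr0.
  by rewrite nm ?Ls.
rewrite -(pair_bigA _ (fun i j => n i j * (if L i j && (i == x) then q j z else 0))) /=.
rewrite (bigD1 x) //= [X in _ + X]big1 ?addr0 => [|i /negPf ix]; last first.
  by apply: big1 => j _; rewrite ix andbF mulr0.
apply: eq_bigr => j _; rewrite eqxx andbT; case: ifP => // Lxj.
by rewrite nm ?Lxj ?mul0r.
Qed.

Lemma mask_sdet_neq0 :
  (forall n, masked n -> (forall x z, L x z -> (n ** q) x z = 0) -> forall x y, n x y = 0) ->
  sdet mask_sys != 0.
Proof.
move=> inj; apply: sdet_neq0 => v vM.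
have vm : masked (fun x y => v (x, y)).
  move=> x y Lxy; have := vM (x, y); rewrite /mask_sys /= (negPf Lxy).
  rewrite (bigD1 (x, y)) //= eqxx mulr1 big1 ?addr0 => [//|t /negPf ->].
  by rewrite mulr0.
case=> x y; apply: (inj _ vm) => {x y} x z Lxz.
have := mask_sysE (x, z) vm; rewrite /= Lxz => <-; rewrite -[RHS](vM (x, z)).
by apply: eq_bigr => -[].
Qed.

Definition mask_sol (b : A -> A -> K) x y : K :=
  if L x y then
    \sum_r (if L r.1 r.2 then b r.1 r.2 else 0) * sadj mask_sys r (x, y) / sdet mask_sys
  else 0.

Lemma mask_sol_masked b : masked (mask_sol b).
Proof. by move=> x y /negPf Lxy; rewrite /mask_sol Lxy. Qed.

Lemma mask_solE b : sdet mask_sys != 0 -> forall x z, L x z -> (mask_sol b ** q) x z = b x z.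
Proof.
move=> d0 x z Lxz.
pose b' (r : A * A) := if L r.1 r.2 then b r.1 r.2 else 0.
pose v (t : A * A) := \sum_r b' r * sadj mask_sys r t / sdet mask_sys.
have vE s : \sum_t v t * mask_sys t s = b' s by exact: sdet_solve.
have vm s : ~~ L s.1 s.2 -> v s = 0.
  move=> Ls; have := vE s; rewrite /mask_sys (negPf Ls) /b' (negPf Ls).
  by rewrite (bigD1 s) //= eqxx mulr1 big1 ?addr0 => [//|t /negPf ->]; rewrite mulr0.
have := mask_sysE (x, z) (mask_sol_masked b); rewrite /= Lxz => <-.
transitivity (b' (x, z)); last by rewrite /b' /= Lxz.
rewrite -vE; apply: eq_bigr => -[x' y] _ /=; congr (_ * _).
by rewrite /mask_sol; case: ifPn => // h; rewrite vm.
Qed.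

Lemma mask_sol_uniq n n' : sdet mask_sys != 0 -> masked n -> masked n' ->
  (forall x z, L x z -> (n ** q) x z = (n' ** q) x z) -> n = n'.
Proof.
move=> d0 nm n'm e; apply: fmatP => x y; apply/eqP; rewrite -subr_eq0; apply/eqP.
pose d x y := n x y - n' x y.
have dm : masked d by move=> ? ? h; rewrite /d nm // n'm // subrr.
apply: (@sdet_inj _ _ mask_sys (fun t => d t.1 t.2) d0 _ (x, y)) => s.
rewrite mask_sysE //; case: ifP => // /e h.
have -> : (d ** q) s.1 s.2 = (n ** q) s.1 s.2 - (n' ** q) s.1 s.2.
  by rewrite /fmul -sumrB; apply: eq_bigr => j _; rewrite mulrBl.
by rewrite h subrr.
Qed.

End MaskedSystem.

Section BigCell.
Variables (K : fieldType) (A : finType) (l : A -> nat).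

Lemma upper_inv (q r : A -> A -> K) : upper l l q -> q ** r = @fone K A -> upper l l r.
Proof.
(* Right multiplication by [q] is injective, hence bijective, on upper matrices. *)
move=> qu qr; pose L x y := (l x <= l y)%N.
have Lu n : masked L n <-> upper l l n.
  by split=> h x y xy; apply: h; move: xy; rewrite /L -ltnNge.
have d0 : sdet (mask_sys L q) != 0.
  apply: mask_sdet_neq0 => n /Lu nu nq x y.
  have nq0 : n ** q = fun _ _ => 0.
    apply: fmatP => a b; case: (leqP (l a) (l b)) => ab; first exact: nq.
    exact: (upperM nu qu).
  by rewrite -[n]fmulr1 -qr fmulA nq0 fmul0l.
pose f := mask_sol L q (@fone K A).
have fu : upper l l f by apply/Lu; exact: mask_sol_masked.
suff -> : r = f by [].
have fq : f ** q = @fone K A.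
  apply: fmatP => a b; case: (leqP (l a) (l b)) => ab; first exact: mask_solE.
  by rewrite (upperM fu qu) // (@upper1 K A l).
by rewrite -[f]fmulr1 -qr fmulA fq fmul1.
Qed.

Definition low x y := (l y < l x)%N.

Lemma lowtri_masked (m : A -> A -> K) : lowtri l m <-> masked low m.
Proof. by split=> h x y xy; apply: h; move: xy; rewrite /low -leqNgt. Qed.

(* [g] is in the big cell [U^- P] when [bigdet g != 0], and [1 + bigsol g] is then
   the inverse of the factor of [g] in [U^-]. *)
Definition bigdet (g : A -> A -> K) : K := sdet (mask_sys low g).
Definition bigsol (g : A -> A -> K) : A -> A -> K := mask_sol low g (fun x z => - g x z).

Lemma bigsol_lowtri g : lowtri l (bigsol g).
Proof. exact/lowtri_masked/mask_sol_masked. Qed.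

Lemma bigsol_upper g : bigdet g != 0 -> upper l l (funi (bigsol g) ** g).
Proof. by move=> d0 x z xz; rewrite fmul_unil (mask_solE _ d0 xz) subrr. Qed.

Lemma bigsol_uniq g n : bigdet g != 0 -> lowtri l n -> upper l l (funi n ** g) -> n = bigsol g.
Proof.
move=> d0 /lowtri_masked nm ng; apply: (mask_sol_uniq d0 nm).
  exact: mask_sol_masked.
move=> x z xz; rewrite (mask_solE _ d0 xz); have := ng x z xz; rewrite fmul_unil.
by move/eqP; rewrite addrC addr_eq0 => /eqP.
Qed.

(** If [n] is strictly lower and [n (1 + m) q] is upper, then [n (1 + m)] is both upper and strictly
    lower, hence zero, and so is [n]: the linear system is regular. With its converse [bigcellP]
    this describes the big cell by one determinant. *)
Lemma bigdet_factor m q r : lowtri l m -> upper l l q -> q ** r = @fone K A ->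
  bigdet (funi m ** q) != 0.
Proof.
move=> ml qu qr; apply: mask_sdet_neq0 => n /lowtri_masked nl nmq.
have ru := upper_inv qu qr.
have nm : upper l l (n ** funi m).
  rewrite -[n ** _]fmulr1 -qr fmulA -[n ** funi m ** q]fmulA.
  by apply: upperM ru => x z xz; exact: nmq.
have nms : lowtri l (n ** funi m).
  move=> x y xy; rewrite fmul_unir nl // add0r.
  apply: (raisesM (lowtri_raises nl) (lowtri_raises ml)).
  by apply: leq_ltn_trans xy _; rewrite -{1}[l y]addn0 ltn_add2l.
have nm0 : n ** funi m = fun _ _ => 0.
  by apply: fmatP => x y; case: (leqP (l x) (l y)) => xy; [exact: nms|exact: nm].
by move=> x y; rewrite -[n]fmulr1 -(funi_linvr ml) fmulA nm0 fmul0l.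
Qed.

Lemma bigcellP g r : g ** r = @fone K A -> bigdet g != 0 ->
  let m := linv l (bigsol g) in let q := funi (bigsol g) ** g in
  [/\ lowtri l m, upper l l q, g = funi m ** q & exists r', q ** r' = @fone K A].
Proof.
move=> gr d0 m q; have nl := bigsol_lowtri g; split.
- exact: linv_lowtri.
- exact: bigsol_upper.
- by rewrite /q fmulA funi_linvl // fmul1.
exists (r ** funi m); rewrite /q -!fmulA [g ** _]fmulA gr fmul1.
exact: funi_linvr.
Qed.

(** Multiplication by the parabolic group on the right preserves the big cell and the unipotent
    factor; this makes the charts of the quotients well defined. *)
Lemma bigdet_upperM g r q r' : g ** r = @fone K A -> upper l l q -> q ** r' = @fone K A ->
  bigdet g != 0 -> bigdet (g ** q) != 0 /\ bigsol (g ** q) = bigsol g.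
Proof.
move=> gr qu qr d0; have [ml q0u gE [r0 qr0]] := bigcellP gr d0.
have d1 : bigdet (g ** q) != 0.
  move: ml q0u gE qr0; move: (linv _ _) (funi _ ** g) => m q0 ml q0u gE qr0.
  have -> : g ** q = funi m ** (q0 ** q) by rewrite fmulA -gE.
  apply: (bigdet_factor ml (upperM q0u qu) (r := r' ** r0)).
  by rewrite fmulA -[q0 ** q ** r']fmulA qr fmulr1.
split=> //; apply/esym; apply: bigsol_uniq => //; first exact: bigsol_lowtri.
by rewrite fmulA; apply: upperM qu; exact: bigsol_upper.
Qed.

Lemma bigsol_funi m : lowtri l m -> bigdet (funi m) != 0 /\ bigsol (funi m) = linv l m.
Proof.
move=> ml; have d0 : bigdet (funi m) != 0.
  by rewrite -[funi m]fmulr1; apply: (bigdet_factor (r := @fone K A)); rewrite ?fmul1 //; exact: upper1.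
split=> //; apply/esym; apply: bigsol_uniq => //; first exact: linv_lowtri.
by rewrite funi_linvl //; exact: upper1.
Qed.

End BigCell.

Lemma linvK (K : fieldType) (A : finType) (l : A -> nat) (m : A -> A -> K) :
  lowtri l m -> linv l (linv l m) = m.
Proof.
move=> ml; apply: funi_inj; have h := funi_linvl (linv_lowtri ml).
by rewrite -[LHS]fmulr1 -(funi_linvl ml) fmulA h fmul1.
Qed.

Section PolynomialBigCell.
Variables (K : fieldType) (S : coordSpace K) (A : finType) (l : A -> nat).

Lemma polyfun_sdet (T : finType) (M : S -> T -> T -> K) :
  (forall a b, polyfun (fun s => M s a b)) -> polyfun (fun s => sdet (M s)).
Proof. by move=> h; apply: polyfun_det => i j; under eq_fun do rewrite mxE. Qed.

Lemma polyfun_sadj (T : finType) (M : S -> T -> T -> K) a b :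
  (forall a b, polyfun (fun s => M s a b)) -> polyfun (fun s => sadj (M s) a b).
Proof. by move=> h; apply: polyfun_adj => i j; under eq_fun do rewrite mxE. Qed.

Lemma polyfun_mask_sys L (g : S -> A -> A -> K) a b :
  (forall a b, polyfun (fun s => g s a b)) -> polyfun (fun s => mask_sys L (g s) a b).
Proof.
move=> h; rewrite /mask_sys; case: (L _ _) => /=; last exact: polyfun_cst.
by case: (L _ _ && _) => //; exact: polyfun_cst.
Qed.

Lemma polyfun_bigdet (g : S -> A -> A -> K) :
  (forall a b, polyfun (fun s => g s a b)) -> polyfun (fun s => bigdet l (g s)).
Proof. by move=> h; apply: polyfun_sdet => a b; exact: polyfun_mask_sys. Qed.

Lemma regular_bigsol (U : set (zariski S)) (g : S -> A -> A -> K) a b :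
  (forall a b, polyfun (fun s => g s a b)) -> (forall s, U s -> bigdet l (g s) != 0) ->
  affine_regular U (fun s => bigsol l (g s) a b).
Proof.
move=> h gU; rewrite /bigsol /mask_sol; case: (low l a b); last first.
  by apply: regular_polyfun; exact: polyfun_cst.
apply: regular_sum => r; apply: regularM.
  apply: regular_polyfun; apply: polyfunM.
    by case: (low l r.1 r.2); [exact: polyfunN|exact: polyfun_cst].
  by apply: polyfun_sadj => ? ?; exact: polyfun_mask_sys.
apply: regularV => //; apply: regular_polyfun; exact: polyfun_bigdet.
Qed.

Definition fminv (g : A -> A -> K) : A -> A -> K := fun x y => sadj g x y / sdet g.

Lemma regular_fminv (U : set (zariski S)) (g : S -> A -> A -> K) a b :
  (forall a b, polyfun (fun s => g s a b)) -> (forall s, U s -> sdet (g s) != 0) ->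
  affine_regular U (fun s => fminv (g s) a b).
Proof.
move=> h gU; apply: regularM; first by apply: regular_polyfun; exact: polyfun_sadj.
by apply: regularV => //; apply: regular_polyfun; exact: polyfun_sdet.
Qed.

End PolynomialBigCell.

Lemma fminvE (K : fieldType) (A : finType) (g : A -> A -> K) : sdet g != 0 ->
  g ** fminv g = @fone K A /\ fminv g ** g = @fone K A.
Proof.
move=> d0; suff h : g ** fminv g = @fone K A by split=> //; exact: fmul_right_inv.
apply: fmatP => x y; rewrite /fmul /fminv; under eq_bigr => b _ do rewrite mulrA.
rewrite -mulr_suml; have := congr1 (fun f => f x y) (smat_adj g); rewrite /fmul /= => ->.
by rewrite mulrAC divff // mul1r.
Qed.

Lemma sdet_inv (K : fieldType) (A : finType) (g r : A -> A -> K) :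
  g ** r = @fone K A -> sdet g != 0 /\ fminv g = r.
Proof.
move=> gr; have d0 : sdet g != 0.
  apply: sdet_neq0 => v vg t.
  have vg0 : (fun _ : unit => v) ** g = fun _ _ => 0 by apply: fmatP => x y; exact: vg.
  have := congr1 (fun h => ((fun _ : unit => v) ** h) tt t) gr; rewrite /= fmulr1 fmulA => <-.
  by rewrite vg0 fmul0l.
split=> //; have [_ h] := fminvE d0.
by rewrite -[LHS]fmulr1 -gr fmulA h fmul1.
Qed.

(** * Flags in a general representation *)

Section GenericInChart.
Variables (K : closedFieldType) (Q : quiver) (X : vertex Q -> finType).
Variable lv : forall p, X p -> nat.
Arguments lv : clear implicits.

Lemma nonzero_poly_prod (J I : finType) (F : I -> (J -> K) -> K) :
  (forall i, nonzero_poly (F i)) -> nonzero_poly (fun v => \prod_i F i v).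
Proof.
move=> h; elim: (index_enum I) => [|i r IH].
  rewrite (funext (fun x => big_nil _ _ _ _)); split; first exact: polyfun_cst.
  by exists (fun=> 0); exact: oner_neq0.
by rewrite (funext (fun x => big_cons _ _ _ _ _ _)); exact: nonzero_polyM.
Qed.

Definition end_at (t : endo_index X -> K) : emat K X :=
  fun p x y => t (Tagged (fun p => (X p * X p)%type) (x, y)).
Arguments end_at : clear implicits.

Definition end_flat (g : emat K X) : endo_index X -> K :=
  fun i => g (tag i) (tagged i).1 (tagged i).2.

Definition move_rep (g : emat K X) (u : rep_index X -> K) : rep_index X -> K :=
  flat (fun e => g (ta e) ** rep_at u e ** fminv (g (ia e))).

Lemma aff_irreducible (J : finType) : irreducible_space (aff K J).
Proof. by move=> f g; exact: polyfun_neq0M. Qed.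

(** Each requirement on [t] is open in the affine space of families of endomorphisms, and can be met
    separately: by [t = 1] for the determinants and for [h], by [t = G' k] for the cell condition at
    [k]. Irreducibility gives a [t] meeting all of them. *)
Lemma generic_translate (I : finType) (G G' : I -> emat K X) u h :
  nonzero_poly h -> h u != 0 -> (forall k p, G k p ** G' k p = @fone K (X p)) ->
  exists t : emat K X, [/\ forall p, sdet (t p) != 0, h (move_rep t u) != 0 &
    forall k p, bigdet (lv p) (t p ** G k p) != 0].
Proof.
move=> [ph _] hu GG'.
pose D (t : endo_index X -> K) := \prod_p sdet (end_at t p).
have pe p x y : polyfun (X := aff K (endo_index X)) (fun t => end_at t p x y).
  exact: polyfun_aff.
have pD : polyfun (X := aff K (endo_index X)) D.
  by apply: polyfun_prod => p; apply: polyfun_sdet => x y.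
have oneE p : end_at (end_flat (fun p => @fone K (X p))) p = @fone K (X p) by [].
have D1 : D (end_flat (fun p => @fone K (X p))) != 0.
  apply/prodf_neq0 => p _; rewrite oneE.
  by have [] := sdet_inv (fmul1 (@fone K (X p))).
pose U : set (zariski (aff K (endo_index X))) := [set t | D t != 0].
have oU : open U by rewrite zariski_openE => t Dt; exists D.
(* [move_rep] contains the inverse of [t], so [H] is regular only on the open set where the
   determinants are non-zero. *)
pose H (t : endo_index X -> K) := h (move_rep (end_at t) u).
have rH : affine_regular U (H : aff K (endo_index X) -> K).
  apply: (@regular_comp K (aff K (endo_index X)) U (aff K (rep_index X)) (fun t => move_rep (end_at t) u) h) => //.
  move=> _ [r ->]; apply: regular_fmul => [x y|y z].
    apply: regular_fmul => [a b|b c]; first exact: regular_polyfun.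
    by apply: regular_polyfun; exact: polyfun_cst.
  by apply: regular_fminv => // t /prodf_neq0 h1; exact: h1.
pose F (t : endo_index X -> K) :=
  \prod_(kp : I * vertex Q) bigdet (lv kp.2) (end_at t kp.2 ** G kp.1 kp.2).
have [pF [t0 Ft0]] : nonzero_poly F.
  apply: nonzero_poly_prod => -[k p]; split.
    apply: polyfun_bigdet => x y; apply: polyfun_fmul => // a b; exact: polyfun_cst.
  exists (end_flat (G' k)) => /=.
  have -> : end_at (end_flat (G' k)) p ** G k p = @fone K (X p) by exact: fmul_right_inv.
  rewrite -funi0; have [] // := @bigsol_funi K _ (lv p) (fun _ _ => 0).
have [||||t [[Dt Ht] Ft]] := @irreducible_openI _ (aff K (endo_index X)) (U `&` [set t | H t != 0])
    [set t | F t != 0] (@aff_irreducible _).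
- exact: regular_neq0_open.
- by rewrite zariski_openE => t Ft; exists F.
- exists (end_flat (fun p => @fone K (X p))); split=> //=; rewrite /H /move_rep.
  rewrite (_ : flat _ = u) // -[RHS]flatK; congr flat; apply: rmatP => e.
  by rewrite !oneE fmul1 (sdet_inv (fmul1 (@fone K _))).2 fmulr1.
- by exists t0.
exists (end_at t); split=> // [p|k p].
  by have /prodf_neq0 h1 := Dt; exact: h1.
by have /prodf_neq0 h1 := Ft; exact: (h1 (k, p)).
Qed.

(* A flag of [u] outside the big cell would give a general translate of [u], which
   still satisfies [h], one flag too many in the big cell. *)
Lemma generic_in_chart n :
  generic_card (fun u => [set v : chart_index lv -> K | chart_map v = u]) n ->
  exists2 h, nonzero_poly h & forall u, h u != 0 ->
    has_card [set v : chart_index lv -> K | chart_map v = u] n /\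
    forall (g g' : emat K X) (w : rmat K X), (forall p, g p ** g' p = @fone K (X p)) ->
      upper_mat lv w -> (forall e, rep_at u e ** g (ia e) = g (ta e) ** w e) ->
      exists v, chart_map v = u /\
        forall p, upper (lv p) (lv p) (funi (linv (lv p) (chart_low lv v p)) ** g p).
Proof.
move=> [h h0 hn]; exists h => // u hu; split; first exact: hn.
move=> g g' w gg' wu uw; have [x [x_inj xE]] := hn u hu.
have xu i : chart_map (x i) = u by apply/xE; exists i.
(* [Some i] stands for the [i]-th flag of [u] in the big cell, and [None] for the flag given by
   [g]. *)
pose G k : emat K X := fun p => if k is Some i then funi (chart_low lv (x i) p) else g p.
pose G' k : emat K X := fun p =>
  if k is Some i then funi (linv (lv p) (chart_low lv (x i) p)) else g' p.
pose W k : rmat K X := if k is Some i then chart_up lv (x i) else w.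
have GG' k p : G k p ** G' k p = @fone K (X p).
  case: k => [i|]; last exact: gg'.
  by apply: funi_linvr; exact: low_mat_lowtri.
have WU k : upper_mat lv (W k) by case: k => [i|] //; exact: up_mat_upper.
have GW k e : rep_at u e ** G k (ia e) = G k (ta e) ** W k e.
  case: k => [i|]; last exact: uw.
  by apply/esym; move: e; apply/chart_mapP.
have [t [dt ht tG]] := generic_translate h0 hu GG'.
pose s p := fminv (t p); have ts p : t p ** s p = @fone K (X p) by exact: (fminvE (dt p)).1.
have st p : s p ** t p = @fone K (X p) by exact: (fminvE (dt p)).2.
have inv k p : (t p ** G k p) ** (G' k p ** s p) = @fone K (X p).
  by rewrite -fmulA [G k p ** _]fmulA GG' fmul1.
pose m k p := linv (lv p) (bigsol (lv p) (t p ** G k p)).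
pose q k p := funi (bigsol (lv p) (t p ** G k p)) ** (t p ** G k p).
have cell k p := bigcellP (inv k p) (tG k p).
have /choice[r rE] : forall k, exists r : emat K X, forall p, q k p ** r p = @fone K (X p).
  move=> k; have h1 p : exists r, q k p ** r = @fone K (X p) by have [_ _ _ ?] := cell k p.
  by exists (fun p => projT1 (cid (h1 p))) => p; exact: (projT2 (cid (h1 p))).
have [y [y_inj yE]] := hn _ ht.
have ml k : lowtri_mat lv (m k) by move=> p; have [] := cell k p.
have qu k p : upper (lv p) (lv p) (q k p) by have [] := cell k p.
have tGE k p : t p ** G k p = funi (m k p) ** q k p by have [] := cell k p.
clear cell; clearbody m q.
pose W' k : rmat K X := fun e => q k (ta e) ** W k e ** r k (ia e).
have W'U k : upper_mat lv (W' k).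
  move=> e; apply: upperM (upperM (qu k _) (WU k e)) (upper_inv (qu k _) (rE k _)).
have vk k : chart_map (chart_vec (lv := lv) (m k) (W' k)) = move_rep t u.
  apply/chart_mapP => e; rewrite chart_lowK // chart_upK //.
  have -> : rep_at (move_rep t u) e = t (ta e) ** rep_at u e ** s (ia e) by [].
  transitivity (t (ta e) ** (G k (ta e) ** W k e) ** r k (ia e)).
    by rewrite /W' !fmulA -tGE.
  have hR : funi (m k (ia e)) = t (ia e) ** G k (ia e) ** r k (ia e).
    by rewrite tGE -fmulA rE fmulr1.
  by rewrite -GW hR -!fmulA [s (ia e) ** _]fmulA st fmul1.
have /choice[f fE] : forall k, exists i, chart_vec (lv := lv) (m k) (W' k) = y i.
  by move=> k; apply/yE; exact: vk.
(* If the translates [t G_k = (1 + m) q_k] and [t G_l = (1 + m) q_l] have the same unipotent factor,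
   then [G_k^-1 G_l = q_k^-1 q_l] is upper: the two flags coincide. *)
have up k l p : m k = m l -> upper (lv p) (lv p) (G' k p ** G l p).
  move=> mkl; have ru := upper_inv (qu k p) (rE k p).
  have -> : G' k p ** G l p = r k p ** q l p.
    have e1 : (G' k p ** s p) ** (t p ** G k p) = @fone K (X p) by exact: fmul_right_inv.
    have e2 : r k p ** funi (linv (lv p) (m k p)) = G' k p ** s p.
      rewrite -[RHS]fmulr1 -(funi_linvr (ml k p)) fmulA; congr (_ ** _).
      by rewrite -[LHS]fmul1 -e1 tGE -!fmulA rE fmulr1.
    rewrite -[G l p]fmul1 -(st p) -fmulA tGE fmulA -e2 -mkl -!fmulA.
    by rewrite [funi (linv _ _) ** _]fmulA (funi_linvl (ml k p)) fmul1.
  exact: upperM ru (qu l p).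
(* The [n + 1] flags are sent to the [n] points over the translate. A collision of two flags already
   in the cell would identify distinct points of the fibre, so [g] collides with one of them. *)
have /injectivePn[k [l kl fkl]] : ~~ injectiveb f.
  by apply/injectiveP => /leq_card; rewrite card_option !card_ord ltnn.
have mkl : m k = m l.
  by rewrite -(chart_lowK (W' k) (ml k)) -(chart_lowK (W' l) (ml l)) !fE fkl.
case: k l kl fkl mkl => [i|] [j|] // kl _ mkl.
- case/negP: kl; apply/eqP; congr Some; apply: x_inj; apply: chart_map_inj.
    by rewrite !xu.
  apply: ematP => p; have := up _ _ p mkl; rewrite /G /G' => U1.
  have il := low_mat_lowtri (x i \o inl) (p := p).
  have jl := low_mat_lowtri (x j \o inl) (p := p).
  exact/esym/(upper_quot_eq il jl U1).
- by exists (x i); split=> // p; exact: up _ _ p mkl.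
- by exists (x j); split=> // p; exact: up _ _ p (esym mkl).
Qed.

End GenericInChart.

Arguments end_at {K Q X} t p x y.

(** * Coordinates *)

Definition line_map (K : fieldType) (V : vectType K) (v : V) (c : K^o) : V := (c : K) *: v.

Fact line_map_is_linear (K : fieldType) (V : vectType K) (v : V) : linear (line_map v).
Proof. by move=> a c d; rewrite /line_map scalerDl scalerA. Qed.
HB.instance Definition _ (K : fieldType) (V : vectType K) (v : V) :=
  GRing.isLinear.Build K K^o V *:%R (line_map v) (@line_map_is_linear K V v).

Definition coord_map (K : fieldType) (V : vectType K) n (t : n.-tuple V) i (v : V) : K^o :=
  coord t i v.

Fact coord_map_is_linear (K : fieldType) (V : vectType K) n (t : n.-tuple V) i :
  linear (coord_map t i).
Proof. by move=> a u v; rewrite /coord_map linearP. Qed.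
HB.instance Definition _ (K : fieldType) (V : vectType K) n (t : n.-tuple V) i :=
  GRing.isLinear.Build K V K^o *:%R (coord_map t i) (coord_map_is_linear t i).

Section Coordinates.
Variable K : fieldType.

Definition is_coord (V : vectType K) (X : finType) (b : X -> V) (co : X -> 'Hom(V, K^o)) : Prop :=
  (forall v, v = \sum_x (co x v : K) *: b x) /\ (forall x y, co x (b y) = (x == y)%:R).

Lemma is_coord_exists (V : vectType K) (X : finType) (b : X -> V) :
  (fullv <= <<codom b>>)%VS -> #|X| = \dim {:V} -> exists co, is_coord b co.
Proof.
move=> bV cX; pose t := codom_tuple b.
have tB : basis_of fullv t by rewrite basisEdim bV size_tuple cX leqnn.
have tE (i : 'I_#|X|) : t`_i = b (enum_val i).
  by rewrite /= /codom_tuple /codom /image_mem (nth_map (enum_val i)) -?cardE // -enum_val_nth.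
exists (fun x => linfun (coord_map t (enum_rank x))); split=> [v|x y].
  rewrite {1}(coord_basis tB (memvf v)) [RHS]sum_enum_rank.
  by apply: eq_bigr => i _; rewrite lfunE /= enum_valK -tE.
rewrite lfunE /= /coord_map -{1}[y]enum_rankK -tE coord_free ?(basis_free tB) //.
by rewrite (inj_eq enum_rank_inj) eq_sym.
Qed.

Section Matrices.
Variables (V W : vectType K) (X Y : finType) (b : X -> V) (co : X -> 'Hom(V, K^o)).
Variables (c : Y -> W) (do : Y -> 'Hom(W, K^o)).

Definition mat (f : 'Hom(V, W)) : Y -> X -> K := fun y x => do y (f (b x)).

Definition hom1 (y : Y) (x : X) : 'Hom(V, W) := (linfun (line_map (c y)) \o co x)%VF.
Definition homm (w : Y -> X -> K) : 'Hom(V, W) := \sum_y \sum_x w y x *: hom1 y x.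

Lemma hommE w v : homm w v = \sum_y (\sum_x w y x * co x v) *: c y.
Proof.
rewrite /homm sum_lfunE; apply: eq_bigr => y _; rewrite sum_lfunE scaler_suml.
apply: eq_bigr => x _; rewrite scale_lfunE comp_lfunE lfunE /= /line_map.
by rewrite scalerA.
Qed.

Hypotheses (bV : is_coord b co) (cW : is_coord c do).

Lemma coord_eval (f : 'Hom(V, W)) v y : do y (f v) = \sum_x mat f y x * co x v.
Proof.
rewrite {1}(bV.1 v) !linear_sum /=; apply: eq_bigr => x _.
by rewrite !linearZ /= mulrC.
Qed.

Lemma mat_homm w : mat (homm w) = w.
Proof.
apply: fmatP => y x; rewrite /mat hommE linear_sum.
transitivity (\sum_y' (\sum_x' w y' x' * fone K x' x) * fone K y y').
  apply: eq_bigr => y' _; rewrite linearZ /= cW.2; congr (_ * _).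
  by apply: eq_bigr => x' _; rewrite bV.2.
transitivity ((w ** @fone K X) y x); last by rewrite fmulr1.
rewrite [LHS](bigD1 y) //= {2}/fone eqxx mulr1 [X in _ + X]big1 ?addr0 // => y' /negPf yy.
by rewrite /fone eq_sym yy mulr0.
Qed.

Lemma matK f : homm (mat f) = f.
Proof.
apply/lfunP => v; rewrite hommE [RHS](cW.1 (f v)).
by apply: eq_bigr => y _; rewrite coord_eval.
Qed.

Lemma mat_inj : injective mat.
Proof. exact: can_inj matK. Qed.

Lemma polyfun_homm (S : coordSpace K) (h : S -> 'Hom(V, W)) (l : 'Hom('Hom(V, W), K^o)) :
  (forall y x, polyfun (fun s => mat (h s) y x)) -> polyfun (fun s => l (h s) : K).
Proof.
move=> hp; rewrite (_ : (fun s => _) =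
  fun s => \sum_y \sum_x mat (h s) y x * l (hom1 y x)).
  apply: polyfun_sum => y; apply: polyfun_sum => x; apply: polyfunM => //.
  exact: polyfun_cst.
apply/funext => s; rewrite -{1}(matK (h s)) /homm linear_sum; apply: eq_bigr => y _.
by rewrite linear_sum; apply: eq_bigr => x _; rewrite linearZ.
Qed.

Definition entry (y : Y) (x : X) (f : 'Hom(V, W)) : K^o := mat f y x.

Fact entry_is_linear y x : linear (entry y x).
Proof. by move=> a f g; rewrite /entry /mat add_lfunE scale_lfunE linearP. Qed.
HB.instance Definition _ y x :=
  GRing.isLinear.Build K 'Hom(V, W) K^o *:%R (entry y x) (entry_is_linear y x).

Lemma linfun_entry y x f : linfun (entry y x) f = mat f y x.
Proof. by rewrite lfunE. Qed.

End Matrices.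

Lemma mat_comp (V V' V'' : vectType K) (X X' X'' : finType) (b : X -> V) co
    (b' : X' -> V') co' co'' (f : 'Hom(V', V'')) (g : 'Hom(V, V')) :
  is_coord b co -> is_coord b' co' ->
  mat b co'' (f \o g)%VF = mat b' co'' f ** mat b co' g :> (X'' -> X -> K).
Proof.
move=> bV bV'; apply: fmatP => z x; rewrite {1}/mat comp_lfunE.
by rewrite (coord_eval co'' bV').
Qed.

Lemma mat_id (V : vectType K) (X : finType) (b : X -> V) co :
  is_coord b co -> mat b co \1%VF = @fone K X.
Proof. by move=> bV; apply: fmatP => x y; rewrite /mat id_lfunE bV.2. Qed.

Lemma homm_comp (V V' V'' : vectType K) (X X' X'' : finType) (b : X -> V) co
    (b' : X' -> V') co' (b'' : X'' -> V'') co'' w w' :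
  is_coord b co -> is_coord b' co' -> is_coord b'' co'' ->
  homm co b'' (w ** w') = (homm co' b'' w \o homm co b' w')%VF.
Proof.
move=> h h' h''; apply: (mat_inj h h''); rewrite (mat_comp _ _ _ h h').
by rewrite !mat_homm.
Qed.

Lemma lker_mat (V : vectType K) (X : finType) (b : X -> V) co (g : 'End(V)) :
  is_coord b co -> lker g == 0%VS -> mat b co g ** mat b co g^-1%VF = @fone K X.
Proof.
by move=> bV g0; rewrite -(mat_comp _ _ _ bV bV) lker0_compfV // mat_id.
Qed.

Lemma lker_homm (V : vectType K) (X : finType) (b : X -> V) co (w r : X -> X -> K) :
  is_coord b co -> w ** r = @fone K X -> lker (homm co b w) == 0%VS.
Proof.
move=> bV /fmul_right_inv wr; apply/lker0P; apply: (can_inj (g := homm co b r)) => v.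
rewrite -comp_lfunE -(homm_comp _ _ bV bV bV) wr.
by rewrite -(mat_id bV) (matK bV bV) id_lfunE.
Qed.

End Coordinates.

(** * Representations in coordinates *)

Section Parametrized.
Variable K : closedFieldType.

(** An image of a principal open subset of affine space, from which it inherits irreducibility; the
    denominator [d] is there for [GL], where it is a product of determinants. *)
Definition parametrized (S : coordSpace K) : Prop :=
  exists (J : finType) (d : (J -> K) -> K) (tau : (J -> K) -> S),
  [/\ nonzero_poly d,
      forall c, coordfun c -> exists2 g : aff K J -> K, polyfun g &
        forall v, d v != 0 -> c (tau v) = g v &
      forall x, exists2 v, d v != 0 & tau v = x].

Lemma parametrized_irreducible S : parametrized S -> irreducible_space S.
Proof.
move=> [J [d [tau [d0 tau_poly tau_surj]]]] f g pf pg [x fx] [y gy].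
have lift h : polyfun h -> exists2 h' : aff K J -> K, polyfun h' &
    forall v, d v != 0 -> h (tau v) = h' v.
  elim=> [c|c /tau_poly//|h1 h2 _ [g1 pg1 e1] _ [g2 pg2 e2]|h1 h2 _ [g1 pg1 e1] _ [g2 pg2 e2]].
  - by exists (fun=> c) => //; exact: polyfun_cst.
  - by exists (fun v => g1 v + g2 v) => [|v dv]; [exact: polyfunD|rewrite e1 ?e2].
  - by exists (fun v => g1 v * g2 v) => [|v dv]; [exact: polyfunM|rewrite e1 ?e2].
have [f' pf' fE] := lift f pf; have [g' pg' gE] := lift g pg.
have nf : nonzero_poly f' by split=> //; have [v dv vx] := tau_surj x; exists v; rewrite -fE ?vx.
have ng : nonzero_poly g' by split=> //; have [v dv vy] := tau_surj y; exists v; rewrite -gE ?vy.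
have [_ [v]] := nonzero_polyM d0 (nonzero_polyM nf ng).
rewrite !mulf_eq0 !negb_or => /andP[dv /andP[fv gv]].
by exists (tau v); rewrite fE ?gE.
Qed.

Lemma parametrized_prod S T : parametrized S -> parametrized T -> parametrized (prod_space S T).
Proof.
move=> [J [d [tau [[pd [v0 dv0]] tau_poly tau_surj]]]].
move=> [L [d' [tau' [[pd' [w0 dw0]] tau'_poly tau'_surj]]]].
have pl f : polyfun (X := aff K J) f -> polyfun (X := aff K (J + L)%type) (fun v => f (v \o inl)).
  apply: (@polyfun_comp _ (aff K (J + L)%type) (aff K J) (fun v => v \o inl)).
  by move=> _ [j ->]; exact: (@polyfun_aff _ (J + L)%type (inl j)).
have pr f : polyfun (X := aff K L) f -> polyfun (X := aff K (J + L)%type) (fun v => f (v \o inr)).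
  apply: (@polyfun_comp _ (aff K (J + L)%type) (aff K L) (fun v => v \o inr)).
  by move=> _ [j ->]; exact: (@polyfun_aff _ (J + L)%type (inr j)).
exists (J + L)%type, (fun v => d (v \o inl) * d' (v \o inr)),
  (fun v => (tau (v \o inl), tau' (v \o inr))).
have mk v w : exists u : J + L -> K, u \o inl = v /\ u \o inr = w.
  by exists (fun j => match j with inl j => v j | inr l => w l end).
split.
- split; first by apply: polyfunM; [exact: pl|exact: pr].
  by have [u [uv uw]] := mk v0 w0; exists u; rewrite uv uw mulf_neq0.
- move=> _ [[c cc ->]|[c cc ->]].
    have [g pg gE] := tau_poly c cc; exists (fun v => g (v \o inl)); first exact: pl.
    by move=> v; rewrite mulf_eq0 negb_or => /andP[dv _]; exact: gE.
  have [g pg gE] := tau'_poly c cc; exists (fun v => g (v \o inr)); first exact: pr.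
  by move=> v; rewrite mulf_eq0 negb_or => /andP[_ dv]; exact: gE.
move=> [x y]; have [v dv vx] := tau_surj x; have [w dw wy] := tau'_surj y.
by have [u [uv uw]] := mk v w; exists u; rewrite uv uw ?mulf_neq0 ?vx ?wy.
Qed.

End Parametrized.

Lemma sval_sub_inj (K : fieldType) (Y : coordSpace K) (S : set Y) (x y : sub_space S) :
  sval x = sval y -> x = y.
Proof. by case: x y => [x Sx] [y Sy] /= ?; exact: eq_exist. Qed.

Section Based.
Variables (K : closedFieldType) (Q : quiver) (V : vertex Q -> vectType K).
Variables (X : vertex Q -> finType) (b : forall p, X p -> V p).
Variable co : forall p, X p -> 'Hom(V p, K^o).
Arguments b : clear implicits.
Arguments co : clear implicits.
Hypothesis bV : forall p, is_coord (b p) (co p).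

Definition gmat (g : Endo V) : emat K X := fun p => mat (b p) (co p) (g p).
Definition rep_mat (u : Rep V) : rmat K X := fun e => mat (b (ia e)) (co (ta e)) (u e).
Definition ghom (m : emat K X) : Endo V := fun p => homm (co p) (b p) (m p).
Definition rep_hom (w : rmat K X) : Rep V := fun e => homm (co (ia e)) (b (ta e)) (w e).
Arguments gmat : clear implicits.
Arguments rep_mat : clear implicits.

Lemma gmatK g : ghom (gmat g) = g.
Proof. by apply: functional_extensionality_dep => p; exact: (matK (bV p) (bV p)). Qed.

Lemma ghomK m : gmat (ghom m) = m.
Proof. by apply: ematP => p; exact: (mat_homm (bV p) (bV p)). Qed.

Lemma rep_matK u : rep_hom (rep_mat u) = u.
Proof. by apply: functional_extensionality_dep => e; exact: (matK (bV _) (bV _)). Qed.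

Lemma rep_homK w : rep_mat (rep_hom w) = w.
Proof. by apply: rmatP => p; exact: (mat_homm (bV _) (bV _)). Qed.

Lemma gmatM g h p : gmat (gmul g h) p = gmat g p ** gmat h p.
Proof. exact: mat_comp (bV p) (bV p). Qed.

Lemma gmatV (g : GL V) p : gmat (sval g) p ** gmat (ginv (sval g)) p = @fone K (X p).
Proof. exact: lker_mat (bV p) (svalP g p). Qed.

Lemma gmatVl (g : GL V) p : gmat (ginv (sval g)) p ** gmat (sval g) p = @fone K (X p).
Proof. exact: fmul_right_inv (gmatV g p). Qed.

Lemma rep_mat_gact g u e :
  rep_mat (gact g u) e = gmat g (ta e) ** rep_mat u e ** gmat (ginv g) (ia e).
Proof. by rewrite -(mat_comp _ _ _ (bV _) (bV _)) -(mat_comp _ _ _ (bV _) (bV _)). Qed.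

Lemma ghom_GL m r : (forall p, m p ** r p = @fone K (X p)) ->
  forall p, lker (ghom m p) == 0%VS.
Proof. by move=> mr p; exact: lker_homm (bV p) (mr p). Qed.

Definition mkGL m r (mr : forall p, m p ** r p = @fone K (X p)) : GL V :=
  exist _ (ghom m) (ghom_GL mr).

Lemma mkGLV m r (mr : forall p, m p ** r p = @fone K (X p)) p :
  gmat (ginv (sval (mkGL mr))) p = r p.
Proof.
have h := gmatVl (mkGL mr) p; rewrite /= ghomK in h.
by rewrite -[LHS]fmulr1 -(mr p) fmulA h fmul1.
Qed.

Lemma gmat_inj g h : gmat g = gmat h -> g = h.
Proof. by move=> e; rewrite -(gmatK g) e gmatK. Qed.

Lemma polyfun_entry (S : coordSpace K) (h : S -> Rep V) e y x :
  (forall c, coordfun c -> polyfun (c \o h)) -> polyfun (fun s => rep_mat (h s) e y x).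
Proof.
move=> hp; have := hp (fun u => linfun (entry (b (ia e)) (co (ta e)) y x) (u e)).
rewrite (_ : _ \o _ = fun s => rep_mat (h s) e y x); last first.
  by apply/funext => s /=; rewrite linfun_entry.
by apply; exists e, (linfun (entry (b (ia e)) (co (ta e)) y x)).
Qed.

Lemma polyfun_gentry (S : coordSpace K) (h : S -> Endo V) p y x :
  (forall c, coordfun c -> polyfun (c \o h)) -> polyfun (fun s => gmat (h s) p y x).
Proof.
move=> hp; have := hp (fun u => linfun (entry (b p) (co p) y x) (u p)).
rewrite (_ : _ \o _ = fun s => gmat (h s) p y x); last first.
  by apply/funext => s /=; rewrite linfun_entry.
by apply; exists p, (linfun (entry (b p) (co p) y x)).
Qed.

Lemma polyfun_rep (S : coordSpace K) (h : S -> Rep V) c :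
  (forall e y x, polyfun (fun s => rep_mat (h s) e y x)) -> coordfun c -> polyfun (c \o h).
Proof.
move=> hp [e [l ->]].
exact: (polyfun_homm (bV (ia e)) (bV (ta e)) (h := fun s => h s e) l (hp e)).
Qed.

Lemma polyfun_endo (S : coordSpace K) (h : S -> Endo V) c :
  (forall e y x, polyfun (fun s => gmat (h s) e y x)) -> coordfun c -> polyfun (c \o h).
Proof.
move=> hp [p [l ->]].
exact: (polyfun_homm (bV p) (bV p) (h := fun s => h s p) l (hp p)).
Qed.

Lemma parametrized_Rep : parametrized (Rep V).
Proof.
exists (rep_index X), (fun=> 1), (fun u => rep_hom (rep_at u)); split.
- by split; [exact: polyfun_cst|exists (fun=> 0); exact: oner_neq0].
- move=> c cc; exists (c \o (fun u => rep_hom (rep_at u))) => //.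
  apply: (polyfun_rep (S := aff K (rep_index X))) cc => e y x.
  under eq_fun do rewrite rep_homK; exact: polyfun_aff.
by move=> u; exists (flat (rep_mat u)); [exact: oner_neq0|exact: rep_matK].
Qed.

Lemma parametrized_GL : parametrized (GL V).
Proof.
pose d (t : endo_index X -> K) := \prod_p sdet (end_at t p).
have dE t : d t != 0 -> forall p, end_at t p ** fminv (end_at t p) = @fone K (X p).
  by move=> /prodf_neq0 h p; have [] := @fminvE _ _ (end_at t p) (h p isT).
(* Where a determinant vanishes, [tau] takes the identity as a default value. *)
pose tau (t : endo_index X -> K) : GL V := match pselect (d t != 0) with
  | left h => mkGL (dE t h) | right _ => exist _ _ (@GL1 _ _ V) end.
have tauE t : d t != 0 -> sval (tau t) = ghom (end_at t).
  by rewrite /tau; case: pselect.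
exists (endo_index X), d, tau; split.
- split.
    apply: (@polyfun_prod _ (aff K (endo_index X))) => p.
    by apply: (@polyfun_sdet _ (aff K (endo_index X))) => x y; exact: polyfun_aff.
  exists (end_flat (fun p => @fone K (X p))); apply/prodf_neq0 => p _.
  by have [] := sdet_inv (fmul1 (@fone K (X p))).
- move=> _ [c cc ->]; exists (c \o (fun t => ghom (end_at t))).
    apply: (polyfun_endo (S := aff K (endo_index X))) cc => e y x.
    under eq_fun do rewrite ghomK; exact: polyfun_aff.
  by move=> t dt /=; rewrite tauE.
move=> g; have gE p : end_at (end_flat (gmat (sval g))) p = gmat (sval g) p by [].
have dg : d (end_flat (gmat (sval g))) != 0.
  by apply/prodf_neq0 => p _; have [] := sdet_inv (gmatV g p).
exists (end_flat (gmat (sval g))) => //.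
apply: sval_sub_inj; rewrite tauE //; exact: gmatK.
Qed.

Section Adapted.
Variables (s : nat) (W : forall p, 'I_s -> {vspace V p}) (lvs : forall p, X p -> 'I_s).
Arguments W : clear implicits.
Arguments lvs : clear implicits.
Hypothesis bW : forall p x, b p x \in W p (lvs p x).
Hypothesis coW : forall p i v x, v \in W p i -> lvs p x != i -> co p x v = 0.

Definition lev p (x : X p) : nat := lvs p x.
Arguments lev : clear implicits.

Lemma flagE p (i : 'I_s) v : reflect (forall x, (i < lev p x)%N -> co p x v = 0) (v \in flag W p i).
Proof.
apply: (iffP idP) => [|h].
  rewrite /flag => /memv_sumP[u uW ->] x ix; rewrite linear_sum big1 // => j ji.
  by apply: coW (uW j ji) _; apply: contraTneq ix => e; rewrite -leqNgt /lev e.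
rewrite ((bV p).1 v); apply: memv_suml => x _; case: (leqP (lev p x) i) => xi.
  by apply: memvZ; apply: (subvP (flag_mono W p xi)); apply: subvP (bW x); exact: sub_flag.
by rewrite h // scale0r mem0v.
Qed.

Lemma upper_flag p q (f : 'Hom(V p, V q)) :
  (forall i, (f @: W p i <= flag W q i)%VS) <-> upper (lev q) (lev p) (mat (b p) (co q) f).
Proof.
split=> [h y x xy|h i].
  have /flagE fx : f (b p x) \in flag W q (lvs p x).
    by apply: (subvP (h _)); exact: memv_img.
  exact: fx.
apply/subvP => _ /memv_imgP[v vW ->]; apply/flagE => y iy.
rewrite (coord_eval _ (bV p)) big1 // => x _; have [xi|xi] := eqVneq (lvs p x) i.
  by rewrite h ?mul0r // /lev xi.
by rewrite (coW vW xi) mulr0.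
Qed.

Lemma parabolicP (g : GL V) : parabolic W g <-> forall p, upper (lev p) (lev p) (gmat (sval g) p).
Proof.
by split=> h p; [apply/upper_flag; exact: h|move=> i; apply: (upper_flag _).2].
Qed.

Lemma CplusP (u : Rep V) :
  (forall e i, (u e @: W (ia e) i <= flag W (ta e) i)%VS) <-> upper_mat lev (rep_mat u).
Proof.
by split=> h e; [apply/upper_flag; exact: h|move=> i; apply: (upper_flag _).2].
Qed.

End Adapted.
End Based.

Arguments gmat {K Q V X} b co g p _ _.
Arguments rep_mat {K Q V X} b co u e _ _.
Arguments ghom {K Q V X} b co m _.
Arguments rep_hom {K Q V X} b co w _.
Arguments lev {Q X s} lvs p x.
Arguments polyfun_entry {K Q V X b co S h e y x}.
Arguments polyfun_gentry {K Q V X b co S h p y x}.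

(** * Charts of the homogeneous spaces *)

Local Open Scope quotient_scope.

Lemma regular_linv (K : fieldType) (S : coordSpace K) (U : set (zariski S)) (A : finType)
    (l : A -> nat) (m : S -> A -> A -> K) a b :
  (forall a b, affine_regular U (fun s => m s a b)) ->
  affine_regular U (fun s => linv l (m s) a b).
Proof.
move=> h; apply: (@regular_comp K S U (aff K (A * A)%type) (fun s xy => m s xy.1 xy.2)
  (fun t => linv l (fun x y => t (x, y)) a b)).
  by move=> _ [[x y] ->]; exact: h.
apply: (@polyfun_linv K (aff K (A * A)%type)) => x y; exact: polyfun_aff.
Qed.

Section SpaceCharts.
Variables (K : closedFieldType) (Q : quiver) (V : vertex Q -> vectType K).
Variables (X : vertex Q -> finType) (b : forall p, X p -> V p).
Variable co : forall p, X p -> 'Hom(V p, K^o).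
Arguments b : clear implicits.
Arguments co : clear implicits.
Hypothesis bV : forall p, is_coord (b p) (co p).
Variables (s : nat) (W : forall p, 'I_s -> {vspace V p}) (lvs : forall p, X p -> 'I_s).
Arguments W : clear implicits.
Arguments lvs : clear implicits.
Hypothesis bW : forall p x, b p x \in W p (lvs p x).
Hypothesis coW : forall p i v x, v \in W p i -> lvs p x != i -> co p x v = 0.

Local Notation lv := (lev lvs).
Local Notation gm := (gmat b co).
Local Notation rm := (rep_mat b co).
Local Notation rhom := (rep_hom b co).

Definition rep_chart (u : rep_index X -> K) : affine (Rep V) := rhom (rep_at u).

Lemma rep_chartP : is_fchart rep_chart.
Proof.
move=> N e e' eK eK'.
apply: (@chart_from_section K (Rep V) (affine (Rep V)) id _ _ _ _ (rep_index X) rep_chart setT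
  (fun u => flat (rm u))) eK eK' => //.
- by move=> x; exists x.
- exact: parametrized_irreducible (parametrized_Rep bV).
- move=> c; apply: (polyfun_rep bV (S := aff K (rep_index X))) => e1 y x.
  by under eq_fun do rewrite (rep_homK bV); exact: polyfun_aff.
- exact: openT.
- move=> j; apply: (@regular_polyfun _ (Rep V) setT (fun u => flat (rm u) j)).
  by apply: (polyfun_entry (S := Rep V) (h := id)) => c; exact: polyfun_coord.
- by move=> v; rewrite /rep_chart (rep_homK bV) flatK.
- by move=> u _; rewrite /rep_chart -[RHS](rep_matK bV); congr (rhom _).
by move=> u u' _ /= ->.
Qed.

Let upC (w : rmat K X) : upper_mat lv w ->
  forall e i, (rhom w e @: W (ia e) i <= flag W (ta e) i)%VS.
Proof. by move=> wu; apply/(CplusP bV bW coW); rewrite (rep_homK bV). Qed.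

Definition mkC (w : rmat K X) (wu : upper_mat lv w) : Cplus W :=
  exist (fun u : Rep V => forall e i, (u e @: W (ia e) i <= flag W (ta e) i)%VS)
    (rhom w) (upC wu).

Lemma Cplus_upper (y : Cplus W) : upper_mat lv (rm (sval y)).
Proof. by apply/(CplusP bV bW coW); exact: svalP y. Qed.

Definition up_chart (v : up_index lv -> K) : Cplus W := mkC (up_mat_upper v).

Lemma up_chart_poly c : coordfun c -> polyfun (X := aff K (up_index lv)) (c \o up_chart).
Proof.
case=> c' c'c ->; apply: (polyfun_rep bV (S := aff K (up_index lv))
  (h := fun v => rhom (up_mat lv v))) c'c => e y x.
by under eq_fun do rewrite (rep_homK bV); exact: polyfun_up_mat.
Qed.

Lemma up_vec_chart v : up_vec (lv := lv) (rm (sval (up_chart v))) = v.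
Proof. by rewrite /= (rep_homK bV) up_matK. Qed.

Lemma up_chart_vec y : up_chart (up_vec (lv := lv) (rm (sval y))) = y.
Proof.
by apply: sval_sub_inj; rewrite /= up_vecK ?(rep_matK bV) //; exact: Cplus_upper.
Qed.

Lemma parametrized_Cplus : parametrized (Cplus W).
Proof.
exists (up_index lv), (fun=> 1), up_chart; split.
- by split; [exact: polyfun_cst|exists (fun=> 0); exact: oner_neq0].
- by move=> c cc; exists (c \o up_chart) => //; exact: up_chart_poly.
by move=> u; exists (up_vec (rm (sval u))); [exact: oner_neq0|exact: up_chart_vec].
Qed.

Lemma polyfun_Cplus_entry e y x : polyfun (X := Cplus W) (fun u => rm (sval u) e y x).
Proof.
apply: (polyfun_entry (S := Cplus W)) => c cc.
by apply: polyfun_coord; exists c.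
Qed.

Lemma up_chartP : is_fchart (X := affine (Cplus W)) up_chart.
Proof.
move=> N e e' eK eK'.
apply: (@chart_from_section K (Cplus W) (affine (Cplus W)) id _ _ _ _ (up_index lv) up_chart setT
  (fun y => up_vec (rm (sval y)))) eK eK' => //.
- by move=> x; exists x.
- exact: parametrized_irreducible parametrized_Cplus.
- exact: up_chart_poly.
- exact: openT.
- by move=> j; apply: regular_polyfun; exact: polyfun_Cplus_entry.
- exact: up_vec_chart.
- by move=> y _; exact: up_chart_vec.
by move=> u u' _ /= ->.
Qed.

Definition low_GL (v : low_index lv -> K) : GL V :=
  mkGL bV (fun p => funi_linvr (low_mat_lowtri v (p := p))).

Lemma gmat_low_GL v p : gm (sval (low_GL v)) p = funi (low_mat lv v p).
Proof. by rewrite /= (ghomK bV). Qed.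

Lemma low_GL_poly c : coordfun c -> polyfun (X := aff K (low_index lv)) (c \o low_GL).
Proof.
case=> c' c'c ->; apply: (polyfun_endo bV (S := aff K (low_index lv))
  (h := fun v => ghom b co (fun p => funi (low_mat lv v p)))) c'c => e y x.
under eq_fun do rewrite (ghomK bV); apply: polyfun_funi => a a'.
exact: polyfun_low_mat.
Qed.

Lemma polyfun_GL_entry p y x : polyfun (X := GL V) (fun g => gm (sval g) p y x).
Proof.
apply: (polyfun_gentry (S := GL V)) => c cc.
by apply: polyfun_coord; exists c.
Qed.

Definition in_bigcell (g : GL V) : Prop := forall p, bigdet (lv p) (gm (sval g) p) != 0.

(** In the big cell, [g = (1 + cell_low g) cell_par g] is the factorization into a unipotent and a
    parabolic element, and [cell_parV g] is the inverse of the latter. *)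
Definition cell_low (g : GL V) : emat K X := fun p => linv (lv p) (bigsol (lv p) (gm (sval g) p)).
Definition cell_par (g : GL V) : emat K X :=
  fun p => funi (bigsol (lv p) (gm (sval g) p)) ** gm (sval g) p.
Arguments cell_low : clear implicits.
Arguments cell_par : clear implicits.
Definition cell_parV (g : GL V) : emat K X := fun p => gm (ginv (sval g)) p ** funi (cell_low g p).

Arguments cell_parV : clear implicits.

Lemma cell_low_lowtri g : lowtri_mat lv (cell_low g).
Proof. by move=> p; apply/linv_lowtri/bigsol_lowtri. Qed.

Lemma cell_par_inv g p : cell_par g p ** cell_parV g p = @fone K (X p).
Proof.
rewrite /cell_par /cell_parV -!fmulA [gm _ p ** _]fmulA (gmatV bV) fmul1.
by apply: funi_linvr; exact: bigsol_lowtri.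
Qed.

Lemma cell_par_upper g : in_bigcell g -> forall p, upper (lv p) (lv p) (cell_par g p).
Proof. by move=> gD p; exact: bigsol_upper. Qed.

Lemma in_bigcell_low v : in_bigcell (low_GL v) /\ cell_low (low_GL v) = low_mat lv v.
Proof.
have ml p := low_mat_lowtri v (p := p).
split; first by move=> p; rewrite gmat_low_GL; exact: (bigsol_funi (ml p)).1.
by apply: ematP => p; rewrite /cell_low gmat_low_GL (bigsol_funi (ml p)).2 linvK.
Qed.

Lemma in_bigcell_par g g' h : parabolic W h -> sval g' = gmul (sval g) (ginv (sval h)) ->
  in_bigcell g -> in_bigcell g' /\ cell_low g' = cell_low g.
Proof.
move=> /(parabolicP bV bW coW) hu gE gD.
have E p := bigdet_upperM (gmatV bV g p) (upper_inv (hu p) (gmatV bV h p)) (gmatVl bV h p) (gD p).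
have g'E p : gm (sval g') p = gm (sval g) p ** gm (ginv (sval h)) p by rewrite gE (gmatM bV).
split=> [p|]; first by rewrite g'E; exact: (E p).1.
by apply: ematP => p; rewrite /cell_low g'E (E p).2.
Qed.

Definition par_GL (g : GL V) : GL V := mkGL bV (cell_par_inv g).

Lemma par_GL_parabolic g : in_bigcell g -> parabolic W (par_GL g).
Proof.
move=> gD; apply/(parabolicP bV bW coW) => p; rewrite /= (ghomK bV).
exact: cell_par_upper.
Qed.

Lemma low_GL_cell g :
  sval (low_GL (low_vec (lv := lv) (cell_low g))) = gmul (sval g) (ginv (sval (par_GL g))).
Proof.
apply: (gmat_inj bV); apply: ematP => p.
rewrite gmat_low_GL low_vecK; last exact: cell_low_lowtri.
by rewrite (gmatM bV) mkGLV /cell_parV fmulA (gmatV bV) fmul1.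
Qed.

Lemma polyfun_bigcell : polyfun (X := GL V) (fun g => \prod_p bigdet (lv p) (gm (sval g) p)).
Proof.
by apply: polyfun_prod => p; apply: polyfun_bigdet => x y; exact: polyfun_GL_entry.
Qed.

Lemma in_bigcellE g : in_bigcell g <-> \prod_p bigdet (lv p) (gm (sval g) p) != 0.
Proof.
split=> [h|/prodf_neq0 h p]; last exact: h.
by apply/prodf_neq0 => p _; exact: h.
Qed.

Definition GP_chart (v : low_index lv -> K) : GP W :=
  \pi_({eq_quot EquivRelPack (GP_equiv W)}) (low_GL v).

(** A coset in the big cell contains exactly one element [1 + m], and by Cramer's rule [m] is a
    regular function on the cell. *)
Lemma GP_chartP : is_fchart GP_chart.
Proof.
move=> N e e' eK eK'.
apply: (@chart_from_section K (GL V) (GP W) \pi_({eq_quot EquivRelPack (GP_equiv W)}) _ _ _ _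
  (low_index lv) low_GL in_bigcell (fun g => low_vec (cell_low g))) eK eK' => //.
- by move=> x; exists (repr x); exact: reprK.
- exact: parametrized_irreducible (parametrized_GL bV).
- exact: low_GL_poly.
- rewrite zariski_openE => g /in_bigcellE gD.
  exists (fun g => \prod_p bigdet (lv p) (gm (sval g) p)); split=> //.
    exact: polyfun_bigcell.
  by move=> h /in_bigcellE.
- move=> j; apply: regular_linv => x y; apply: regular_bigsol => //.
  by move=> ? ?; exact: polyfun_GL_entry.
- by move=> v; exact: (in_bigcell_low v).1.
- by move=> v; rewrite (in_bigcell_low v).2 low_matK.
- move=> g gD; apply/esym/eqmodP/asboolP.
  by exists (par_GL g); [exact: par_GL_parabolic|exact: low_GL_cell].
move=> g g' gD /eqmodP/asboolP[h Ph gE]; have [? ->] := in_bigcell_par Ph gE gD.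
by [].
Qed.

Definition GPC_section (v : chart_index lv -> K) : prod_space (GL V) (Cplus W) :=
  (low_GL (v \o inl), up_chart (v \o inr)).

Definition GPC_chart (v : chart_index lv -> K) : GPC W :=
  \pi_({eq_quot EquivRelPack (GPC_equiv W)}) (GPC_section v).

(** If [g = (1 + m) q] is the factorization of an element of the big cell, the class of [(g, y)] has
    the normal form [(1 + m, q y)]; this is its second component, with [q] acting by conjugation. *)
Definition cell_rep (x : prod_space (GL V) (Cplus W)) : rmat K X := fun e =>
  cell_par x.1 (ta e) ** rm (sval x.2) e ** cell_parV x.1 (ia e).

Lemma cell_rep_upper x : in_bigcell x.1 -> upper_mat lv (cell_rep x).
Proof.
move=> xD e; have pu := cell_par_upper xD.
have pv := upper_inv (pu (ia e)) (cell_par_inv x.1 (ia e)).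
by have := upperM (upperM (pu (ta e)) (Cplus_upper x.2 (e := e))) pv.
Qed.

Lemma cell_rep_gact x : in_bigcell x.1 ->
  rhom (cell_rep x) = gact (sval (par_GL x.1)) (sval x.2).
Proof.
move=> xD; rewrite -[RHS](rep_matK bV); congr (rhom _); apply: rmatP => e.
by rewrite (rep_mat_gact bV) mkGLV /= (ghomK bV).
Qed.

Lemma GPC_section_cell x : in_bigcell x.1 ->
  GPC_rel x (GPC_section (chart_vec (lv := lv) (cell_low x.1) (cell_rep x))).
Proof.
move=> xD; apply/asboolP; exists (par_GL x.1); first exact: par_GL_parabolic.
split; first exact: low_GL_cell.
rewrite -cell_rep_gact //=; congr (rhom _).
by apply: up_vecK; exact: cell_rep_upper.
Qed.

Lemma GPC_chartP : is_fchart GPC_chart.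
Proof.
move=> N e e' eK eK'.
pose D : set (zariski (prod_space (GL V) (Cplus W))) := [set x | in_bigcell x.1].
have pg p y x : polyfun (X := prod_space (GL V) (Cplus W)) (fun z => gm (sval z.1) p y x).
  apply: (@polyfun_comp _ (prod_space (GL V) (Cplus W)) (GL V) fst
    (fun g => gm (sval g) p y x)); last exact: polyfun_GL_entry.
  by move=> c cc; apply: polyfun_coord; left; exists c.
have py a y x : polyfun (X := prod_space (GL V) (Cplus W)) (fun z => rm (sval z.2) a y x).
  apply: (@polyfun_comp _ (prod_space (GL V) (Cplus W)) (Cplus W) snd
    (fun g => rm (sval g) a y x)); last exact: polyfun_Cplus_entry.
  by move=> c cc; apply: polyfun_coord; right; exists c.
have rs p y x : affine_regular D (fun z => bigsol (lv p) (gm (sval z.1) p) y x).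
  by apply: regular_bigsol => // z; exact.
have rl p y x : affine_regular D (fun z => cell_low z.1 p y x) by apply: regular_linv.
have ru p (m : zariski (prod_space (GL V) (Cplus W)) -> emat K X) y x :
    (forall y x, affine_regular D (fun z => m z p y x)) ->
    affine_regular D (fun z => funi (m z p) y x).
  move=> h; apply: regularD => //; apply: regular_polyfun; exact: polyfun_cst.
apply: (@chart_from_section K _ (GPC W) \pi_({eq_quot EquivRelPack (GPC_equiv W)}) _ _ _ _
  (chart_index lv) GPC_section D (fun x => chart_vec (cell_low x.1) (cell_rep x))) eK eK' => //.
- by move=> x; exists (repr x); exact: reprK.
- apply: parametrized_irreducible; apply: parametrized_prod parametrized_Cplus.
  exact: parametrized_GL bV.
- move=> _ [[c cc ->]|[c cc ->]].
    apply: (@polyfun_comp _ (aff K (chart_index lv)) (aff K (low_index lv))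
      (fun v => v \o inl) (c \o low_GL)); last exact: low_GL_poly.
    by move=> _ [j ->]; exact: (@polyfun_aff _ (chart_index lv) (inl j)).
  apply: (@polyfun_comp _ (aff K (chart_index lv)) (aff K (up_index lv))
    (fun v => v \o inr) (c \o up_chart)); last exact: up_chart_poly.
  by move=> _ [j ->]; exact: (@polyfun_aff _ (chart_index lv) (inr j)).
- rewrite zariski_openE => z /in_bigcellE zD.
  exists (fun z => \prod_p bigdet (lv p) (gm (sval z.1) p)); split=> //.
    by apply: polyfun_prod => p; apply: polyfun_bigdet => y x; exact: pg.
  by move=> h /in_bigcellE.
- case=> [i|r]; first exact: rl.
  apply: regular_fmul => [y x|y x].
    apply: regular_fmul => [y' x'|y' x']; last exact: regular_polyfun.
    apply: regular_fmul => [y1 x1|y1 x1]; last exact: regular_polyfun.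
    exact: (ru _ (fun z p => bigsol (lv p) (gm (sval z.1) p))).
  apply: regular_fmul => [y1 x1|y1 x1]; last exact: (ru _ (fun z => cell_low z.1)).
  (* The inverse of [g] is replaced by Cramer's formula, which is visibly regular. *)
  apply: (@eq_regular K (prod_space (GL V) (Cplus W)) D (fun z => fminv (gm (sval z.1) (ia (tag (val r)))) y1 x1)).
    by move=> z _; rewrite (sdet_inv (gmatV bV z.1 _)).2.
  by apply: regular_fminv => // z _; exact: (sdet_inv (gmatV bV z.1 _)).1.
- by move=> v; exact: (in_bigcell_low (v \o inl)).1.
- move=> v; have [vD vl] := in_bigcell_low (v \o inl).
  have q1 p : cell_par (low_GL (v \o inl)) p = @fone K (X p).
    have ml := low_mat_lowtri (v \o inl) (p := p).
    by rewrite /cell_par gmat_low_GL (bigsol_funi ml).2 funi_linvl.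
  have q2 p : cell_parV (low_GL (v \o inl)) p = @fone K (X p).
    by have := cell_par_inv (low_GL (v \o inl)) p; rewrite q1 fmul1.
  rewrite -[RHS]chart_vecE /= vl; congr chart_vec.
  by apply: rmatP => a; rewrite /cell_rep q1 q2 fmul1 fmulr1 /= (rep_homK bV).
- by move=> x xD; apply/esym/eqmodP; exact: GPC_section_cell.
case=> [g y] [g' y'] gD /eqmodP/asboolP[h Ph [/= gE yE]].
have {}gD : in_bigcell g by exact: gD.
have {}gE : sval g' = gmul (sval g) (ginv (sval h)) by exact: gE.
have [gD' cE] := in_bigcell_par Ph gE gD.
split; [exact: gD'|rewrite [cell_low g']cE; congr chart_vec].
apply: rmatP => a.
(* Since [linv] is an involution on strictly lower matrices, equal [cell_low] give equal
   [bigsol]. *)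
have bE p : bigsol (lv p) (gm (sval g') p) = bigsol (lv p) (gm (sval g) p).
  have := congr1 (fun m : emat K X => linv (lv p) (m p)) cE.
  by rewrite /cell_low !linvK //; exact: bigsol_lowtri.
have pE p : cell_par g' p = cell_par g p ** gm (ginv (sval h)) p.
  by rewrite /cell_par bE gE (gmatM bV) fmulA.
have pVE p : cell_parV g' p = gm (sval h) p ** cell_parV g p.
  have h1 : cell_par g' p ** (gm (sval h) p ** cell_parV g p) = @fone K (X p).
    rewrite pE -fmulA [gm _ p ** (_ ** _)]fmulA (gmatVl bV) fmul1; exact: cell_par_inv.
  have h2 := fmul_right_inv (cell_par_inv g' p).
  by rewrite -[LHS]fmulr1 -h1 fmulA h2 fmul1.
rewrite /cell_rep /= pE pVE yE (rep_mat_gact bV) -!fmulA.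
rewrite [gm (ginv _) (ta a) ** (gm _ (ta a) ** _)]fmulA (gmatVl bV) fmul1.
by rewrite [gm (ginv _) (ia a) ** (gm _ (ia a) ** _)]fmulA (gmatVl bV) fmul1.
Qed.

Lemma eta_GPC_chart v : Defs.eta (GPC_chart v) = rep_chart (chart_map v).
Proof.
rewrite /GPC_chart eta_pi /rep_chart -[LHS](rep_matK bV); congr (rhom _); apply: rmatP => e.
by rewrite (rep_mat_gact bV) mkGLV /= (ghomK bV) (rep_homK bV).
Qed.

(** A point of the image carries a flag given by some [g], not necessarily in the big cell; this is
    the form that [generic_in_chart] accepts. *)
Lemma eta_range (u : Rep V) : range (@Defs.eta K Q V s W) u ->
  exists (g : GL V) (w : rmat K X), upper_mat lv w /\
    forall e, rm u e ** gm (sval g) (ia e) = gm (sval g) (ta e) ** w e.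
Proof.
case=> x _ <-; rewrite -[x]reprK; case: (repr x) => g y; rewrite eta_pi.
exists g, (rm (sval y)); split; first exact: Cplus_upper.
by move=> e; rewrite (rep_mat_gact bV) -fmulA (gmatVl bV) fmulr1.
Qed.

End SpaceCharts.

(** * The degree of eta *)

Section Degree.
Variables (K : closedFieldType) (Q : quiver) (V : vertex Q -> vectType K).
Hypothesis char0 : [pchar K] =i pred0.
Variables (X : vertex Q -> finType) (b : forall p, X p -> V p).
Variable co : forall p, X p -> 'Hom(V p, K^o).
Arguments b : clear implicits.
Arguments co : clear implicits.
Hypothesis bV : forall p, is_coord (b p) (co p).

Lemma generic_rep (h : (rep_index X -> K) -> K) (P : set (Rep V)) :
  nonzero_poly h -> (forall u, h (flat (rep_mat b co u)) != 0 -> P u) ->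
  generically (P : set (affine (Rep V))).
Proof.
move=> [ph [u0 hu0]] hP.
pose f (u : Rep V) := h (flat (rep_mat b co u)).
have pf : polyfun f.
  apply: (@polyfun_comp _ (Rep V) (aff K (rep_index X)) (fun u => flat (rep_mat b co u)) h) => //.
  move=> _ [r ->]; apply: (polyfun_entry (h := id)) => c; exact: polyfun_coord.
exists [set u | f u != 0]; split=> //; first by rewrite zariski_openE => u fu; exists f.
by exists (rep_hom b co (rep_at u0)); rewrite /= /f (rep_homK bV) flatK.
Qed.

Variables (s : nat) (W : forall p, 'I_s -> {vspace V p}) (lvs : forall p, X p -> 'I_s).
Arguments W : clear implicits.
Arguments lvs : clear implicits.
Hypothesis bW : forall p x, b p x \in W p (lvs p x).
Hypothesis coW : forall p i v x, v \in W p i -> lvs p x != i -> co p x v = 0.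
Local Notation lv := (lev lvs).
Hypothesis card_chart : #|chart_index lv| = #|rep_index X|.

(** The charts have [low_index] and [up_index] as coordinates, so the claim is the numerical
    identity [card_chart]. *)
Lemma delta_eta0 : delta_eta W = 0.
Proof.
rewrite /delta_eta (fchart_vdim (rep_chartP bV)) (fchart_vdim (GP_chartP bV bW coW)).
rewrite (fchart_vdim (up_chartP bV bW coW)) -card_chart card_sum PoszD.
by rewrite addrAC addrK subrr.
Qed.

Lemma d_eta_count n :
  generic_card (fun u => [set v : chart_index lv -> K | chart_map v = u]) n -> d_eta W = n.
Proof.
move=> cn; have [n' [cn' _]] := fibre_dichotomy char0 (@chart_map_poly K Q X lv) card_chart.
rewrite -(generic_card_uniq cn cn') => deg {n' cn'}.
have [h h0 hn] := generic_in_chart cn.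
(* If [n = 0] and [eta] were dominant, a general [u] would lie in its image; by [generic_in_chart]
   the flag it carries would yield a point of an empty fibre. Hence [d_eta] takes its default value
   0. *)
have [n0|n_gt0] := posnP n.
  rewrite /d_eta n0; case: asboolP => // -[_ dom].
  have [O [oO O0 OP]] := generic_rep h0 (fun u hu => hu).
  have [u [Ou ru]] := dom O O0 oO.
  have [g [w [wu uw]]] := eta_range bV bW coW ru.
  have [[x [_ xE]] in_chart] := hn _ (OP u Ou).
  have [v [vu _]] := in_chart _ _ w (gmatV bV g) wu uw.
  by have [[i lt_in] _] := (xE v).1 vu; move: (lt_in); rewrite {1}n0.
have {}deg d : has_degree (@Defs.eta K Q V s W) d <-> d = n.
  apply: (deg n_gt0 _ _ _ _ _ (GPC_chartP bV bW coW) (rep_chartP bV)).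
  exact: eta_GPC_chart.
(* Every non-empty open set contains a representation that is general for [h], and over it the fibre
   has [n > 0] points. *)
have dom : dominant (@Defs.eta K Q V s W).
  move=> O [u Ou] oO; have [f [pf fu fO]] := oO u Ou.
  have [_ [u']] : nonzero_poly (fun t => h t * f (rep_hom b co (rep_at t))).
    apply: nonzero_polyM => //; split.
      apply: (@polyfun_comp _ (aff K (rep_index X)) (Rep V) (fun t => rep_hom b co (rep_at t)) f) => //.
      move=> c; apply: (polyfun_rep bV (S := aff K (rep_index X))) => e y x.
      by under eq_fun do rewrite (rep_homK bV); exact: polyfun_aff.
    by exists (flat (rep_mat b co u)); rewrite (_ : rep_hom _ _ _ = u) //; exact: (rep_matK bV).
  rewrite mulf_eq0 negb_or => /andP[hu' fu']; have [[x [_ xE]] _] := hn _ hu'.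
  exists (rep_chart b co u'); split; first exact: fO.
  exists (GPC_chart bV bW coW (x (Ordinal n_gt0))) => //.
  by rewrite eta_GPC_chart; congr rep_chart; apply/xE; exists (Ordinal n_gt0).
rewrite /d_eta asboolT; last by split=> //; exact: delta_eta0.
by case: xgetP => [d _ /deg//|/(_ n)[]]; apply/deg.
Qed.

End Degree.

(** * Counting subrepresentations *)

Local Open Scope card_scope.

Lemma has_card_card_eq T (A : set T) n : has_card A n -> A #= `I_n.
Proof.
move=> [f [f_inj fA]]; case: n f f_inj fA => [|n] f f_inj fA.
  have -> : A = set0 by apply/seteqP; split=> // t /fA[[]].
  by rewrite II0.
have -> : A = (fun k => f (inord k)) @` `I_n.+1.
  apply/seteqP; split=> [t /fA[i ->]|_ [k _ <-]]; last by apply/fA; exists (inord k).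
  by exists i => //=; rewrite inord_val.
apply: inj_card_eq => j k; rewrite !inE => jn kn /f_inj/(congr1 val).
by rewrite /= !inordK.
Qed.

Lemma vbasis_subv (K : fieldType) (V : vectType K) (U T : {vspace V}) :
  (forall i, (i < \dim U)%N -> (vbasis U)`_i \in T) -> (U <= T)%VS.
Proof.
move=> h; apply: (@subv_trans _ _ <<vbasis U>>%VS); first by rewrite (span_basis (vbasisP U)).
by apply/span_subvP => v /(nthP 0)[i]; rewrite size_tuple => iU <-; exact: h.
Qed.

Lemma is_coord_dim (K : fieldType) (V : vectType K) (X : finType) :
  #|X| = \dim {:V} -> exists b co, is_coord (b : X -> V) co.
Proof.
move=> cX; pose b (x : X) : V := (vbasis {:V})`_(enum_rank x).
have [|co h] := @is_coord_exists K V X b _ cX; last by exists b, co.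
apply: vbasis_subv => i iV; have iX : (i < #|X|)%N by rewrite cX.
apply: memv_span.
by apply/codomP; exists (enum_val (Ordinal iX)); rewrite /b enum_valK.
Qed.

Lemma coord_choice (K : fieldType) (I : Type) (V : I -> vectType K) (X : I -> finType)
    (P : forall i, (X i -> V i) -> (X i -> 'Hom(V i, K^o)) -> Prop) :
  (forall i, exists b co, P i b co) -> exists b co, forall i, P i (b i) (co i).
Proof.
move=> h; pose hb i := cid (h i); pose hco i := cid (projT2 (hb i)).
by exists (fun i => projT1 (hb i)), (fun i => projT1 (hco i)) => i; exact: projT2 (hco i).
Qed.

Section StandardSubspace.
Variables (K : fieldType) (A B : finType) (V : vectType K).
Variables (b : A + B -> V) (co : A + B -> 'Hom(V, K^o)).
Hypothesis bV : is_coord b co.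

Definition std : {vspace V} := <<codom (b \o inl)>>%VS.

Lemma stdP v : reflect (forall y, co (inr y) v = 0) (v \in std).
Proof.
apply: (iffP idP) => [|h].
  move/coord_span => -> y; rewrite linear_sum big1 // => i _.
  rewrite linearZ /=; have /codomP[x ->] : (codom_tuple (b \o inl))`_i \in codom (b \o inl).
    by apply: mem_nth; rewrite size_tuple.
  by rewrite /= bV.2 [_ *: _]mulr0.
rewrite (bV.1 v) big_sumType /= [X in _ + X]big1 ?addr0 => [|y _]; last by rewrite h scale0r.
by apply: memv_suml => x _; apply/memvZ/memv_span/codomP; exists x.
Qed.

Lemma std_dim : \dim std = #|A|.
Proof.
rewrite /std; apply/eqP; have -> : #|A| = size (codom (b \o inl)).
  by rewrite size_codom.
change (free (codom_tuple (b \o inl))).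
apply/freeP => k k0 i; have := congr1 (co (inl (enum_val i))) k0.
rewrite linear0 linear_sum (bigD1 i) //= big1 => [|j ji].
  rewrite addr0 linearZ /= /codom /image_mem (nth_map (enum_val i)) -?cardE //.
  by rewrite -enum_val_nth /= bV.2 eqxx [_ *: _]mulr1.
rewrite linearZ /= /codom /image_mem (nth_map (enum_val j)) -?cardE //.
rewrite -enum_val_nth /= bV.2 (inj_eq (@inl_inj A B)) (inj_eq enum_val_inj).
by rewrite eq_sym (negPf ji) [_ *: _]mulr0.
Qed.

End StandardSubspace.

Lemma upper_std (K : fieldType) (A B A' B' : finType) (V V' : vectType K)
    (b : A + B -> V) (co : A + B -> 'Hom(V, K^o))
    (b' : A' + B' -> V') (co' : A' + B' -> 'Hom(V', K^o)) (f : 'Hom(V, V')) :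
  is_coord b co -> is_coord b' co' ->
  (f @: std b <= std b')%VS <-> upper (@coarse_level A' B') (@coarse_level A B) (mat b co' f).
Proof.
move=> bV bV'; split=> [h [a|y] [x|z] //= _|h].
  have /(stdP bV') fx : f (b (inl x)) \in std b'.
    by apply: (subvP h); apply/memv_img/memv_span/codomP; exists x.
  exact: fx.
apply/subvP => _ /memv_imgP[v /(stdP bV) vS ->]; apply/(stdP bV') => y.
rewrite (coord_eval _ bV) big_sumType /= !big1 ?addr0 // => [z _|x _]; first by rewrite vS mulr0.
by rewrite h ?mul0r.
Qed.

(** A basis of [U] followed by a basis of a complement is the image of [b] under [g]. *)
Lemma std_move (K : fieldType) (A B : finType) (V : vectType K) (b : A + B -> V) co
    (U : {vspace V}) : is_coord b co -> #|{: A + B}| = \dim {:V} -> \dim U = #|A| ->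
  exists2 g : 'End(V), lker g == 0%VS & (g @: std b)%VS = U.
Proof.
move=> bV dV dU.
have dC : \dim (U^C)%VS = #|B|.
  by rewrite dimv_compl -dV card_sum dU addKn.
pose b' (x : A + B) : V := match x with
  | inl x => (vbasis U)`_(enum_rank x) | inr y => (vbasis (U^C)%VS)`_(enum_rank y) end.
have [|co' bV'] := @is_coord_exists K V _ b' _ dV.
  rewrite -(addv_complf U) subv_add; apply/andP; split.
    apply: vbasis_subv => i iU; have iX : (i < #|A|)%N by rewrite -dU.
    apply/memv_span/codomP.
    by exists (inl (enum_val (Ordinal iX))); rewrite /= enum_valK.
  apply: vbasis_subv => i iU; have iX : (i < #|B|)%N by rewrite -dC.
  apply/memv_span/codomP.
  by exists (inr (enum_val (Ordinal iX))); rewrite /= enum_valK.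
pose g := homm co b' (@fone K (A + B)%type).
have gb x : g (b x) = b' x.
  have := hommE co b' (@fone K (A + B)%type) (b x); rewrite -/g => ->.
  rewrite [RHS](bV'.1 (b' x)); apply: eq_bigr => y _; congr (_ *: _).
  rewrite bV'.2 (bigD1 y) //= /fone eqxx mul1r big1 ?addr0 ?bV.2 // => z.
  by rewrite eq_sym => /negPf ->; rewrite mul0r.
have g0 : lker g == 0%VS.
  apply/lker0P; apply: (can_inj (g := homm co' b (@fone K (A + B)%type))) => v.
  rewrite -comp_lfunE -(homm_comp _ _ bV bV' bV) fmul1.
  by rewrite -(mat_id bV) (matK bV bV) id_lfunE.
exists g => //; apply/eqP; rewrite eqEdim; apply/andP; split.
  rewrite /std limg_span; apply/span_subvP => _ /mapP[_ /codomP[x ->] ->].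
  rewrite /= gb /=; apply: vbasis_mem; apply: mem_nth.
  by rewrite size_tuple dU.
by rewrite limg_dim_eq ?(eqP g0) ?capv0 // (std_dim bV) dU.
Qed.

Section Circ.
Variables (K : closedFieldType) (Q : quiver) (A B : vertex Q -> finType).
Let X p : finType := (A p + B p)%type.

(** The correspondence sends a point of the two-step chart to the image of the standard subspace
    under [1 + m]; it is injective by [upper_quot_eq]. Conversely a subrepresentation is the image
    of the standard subspace under some [g], which for general [u] is in the big cell by
    [generic_in_chart]. *)
Lemma circ_count n :
  generic_card (fun u => [set v : chart_index (@coarse Q A B) -> K | chart_map v = u]) n ->
  circ K (fun p => #|A p|) (fun p => #|B p|) = n.
Proof.
move=> cn; pose V p : vectType K := 'cV[K]_(#|A p| + #|B p|).
have dV p : #|X p| = \dim {:V p} by rewrite card_sum dimvf /dim /= muln1.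
have [b [co bV]] := coord_choice (fun p => is_coord_dim (dV p)).
have [h h0 hn] := generic_in_chart cn.
pose lc := @coarse Q A B.
pose M (v : chart_index lc -> K) : forall p, {vspace V p} :=
  fun p => (homm (co p) (b p) (funi (chart_low lc v p)) @: std (b p))%VS.
have count (u : Rep V) : h (flat (rep_mat b co u)) != 0 ->
    subreps u (fun p => #|A p|) #= `I_n.
  move=> /hn[card_u in_chart]; apply: has_card_card_eq.
  apply: (has_card_image (f := M)) card_u => [v v' /= vu v'u e|U].
    apply: chart_map_inj; first by rewrite vu v'u.
    apply: ematP => p.
    have ml := low_mat_lowtri (v \o inl) (p := p).
    have ml' := low_mat_lowtri (v' \o inl) (p := p).
    have up : upper (@coarse Q A B p) (@coarse Q A B p)
        (funi (linv (@coarse Q A B p) (chart_low lc v' p)) ** funi (chart_low lc v p)).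
      rewrite -[_ ** _](mat_homm (bV p) (bV p)); apply/(upper_std _ (bV p) (bV p)).
      rewrite (homm_comp _ _ (bV p) (bV p) (bV p)) limg_comp.
      rewrite [X in (_ @: X)%VS](congr1 (fun M : forall p, {vspace V p} => M p) e).
      rewrite /M -limg_comp -(homm_comp _ _ (bV p) (bV p) (bV p)) (funi_linvl ml').
      by rewrite -(mat_id (bV p)) (matK (bV p) (bV p)) lim1g.
    exact: upper_quot_eq ml' ml up.
  have mE (v : chart_index lc -> K) p : funi (chart_low lc v p) **
      funi (linv (@lc p) (chart_low lc v p)) = @fone K (X p).
    by apply: funi_linvr; exact: low_mat_lowtri.
  split=> [[dU stU]|[v vu <-]]; last first.
    split=> [p|e].
      rewrite /M limg_dim_eq ?(std_dim (bV p)) //.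
      by rewrite (eqP (lker_homm (bV p) (mE v p))) capv0.
    rewrite /M -limg_comp.
    have -> : (u e \o homm (co (ia e)) (b (ia e)) (funi (chart_low lc v (ia e))) =
        homm (co (ta e)) (b (ta e)) (funi (chart_low lc v (ta e))) \o
        homm (co (ia e)) (b (ta e)) (chart_up lc v e))%VF.
      apply: (mat_inj (bV (ia e)) (bV (ta e))); rewrite !(mat_comp _ _ _ (bV _) (bV _)).
      by rewrite !(mat_homm (bV _) (bV _)); have /chart_mapP/(_ e) := vu.
    rewrite limg_comp; apply: limgS; apply/(upper_std _ (bV _) (bV _)).
    by rewrite (mat_homm (bV _) (bV _)); exact: up_mat_upper.
  have dVX p : #|{: A p + B p}| = \dim {:V p} by exact: dV.
  pose hg p := cid2 (std_move (bV p) (dVX p) (dU p)).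
  pose g : Endo V := fun p => s2val (hg p).
  have g0 p : lker (g p) == 0%VS by exact: s2valP (hg p).
  have gS p : (g p @: std (b p))%VS = U p by exact: s2valP' (hg p).
  clearbody g.
  pose G : GL V := exist (fun g : Endo V => forall p, lker (g p) == 0%VS) g g0.
  pose w e := (ginv g (ta e) \o (u e \o g (ia e)))%VF.
  have wu : upper_mat lc (rep_mat b co w).
    move=> e; apply/(upper_std _ (bV _) (bV _)); rewrite /w !limg_comp gS.
    apply: (subv_trans (limgS _ (stU e))); rewrite -gS -limg_comp.
    by rewrite lker0_compVf // lim1g.
  have [|v [vu qu]] := in_chart (gmat b co g) (gmat b co (ginv g)) _ (gmatV bV G) wu.
    move=> e; rewrite -[RHS](mat_comp _ _ _ (bV _) (bV _)) /w /ginv !comp_lfunA lker0_compfV //.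
    rewrite comp_lfun1l; exact/esym/(mat_comp _ _ _ (bV _) (bV _)).
  exists v => //; apply: functional_extensionality_dep => p.
  rewrite -gS /M; set m := chart_low lc v p.
  pose q := homm (co p) (b p) (funi (linv (@lc p) m) ** gmat b co g p).
  have gE : g p = (homm (co p) (b p) (funi m) \o q)%VF.
    rewrite -(homm_comp _ _ (bV p) (bV p) (bV p)) fmulA mE fmul1.
    by rewrite (matK (bV p) (bV p)).
  rewrite gE limg_comp; congr (_ @: _)%VS; apply/esym/eqP.
  rewrite eqEdim; apply/andP; split.
    by apply/(upper_std _ (bV p) (bV p)); rewrite (mat_homm (bV p) (bV p)); exact: qu.
  rewrite limg_dim_eq // (_ : lker q = 0%VS) ?capv0 //; apply/eqP/lker0P => x y qxy.
  by have /lker0P := g0 p; apply; rewrite gE !comp_lfunE qxy.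
have gen := generic_rep bV h0 count.
(* [circ] selects some number valid on a non-empty open set; two such sets meet, so this number is
   [n]. *)
rewrite /circ; case: xgetP => [k _ /= genk|/(_ n)[]//].
have [O1 [oO1 O10 O1P]] := gen; have [O2 [oO2 O20 O2P]] := genk.
have [u [u1 u2]] := irreducible_openI (parametrized_irreducible (parametrized_Rep bV)) oO1 oO2 O10 O20.
apply/card_eq_II; apply: card_eq_trans (O1P u u1); rewrite card_eq_sym; exact: O2P.
Qed.

End Circ.

(** * Iterated blocks *)

Lemma card_level_lt (A B : finType) s (la : A -> 'I_s) (lb : B -> 'I_s) :
  (\sum_(x : A) \sum_(y : B) (lb y < la x)%N =
   \sum_(i < s) \sum_(j < s | i < j) #|[pred y | lb y == i]| * #|[pred x | la x == j]|)%N.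
Proof.
transitivity (\sum_(i < s) \sum_(j < s) (i < j) *
    (#|[pred y | lb y == i]| * #|[pred x | la x == j]|))%N; last first.
  apply: eq_bigr => i _; rewrite [RHS]big_mkcond; apply: eq_bigr => j _.
  by case: (i < j)%N; rewrite ?mul1n ?mul0n.
rewrite [LHS](partition_big la predT) //= [RHS]exchange_big; apply: eq_bigr => j _.
under eq_bigr => x _ do rewrite (partition_big lb predT) //=.
rewrite exchange_big; apply: eq_bigr => i _ /=.
rewrite -!sum1_card big_distrlr /= exchange_big /= big_distrr /=.
apply: eq_bigr => x /eqP xj; rewrite big_distrr /=.
by apply: eq_bigr => y /eqP yi; rewrite xj yi !muln1.
Qed.

Section CardChart.
Variables (Q : quiver) (X : vertex Q -> finType) (s : nat) (lvs : forall p, X p -> 'I_s).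
Arguments lvs : clear implicits.

Definition level_card (i : 'I_s) (p : vertex Q) : nat := #|[pred x | lvs p x == i]|.

(** The lower entries at the vertices contribute the first sum of the Ringel form over all pairs of
    levels [i < j], and the entries at the arrows excluded from [up_index] contribute the second;
    the two agree pair by pair. *)
Lemma card_chart_index :
  (forall i j : 'I_s, (i < j)%N -> ringel (level_card i) (level_card j) = 0) ->
  #|chart_index (lev lvs)| = #|rep_index X|.
Proof.
move=> orth.
have lowE : #|low_index (lev lvs)| =
    (\sum_(i < s) \sum_(j < s | i < j) \sum_p level_card i p * level_card j p)%N.
  rewrite card_sig -sum1_card big_mkcond /=.
  rewrite -(@sig_big_dep _ _ _ _ (fun p => (X p * X p)%type) predT (fun _ _ => true)
    (fun p xy => if (lev lvs p xy.2 < lev lvs p xy.1)%N then 1%N else 0%N)) /=.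
  under [RHS]eq_bigr => i _ do rewrite exchange_big.
  rewrite [RHS]exchange_big; apply: eq_bigr => p _.
  by rewrite -(card_level_lt (lvs p) (lvs p)) pair_bigA.
have upE : (#|up_index (lev lvs)| + \sum_(i < s) \sum_(j < s | i < j)
    \sum_e level_card i (ia e) * level_card j (ta e) = #|rep_index X|)%N.
  rewrite card_sig -(cardC (up_pred (lev lvs))); congr addn.
  pose F (e : arrow Q) (xy : X (ta e) * X (ia e)) : nat := (lev lvs (ia e) xy.2 < lev lvs (ta e) xy.1)%N.
  transitivity (\sum_(r : rep_index X) F (tag r) (tagged r))%N; last first.
    rewrite -sum1_card [RHS]big_mkcond; apply: eq_bigr => r _.
    have -> : (r \in [predC up_pred (lev lvs)]) = ~~ up_pred (lev lvs) r by [].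
    by rewrite /F /up_pred -ltnNge; case: ltnP.
  rewrite -(@sig_big_dep _ _ _ _ (fun e : arrow Q => (X (ta e) * X (ia e))%type)
    predT (fun _ _ => true) F) /=.
  under eq_bigr => i _ do rewrite exchange_big.
  rewrite exchange_big; apply: eq_bigr => e _.
  rewrite -(card_level_lt (lvs (ta e)) (lvs (ia e))) pair_bigA.
  by [].
rewrite card_sum -upE lowE addnC; congr addn.
apply: eq_bigr => i _; apply: eq_bigr => j ij; have := orth i j ij.
rewrite /ringel => /eqP; rewrite subr_eq0 -!(big_morph Posz PoszD (erefl (Posz 0))).
by rewrite eqz_nat => /eqP.
Qed.

End CardChart.

Lemma ringel_suml (Q : quiver) (I : Type) (r : seq I) (a : I -> vertex Q -> nat) b :
  ringel (fun p => \sum_(i <- r) a i p)%N b = \sum_(i <- r) ringel (a i) b.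
Proof.
rewrite /ringel sumrB; congr (_ - _); rewrite [RHS]exchange_big; apply: eq_bigr => x _;
  by rewrite big_distrl /= (big_morph Posz PoszD (erefl (Posz 0))).
Qed.

Lemma ringel_sumr (Q : quiver) (I : Type) (r : seq I) a (b : I -> vertex Q -> nat) :
  ringel a (fun p => \sum_(i <- r) b i p)%N = \sum_(i <- r) ringel a (b i).
Proof.
rewrite /ringel sumrB; congr (_ - _); rewrite [RHS]exchange_big; apply: eq_bigr => x _;
  by rewrite big_distrr /= (big_morph Posz PoszD (erefl (Posz 0))).
Qed.

Lemma card_coarse (Q : quiver) (A B : vertex Q -> finType) :
  ringel (fun p => #|A p|) (fun p => #|B p|) = 0 ->
  #|chart_index (@coarse Q A B)| = #|rep_index (fun p => (A p + B p)%type : finType)|.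
Proof.
move=> h; pose lvs p (x : A p + B p) : 'I_2 := if x is inl _ then ord0 else ord_max.
have -> : @coarse Q A B = lev lvs.
  by apply: functional_extensionality_dep => p; apply/funext => -[].
apply: card_chart_index => i j ij.
have -> : i = ord0 by apply: val_inj; case: i j ij => [[|[]]] //= ? [[|[]]].
have -> : j = ord_max by apply: val_inj; case: i j ij => [[|[]]] //= ? [[|[]]].
rewrite -[RHS]h; congr ringel; apply/funext => p; rewrite /level_card -sum1_card big_mkcond;
  by rewrite big_sumType /= sum1_card big1 ?addn0 ?add0n ?sum1_card.
Qed.

Lemma flag_count_const (K : closedFieldType) (Q : quiver) (X : vertex Q -> finType)
    (lv : forall p, X p -> nat) :
  (forall p q (x : X p) (y : X q), lv p x = lv q y) -> flag_count K lv 1.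
Proof.
move=> lvE; exists (fun=> 1); first by split; [exact: polyfun_cst|exists (fun=> 0); exact: oner_neq0].
move=> u _; exists (fun=> fun p _ _ => 0); split; first by move=> i j; rewrite !ord1.
move=> m; split=> [[ml _]|[_ ->]].
  by exists ord0; apply: ematP => p; apply: fmatP => x y; apply: ml; rewrite (lvE p p x y).
split=> //; exists (rep_at u) => [e x y|e]; first by rewrite (lvE _ _ x y) ltnn.
by rewrite !funi0 fmul1 fmulr1.
Qed.

Section Nested.
Variables (K : closedFieldType) (Q : quiver).
Hypothesis char0 : [pchar K] =i pred0.

Lemma flag_count_sum (A B : vertex Q -> finType) (lA : forall p, A p -> nat)
    (lB : forall p, B p -> nat) (lv : forall p, A p + B p -> nat) nA nB :
  (forall p q a a', (lv p (inl a) < lv q (inl a'))%N = (lA p a < lA q a')%N) ->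
  (forall p q b b', (lv p (inr b) < lv q (inr b'))%N = (lB p b < lB q b')%N) ->
  (forall p q a b, (lv p (inl a) < lv q (inr b))%N) ->
  ringel (fun p => #|A p|) (fun p => #|B p|) = 0 ->
  flag_count K lA nA -> flag_count K lB nB ->
  flag_count K (X := fun p => (A p + B p)%type : finType) lv
    (circ K (fun p => #|A p|) (fun p => #|B p|) * (nA * nB)).
Proof.
move=> h1 h2 h3 orth cA cB.
have [n [cn avoid _]] := fibre_dichotomy char0 (@chart_map_poly K Q _ _) (card_coarse orth).
by rewrite (circ_count cn); exact: flag_count_mul.
Qed.

(** Basis indices with the levels nested to the right, so that the outermost decomposition splits
    off the first level. *)
Fixpoint XR (g : nat -> vertex Q -> nat) n (p : vertex Q) : finType :=
  if n is n'.+1 then ('I_(g 0%N p) + XR (fun i => g i.+1) n' p)%type else void.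

Fixpoint lR g n p : XR g n p -> nat :=
  if n is n'.+1 then fun x => match x with inl _ => 0%N | inr y => (lR y).+1 end
  else fun=> 0%N.

(** The same levels nested to the left: the outermost decomposition splits off the last one. *)
Fixpoint XL (g : nat -> vertex Q -> nat) n (p : vertex Q) : finType :=
  if n is n'.+1 then (XL g n' p + 'I_(g n' p))%type else void.

Fixpoint lL g n p : XL g n p -> nat :=
  if n is n'.+1 then fun x => match x with inl y => lL y | inr _ => n' end
  else fun=> 0%N.

Arguments lR : clear implicits.
Arguments lL : clear implicits.

Lemma lR_lt g n p x : (lR g n p x < n)%N.
Proof. by elim: n g x => [|n IH] g [] //= x; rewrite ltnS. Qed.

Lemma lL_lt g n p x : (lL g n p x < n)%N.
Proof. by elim: n x => [|n IH] [] //= x; rewrite ltnW // ltnS. Qed.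

Lemma card_XR g n p : #|XR g n p| = (\sum_(0 <= i < n) g i p)%N.
Proof.
elim: n g => [|n IH] g /=; first by rewrite big_nil card_void.
by rewrite card_sum card_ord IH big_nat_recl.
Qed.

Lemma card_XL g n p : #|XL g n p| = (\sum_(0 <= i < n) g i p)%N.
Proof.
elim: n => [|n IH] /=; first by rewrite big_nil card_void.
by rewrite card_sum card_ord IH big_nat_recr.
Qed.

Lemma level_card_XR g n p i : (i < n)%N -> #|[pred x | lR g n p x == i]| = g i p.
Proof.
elim: n g i => // n IH g i; rewrite -sum1_card big_mkcond big_sumType /=.
case: i => [_|i i_n] /=.
  by rewrite sum1_card card_ord big1 ?addn0.
rewrite big1 // add0n -big_mkcond /= sum1_card -(IH (fun i => g i.+1) i) //.
Qed.

Lemma level_card_XL g n p i : (i < n)%N -> #|[pred x | lL g n p x == i]| = g i p.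
Proof.
elim: n => // n IH; rewrite ltnS leq_eqVlt -sum1_card big_mkcond big_sumType /=.
case/orP => [/eqP ->|i_n].
  rewrite big1 => [|x _]; last by rewrite inE /= (ltn_eqF (lL_lt x)).
  rewrite add0n (eq_bigr (fun=> 1%N)) => [|x _]; last by rewrite inE /= eqxx.
  by rewrite sum1_card card_ord.
rewrite [X in (_ + X)%N]big1 => [|x _]; last by rewrite inE /= gtn_eqF.
by rewrite addn0 -big_mkcond /= sum1_card IH.
Qed.

Lemma flag_count_XR g n :
  (forall i j, (i < j < n)%N -> ringel (g i) (g j) = 0) ->
  flag_count K (lR g n)
    (\prod_(i < n | i.+1 < n) circ K (g i) (fun p => \sum_(i.+1 <= j < n) g j p))%N.
Proof.
elim: n g => [|n IH] g orth; first by rewrite big_ord0; apply: flag_count_const => p q [].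
(* One level is a base case of its own: splitting it from an empty remainder would bring in a factor
   [g 0] against the zero vector, absent from the product. *)
case: n IH orth => [|n] IH orth.
  rewrite big_mkcond big_ord_recl big_ord0 /= muln1.
  by apply: flag_count_const => p q [x|[]] [y|[]].
have orth' i j : (i < j < n.+1)%N -> ringel (g i.+1) (g j.+1) = 0.
  by move=> ij; apply: orth.
have := IH _ orth'; set P := (\prod_(_ < _ | _) _)%N => cP.
have c0 : flag_count K (X := fun p => 'I_(g 0%N p)) (fun _ _ => 0%N) 1.
  exact: flag_count_const.
have := @flag_count_sum (fun p => 'I_(g 0%N p)) (XR (fun i => g i.+1) n.+1) _ _
  (lR g n.+2) _ _ _ _ _ _ c0 cP.
have -> : (\prod_(i < n.+2 | i.+1 < n.+2)
      circ K (g i) (fun p => \sum_(i.+1 <= j < n.+2) g j p) =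
    circ K (fun p => #|'I_(g 0 p)|) (fun p => #|XR (fun i => g i.+1) n.+1 p|) * (1 * P))%N.
  rewrite mul1n big_mkcond big_ord_recl /=; congr (_ * _)%N.
    congr circ; first by apply/funext => p; rewrite card_ord.
    apply/funext => p; rewrite big_add1; exact/esym/(card_XR (fun i => g i.+1) n.+1 p).
  rewrite /P [RHS]big_mkcond; apply: eq_bigr => i _; rewrite /bump /= ltnS; case: ifP => // _.
  by congr circ; apply/funext => p; rewrite big_add1.
apply=> //.
have -> : (fun p => #|'I_(g 0 p)|) = g 0%N by apply/funext => p; rewrite card_ord.
have -> : (fun p => #|XR (fun i => g i.+1) n.+1 p|) =
    fun p => (\sum_(i <- index_iota 0 n.+1) g i.+1 p)%N.
  by apply/funext => p; rewrite card_XR.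
rewrite ringel_sumr big_seq big1 // => j; rewrite mem_index_iota => /andP[_ jn].
by apply: orth.
Qed.

Lemma flag_count_XL g n :
  (forall i j, (i < j < n)%N -> ringel (g i) (g j) = 0) ->
  flag_count K (lL g n)
    (\prod_(i < n | 0 < i) circ K (fun p => \sum_(0 <= j < i) g j p) (g i))%N.
Proof.
elim: n => [|n IH] orth; first by rewrite big_ord0; apply: flag_count_const => p q [].
case: n IH orth => [|n] IH orth.
  rewrite big_mkcond big_ord_recl big_ord0 /= muln1.
  by apply: flag_count_const => p q [[]|x] [[]|y].
have orth' i j : (i < j < n.+1)%N -> ringel (g i) (g j) = 0.
  by move=> /andP[ij jn]; apply: orth; rewrite ij leqW.
have := IH orth'; set P := (\prod_(_ < _ | _) _)%N => cP.
have c0 : flag_count K (X := fun p => 'I_(g n.+1 p)) (fun _ _ => 0%N) 1.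
  exact: flag_count_const.
have := @flag_count_sum (XL g n.+1) (fun p => 'I_(g n.+1 p)) _ _
  (lL g n.+2) _ _ _ _ _ _ cP c0.
have -> : (\prod_(i < n.+2 | 0 < i) circ K (fun p => \sum_(0 <= j < i) g j p) (g i) =
    circ K (fun p => #|XL g n.+1 p|) (fun p => #|'I_(g n.+1 p)|) * (P * 1))%N.
  rewrite muln1 big_mkcond big_ord_recr /= mulnC; congr (_ * _)%N.
    congr circ; last by apply/funext => p; rewrite card_ord.
    by apply/funext => p; exact/esym/(card_XL g n.+1 p).
  by rewrite /P [RHS]big_mkcond; apply: eq_bigr => i _.
apply=> //.
- by move=> p q b b'; rewrite /= ltnn.
- by move=> p q a b; exact: (@lL_lt g n.+1 p a).
have -> : (fun p => #|'I_(g n.+1 p)|) = g n.+1 by apply/funext => p; rewrite card_ord.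
have -> : (fun p => #|XL g n.+1 p|) = fun p => (\sum_(i <- index_iota 0 n.+1) g i p)%N.
  by apply/funext => p; rewrite card_XL.
rewrite ringel_suml big_seq big1 // => j; rewrite mem_index_iota => /andP[_ jn].
by apply: orth; rewrite jn ltnSn.
Qed.

End Nested.

(** The bases of the [W i] together span, and by the dimension count they form a basis; a coordinate
    of another level then vanishes on the basis of [W i]. *)
Lemma adapted_coord (K : fieldType) (V : vectType K) s (W : 'I_s -> {vspace V})
    (X : finType) (lvs : X -> 'I_s) :
  (\sum_i W i)%VS = {:V}%VS -> #|X| = \dim {:V} ->
  (forall i, #|[pred x | lvs x == i]| = \dim (W i)) ->
  exists b co, [/\ is_coord (b : X -> V) co, forall x, b x \in W (lvs x) &
    forall i v x, v \in W i -> lvs x != i -> co x v = 0].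
Proof.
move=> Wsum cX cW.
pose L i : seq X := enum [pred x | lvs x == i].
pose b (x : X) : V := (vbasis (W (lvs x)))`_(index x (L (lvs x))).
have bE i k : (k < \dim (W i))%N -> exists2 y, lvs y = i & b y = (vbasis (W i))`_k.
  move=> kW; have kL : (k < size (L i))%N by rewrite -cardE cW.
  have [x0 _] : exists x0, x0 \in L i.
    by case: (L i) kL => // x0 r _; exists x0; rewrite mem_head.
  have := mem_nth x0 kL; rewrite mem_enum inE => /eqP yi.
  exists (nth x0 (L i) k) => //; rewrite /b yi index_uniq //; exact: enum_uniq.
have [|co bV] := @is_coord_exists K V X b _ cX.
  rewrite -Wsum; apply/subv_sumP => i _; apply: vbasis_subv => k kW.
  by have [y _ <-] := bE i k kW; apply/memv_span/codomP; exists y.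
exists b, co; split=> // [x|i v x vW xi].
  rewrite /b; apply/vbasis_mem/mem_nth; rewrite size_tuple -cW cardE index_mem.
  by rewrite mem_enum inE.
suff /subvP/(_ v vW) : (W i <= lker (co x))%VS by rewrite memv_ker => /eqP.
apply: vbasis_subv => k kW; have [y yi <-] := bE i k kW.
rewrite memv_ker bV.2; case: (eqVneq x y) xi => [->|_ _]; last exact: eqxx.
by rewrite yi eqxx.
Qed.

Section FlagDegree.
Variables (K : closedFieldType) (Q : quiver) (s : nat) (beta : 'I_s -> vertex Q -> nat).
Hypothesis char0 : [pchar K] =i pred0.
Hypothesis beta_orth : forall i j : 'I_s, (i < j)%N -> ringel (beta i) (beta j) = 0.
Variables (V : vertex Q -> vectType K) (W : forall p, 'I_s -> {vspace V p}).
Arguments W : clear implicits.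
Hypothesis dimV : forall p, \dim {:V p} = (\sum_i beta i p)%N.
Hypothesis W_sum : forall p, (\sum_i W p i)%VS = {:V p}%VS.
Hypothesis dimW : forall p i, \dim (W p i) = beta i p.

(** The index types are constrained only by the size of each level, while [d_eta W] does not involve
    them. Flag counts computed with different nestings are therefore equal. *)
Lemma d_eta_flag_count (X : vertex Q -> finType) (lvs : forall p, X p -> 'I_s) n :
  (forall p i, #|[pred x | lvs p x == i]| = beta i p) ->
  flag_count K (lev lvs) n -> delta_eta W = 0 /\ d_eta W = n.
Proof.
move=> cX cn.
have dX p : #|X p| = \dim {:V p}.
  rewrite dimV -sum1_card (partition_big (lvs p) predT) //=; apply: eq_bigr => i _.
  by rewrite sum1_card cX.
have cW p i : #|[pred x | lvs p x == i]| = \dim (W p i) by rewrite cX dimW.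
have [b [co bco]] := coord_choice (fun p => adapted_coord (W_sum p) (dX p) (cW p)).
have bV p : is_coord (b p) (co p) by have [] := bco p.
have bW p x : b p x \in W p (lvs p x) by have [_ + _] := bco p.
have coW p i v x : v \in W p i -> lvs p x != i -> co p x v = 0.
  by have [_ _ h'] := bco p; exact: h'.
have card_chart : #|chart_index (lev lvs)| = #|rep_index X|.
  apply: card_chart_index => i j ij; rewrite -[RHS](beta_orth ij).
  by congr ringel; apply/funext => p; exact: cX.
split; first exact: (delta_eta0 bV bW coW card_chart).
have [n' [cn' _ _]] := fibre_dichotomy char0 (@chart_map_poly K Q X (lev lvs)) card_chart.
rewrite (generic_card_uniq cn (flag_count_chart cn')).
exact: (d_eta_count char0 bV bW coW card_chart cn').
Qed.

End FlagDegree.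

Theorem theorem5 (K : closedFieldType) (char0 : [pchar K] =i pred0)
  (Q : quiver) (s : nat) (s_ge2 : (2 <= s)%N)
  (beta : 'I_s -> vertex Q -> nat)
  (beta_neq0 : forall i, exists p, beta i p != 0%N)
  (alpha : vertex Q -> nat)
  (alphaE : forall p, alpha p = (\sum_i beta i p)%N)
  (beta_orth : forall i j : 'I_s, (i < j)%N -> ringel (beta i) (beta j) = 0)
  (V : vertex Q -> vectType K)
  (dimV : forall p, \dim {:V p} = alpha p)
  (W : forall p, 'I_s -> {vspace V p})
  (W_sum : forall p, (\sum_i W p i)%VS = {:V p}%VS)
  (W_direct : forall p, directv (\sum_i W p i))
  (dimW : forall p i, \dim (W p i) = beta i p) :
  [/\ delta_eta W = 0,
      d_eta W =
        (\prod_(i < s | i.+1 < s)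
           circ K (beta i) (fun p => alpha p - \sum_(j < s | j <= i) beta j p))%N
    & d_eta W =
        (\prod_(i < s | 0 < i)
           circ K (fun p => alpha p - \sum_(j < s | i <= j) beta j p) (beta i))%N].
Proof.
have dimV' p : \dim {:V p} = (\sum_i beta i p)%N by rewrite dimV alphaE.
(* [beta] is extended by zero to all natural numbers, so that shifting the levels in the recursion
   involves no ordinals. *)
pose g (i : nat) : vertex Q -> nat := oapp beta (fun=> 0%N) (insub i).
have gE (i : 'I_s) : g i = beta i by rewrite /g valK.
have g_orth i j : (i < j < s)%N -> ringel (g i) (g j) = 0.
  move=> /andP[ij js]; have is_ := ltn_trans ij js.
  by rewrite (gE (Ordinal is_)) (gE (Ordinal js)); exact: beta_orth.
pose rlev p (x : XR g s p) : 'I_s := Ordinal (lR_lt x).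
pose llev p (x : XL g s p) : 'I_s := Ordinal (lL_lt x).
have cR p i : #|[pred x | rlev p x == i]| = beta i p.
  by rewrite -gE -(level_card_XR g p (ltn_ord i)); apply: eq_card.
have cL p i : #|[pred x | llev p x == i]| = beta i p.
  by rewrite -gE -(level_card_XL g p (ltn_ord i)); apply: eq_card.
have [d0 dR] := d_eta_flag_count char0 beta_orth dimV' W_sum dimW cR (flag_count_XR char0 g_orth).
have [_ dL] := d_eta_flag_count char0 beta_orth dimV' W_sum dimW cL (flag_count_XL char0 g_orth).
split; first exact: d0.
  rewrite dR; apply: eq_bigr => i _; rewrite gE; congr circ; apply/funext => p.
  (* Removing the levels up to [i] from [alpha] leaves the sum of the later ones, the form produced
     by the right nesting. *)
  rewrite alphaE (bigID (fun j : 'I_s => (j <= i)%N)) /= addKn big_geq_mkord.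
  by apply: eq_big => [j|j _]; rewrite ?gE // ltnNge.
rewrite dL; apply: eq_bigr => i _; rewrite gE; congr circ; apply/funext => p.
rewrite alphaE (bigID (fun j : 'I_s => (i <= j)%N)) /= addKn big_mkord.
rewrite (big_ord_widen s (fun j => g j p)); last exact: ltnW.
by apply: eq_big => [j|j _]; rewrite ?gE // -ltnNge.
Qed.
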